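(* Let $p,n\in\mathbb N$ and let $S=(s_{ik})\in\mathbb R^{p\times n}$ be a matrix with nonnegative entries. (i) If (A) holds true, then there is a unique holomorphic function $m\colon\mathbb H\to\mathbb C^p$ satisfying $$-\frac{1}{m(\zeta)}=\zeta-S\,\frac{1}{1+S^t m(\zeta)}\qquad\text{for all }\zeta\in\mathbb H$$ such that $\mathrm{Im}\, m(\zeta)>0$ for all $\zeta\in\mathbb H$. Moreover, there is a probability measure $\nu$ on $\mathbb R$ whose support is contained in $[0,4s_*]$ such that $$\langle m(\zeta)\rangle=\int_{\mathbb R}\frac{1}{\omega-\zeta}\,\nu(d\omega)\qquad\text{for all }\zeta\in\mathbb H.$$ (ii) Assume (A), (B) and (D). Then $\nu$ is absolutely continuous with respect to Lebesgue measure apart from a possible point mass at zero, i.e., there are a number $\pi_*\in[0,1]$ and a locally Hölder-continuous function $\pi\colon(0,\infty)\to[0,\infty)$ such that $$\nu(d\omega)=\pi_*\,\delta_0(d\omega)+\pi(\omega)\mathbf 1(\omega>0)\,d\omega .$$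
   Context: $\mathbb H=\{z\in\mathbb C:\mathrm{Im}\,z>0\}$. For vectors, products, reciprocals, imaginary parts and inequalities are understood componentwise, scalars are identified with constant vectors, and $\langle w\rangle=l^{-1}\sum_{i=1}^l w_i$ for $w\in\mathbb C^l$. $S^t$ is the transpose of $S$. (In the application $s_{ik}=\mathbb E|x_{ik}|^2$ for a $p\times n$ random matrix $X=(x_{ik})$ with independent centered entries.) Assumptions: (A) There is $s_*>0$ such that $s_{ik}\le \frac{s_*}{p+n}$ for all $i=1,\dots,p$, $k=1,\dots,n$. (B) There are $L_1,L_2\in\mathbb N$ and $\psi_1,\psi_2>0$ such that $[(SS^t)^{L_1}]_{ij}\ge\frac{\psi_1}{p+n}$ and $[(S^tS)^{L_2}]_{kl}\ge\frac{\psi_2}{p+n}$ for all $i,j=1,\dots,p$ and $k,l=1,\dots,n$. (D) There are constants $r_1,r_2>0$ such that $r_1\le \frac pn\le r_2$. *)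

(* Defs.v *)
From HB Require Import structures.
From mathcomp Require Import all_boot all_order all_algebra complex.
From mathcomp Require Import all_classical all_reals all_analysis.

Set Implicit Arguments.
Unset Strict Implicit.
Unset Printing Implicit Defensive.

Import Order.TTheory GRing.Theory Num.Theory.
Import numFieldNormedType.Exports.

Local Open Scope classical_set_scope.
Local Open Scope ring_scope.
Local Open Scope complex_scope.

Definition upper_half_plane (R : realType) : set R[i] :=
  [set z | 0 < complex.Im z].

(* [R[i]^o] is the one-dimensional normed space over the field [R[i]], so the
   difference quotient in [derivable f z 1] is taken along a complex increment:
   this is complex differentiability. *)
Definition holomorphic_on (R : realType) (D : set R[i])
    (f : R[i] -> R[i]) : Prop :=
  forall z, D z -> derivable (f : R[i]^o -> R[i]^o) z 1.

Definition vholomorphic_on (R : realType) (p : nat) (D : set R[i])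
    (f : R[i] -> 'cV[R[i]]_p) : Prop :=
  forall i : 'I_p, holomorphic_on D (fun z => f z i ord0).

Definition vinv (F : fieldType) (l : nat) (w : 'cV[F]_l) : 'cV[F]_l :=
  map_mx (fun x => x^-1) w.

Definition vmean (F : fieldType) (l : nat) (w : 'cV[F]_l) : F :=
  l%:R^-1 * \sum_(i < l) w i ord0.

Definition cmx (R : realType) (p n : nat) (S : 'M[R]_(p, n)) : 'M[R[i]]_(p, n) :=
  map_mx (fun x => x%:C) S.

Definition assumptionA (R : realType) (p n : nat) (S : 'M[R]_(p, n)) (s : R) :
    Prop :=
  0 < s /\ forall i k, S i k <= s / (p + n)%:R.

Definition assumptionB (R : realType) (p n : nat) (S : 'M[R]_(p, n)) : Prop :=
  exists (L1 L2 : nat) (psi1 psi2 : R),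
    [/\ (0 < L1)%N, (0 < L2)%N, 0 < psi1 & 0 < psi2] /\
    (forall i j : 'I_p, psi1 / (p + n)%:R <= ((S *m S^T) ^+ L1) i j) /\
    (forall k l : 'I_n, psi2 / (p + n)%:R <= ((S^T *m S) ^+ L2) k l).

Definition assumptionD (R : realType) (p n : nat) : Prop :=
  exists r1 r2 : R, [/\ 0 < r1, 0 < r2 & r1 <= p%:R / n%:R <= r2].

(* Functions on the upper half-plane are represented by total functions on
   [R[i]] whose values off the half-plane are irrelevant.  The positivity of the
   imaginary parts makes both componentwise inverses genuine. *)
Definition is_solution (R : realType) (p n : nat) (S : 'M[R]_(p, n))
    (m : R[i] -> 'cV[R[i]]_p) : Prop :=
  [/\ vholomorphic_on (@upper_half_plane R) m,
      forall z, upper_half_plane z ->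
        - vinv (m z) =
          const_mx z - cmx S *m vinv (const_mx 1 + (cmx S)^T *m m z)
    & forall z, upper_half_plane z -> forall i, 0 < complex.Im (m z i ord0)].

Definition measure_support (R : realType)
    (mu : {measure set (measurableTypeR R) -> \bar R}) : set R :=
  [set x : R | forall U : set R, open_nbhs x U -> (0 < mu U)%E].

Definition Cintegral (R : realType) (d : measure_display) (T : measurableType d)
    (mu : {measure set T -> \bar R}) (f : T -> R[i]) : R[i] :=
  (\int[mu]_w complex.Re (f w)) +i* (\int[mu]_w complex.Im (f w)).

Definition represents (R : realType) (p : nat) (s : R)
    (m : R[i] -> 'cV[R[i]]_p) (nu : probability (measurableTypeR R) R) : Prop :=
  measure_support nu `<=` `[0, 4 * s] /\
  forall z, upper_half_plane z ->
    vmean (m z) = Cintegral nu (fun w : R => (w%:C - z)^-1).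

Definition locally_holder (R : realType) (D : set R) (f : R -> R) : Prop :=
  exists a : R, 0 < a <= 1 /\
    forall K : set R, compact K -> K `<=` D ->
      exists C : R, forall x y, K x -> K y -> `|f x - f y| <= C * `|x - y| `^ a.

(* Main.v *)
From HB Require Import structures.
Require Import Defs.
From mathcomp Require Import all_boot all_order all_algebra complex.
From mathcomp Require Import all_classical all_reals all_analysis.
From mathcomp Require Import sesquilinear spectral measurable_realfun ring lra.
Set Implicit Arguments.
Unset Strict Implicit.
Unset Printing Implicit Defensive.
Import Order.TTheory GRing.Theory Num.Theory.
Import numFieldNormedType.Exports.
Local Open Scope classical_set_scope.
Local Open Scope ring_scope.
Local Open Scope complex_scope.

(* Write [Phi_z u i = - (z - sum_k s_ik / (1 + sum_j s_jk u_j))^-1]; a solution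
   at [z] is a fixed point of [Phi_z] with positive imaginary parts.

   (i) For [d(u,v) = max_i |u_i - v_i|^2 / (Im u_i Im v_i)], Cauchy-Schwarz shows
   that [Phi_z] does not increase [d], and strictly contracts it at fixed
   points, whence uniqueness.  On vectors with [Im (z u_i) >= 0] the contraction
   is uniform, so the iterates of [Phi_z] from [-1/z] become asymptotically
   fixed and any ultrafilter limit is a solution.  By the spectral theorem each
   iterate is a Stieltjes transform of a discrete probability measure, carried by
   [0, 4 s] because the iterates stay bounded near every other real point; Helly
   selection along the same ultrafilter gives the measures of the limit.

   (ii) Put [h = Im m].  The Schur test for the matrix [|m_i| s_ik / |q_k|], with
   [q = 1 + S^t m], bounds [m], [q] and their inverses on strips away from [0].
   The derivative satisfies the linearized equation
   [m' = m^2 (1 + S (q^-2 S^t m'))], and comparing [|m'|] with [h] by the Harnack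
   inequality that (B) provides yields [|m'| (sum_i h_i)^2 <= C].  So
   [(sum_i h_i)^3] is Lipschitz and [sum_i h_i] is 1/3-Hoelder up to the positive
   real axis; its boundary value over [pi] is the density, by Stieltjes
   inversion. *)

(** * Complex modulus *)

Local Notation Re := complex.Re.
Local Notation Im := complex.Im.

Section ComplexModulus.
Context {R : realType}.
Implicit Types (x y : R) (z w : R[i]).

(** In (i), the decay of [d] between consecutive iterates is not summed to a Cauchy property. A
    limit along an ultrafilter exists by boundedness alone, and the decay only serves to see that
    this limit is a fixed point. The ultrafilter is fixed once, before [z] and [i], so the limits at
    all [z] come from one sequence of measures; holomorphy is then read off from the integral
    representation instead of from normal families.

    In (ii), the obstacle is that the linearized equation degenerates as [h] tends to [0]. The
    imaginary part of the equation makes [h] an almost fixed vector of the nonnegative matrix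
    [|m|^2 S |q|^-2 S^t], so a bound by moduli alone leaves no gap. What survives is a cancellation
    in the phases of [m_i / q_k], and its gain is of order [h^2]. This is the origin of the square
    in the derivative bound, and so of the cube and of the exponent 1/3. The matrix [S] is fixed, so
    constants may depend on [p], [n] and [S]; crude bounds, such as sums over all entries, are good
    enough. *)

Definition cabs z : R := Num.sqrt (Re z ^+ 2 + Im z ^+ 2).

(** The norm on [R[i]] takes its values in [R[i]]; estimates between real numbers go through the
    real-valued [cabs]. *)
Lemma norm_cabs z : `|z| = (cabs z)%:C.
Proof. exact: normc_def. Qed.

Lemma cabs_ge0 z : 0 <= cabs z. Proof. exact: sqrtr_ge0. Qed.

Lemma sqr_cabs z : cabs z ^+ 2 = Re z ^+ 2 + Im z ^+ 2.
Proof. by rewrite sqr_sqrtr// addr_ge0// sqr_ge0. Qed.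

Lemma cabsM z w : cabs (z * w) = cabs z * cabs w.
Proof. by apply: complexI; rewrite -norm_cabs normrM !norm_cabs rmorphM. Qed.

Lemma cabsN z : cabs (- z) = cabs z.
Proof. by apply: complexI; rewrite -!norm_cabs normrN. Qed.

Lemma cabsV z : cabs z^-1 = (cabs z)^-1.
Proof. by apply: complexI; rewrite -norm_cabs normfV norm_cabs fmorphV. Qed.

Lemma cabs0 : cabs 0 = 0.
Proof. by apply: complexI; rewrite -norm_cabs normr0. Qed.

Lemma cabs1 : cabs 1 = 1.
Proof. by apply: complexI; rewrite -norm_cabs normr1. Qed.

Lemma cabsX z n : cabs (z ^+ n) = cabs z ^+ n.
Proof. by apply: complexI; rewrite -norm_cabs normrX norm_cabs rmorphXn. Qed.

Lemma cabs_real x : cabs x%:C = `|x|.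
Proof. by rewrite /cabs/= expr0n/= addr0 sqrtr_sqr. Qed.

Lemma cabsD z w : cabs (z + w) <= cabs z + cabs w.
Proof. by rewrite -lecR rmorphD/= -!norm_cabs ler_normD. Qed.

Lemma cabsB z w : cabs (z - w) <= cabs z + cabs w.
Proof. by rewrite -(cabsN w) cabsD. Qed.

Lemma cabs_subC z w : cabs (z - w) = cabs (w - z).
Proof. by rewrite -cabsN opprB. Qed.

Lemma cabs_lbD z w : cabs z - cabs w <= cabs (z + w).
Proof. by rewrite lerBlDr -{1}(addrK w z) -(cabsN w) cabsD. Qed.

Lemma cabs_sum (I : Type) (r : seq I) (P : pred I) (F : I -> R[i]) :
  cabs (\sum_(i <- r | P i) F i) <= \sum_(i <- r | P i) cabs (F i).
Proof.
elim/big_rec2: _ => [|i y z _ h]; first by rewrite cabs0.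
by rewrite (le_trans (cabsD _ _))// lerD2l.
Qed.

Lemma cabs_eq0 z : (cabs z == 0) = (z == 0).
Proof. by rewrite -(normr_eq0 z) norm_cabs (inj_eq (@complexI R)). Qed.

Lemma cabs_gt0 z : (0 < cabs z) = (z != 0).
Proof. by rewrite lt_def cabs_ge0 andbT cabs_eq0. Qed.

Lemma Re_le_cabs z : `|Re z| <= cabs z.
Proof. by rewrite -sqrtr_sqr ler_wsqrtr// lerDl sqr_ge0. Qed.

Lemma Im_le_cabs z : `|Im z| <= cabs z.
Proof. by rewrite -sqrtr_sqr ler_wsqrtr// lerDr sqr_ge0. Qed.

Lemma cabs_le_ReIm z : cabs z <= `|Re z| + `|Im z|.
Proof.
rewrite -(@ler_pXn2r _ 2)// ?nnegrE ?cabs_ge0 ?addr_ge0//.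
by rewrite sqr_cabs sqrrD !real_normK ?num_real// addrAC lerDl mulrn_wge0 ?mulr_ge0.
Qed.

Lemma ReD z w : Re (z + w) = Re z + Re w. Proof. by case: z; case: w. Qed.
Lemma ImD z w : Im (z + w) = Im z + Im w. Proof. by case: z; case: w. Qed.
Lemma ReN z : Re (- z) = - Re z. Proof. by case: z. Qed.
Lemma ImN z : Im (- z) = - Im z. Proof. by case: z. Qed.
Lemma ReM z w : Re (z * w) = Re z * Re w - Im z * Im w.
Proof. by case: z => ? ?; case: w. Qed.
Lemma ImM z w : Im (z * w) = Re z * Im w + Im z * Re w.
Proof. by case: z => ? ?; case: w. Qed.
Lemma ReZ x z : Re (x%:C * z) = x * Re z.
Proof. by rewrite ReM /= mul0r subr0. Qed.
Lemma ImZ x z : Im (x%:C * z) = x * Im z.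
Proof. by rewrite ImM /= mul0r addr0. Qed.
Lemma Re_sum (I : Type) (r : seq I) (P : pred I) (F : I -> R[i]) :
  Re (\sum_(i <- r | P i) F i) = \sum_(i <- r | P i) Re (F i).
Proof. by elim/big_rec2: _ => [//|i y z _ <-]; rewrite ReD. Qed.
Lemma Im_sum (I : Type) (r : seq I) (P : pred I) (F : I -> R[i]) :
  Im (\sum_(i <- r | P i) F i) = \sum_(i <- r | P i) Im (F i).
Proof. by elim/big_rec2: _ => [//|i y z _ <-]; rewrite ImD. Qed.
Lemma ReV z : Re z^-1 = Re z / cabs z ^+ 2.
Proof. by rewrite sqr_cabs; case: z. Qed.
Lemma ImV z : Im z^-1 = - Im z / cabs z ^+ 2.
Proof. by rewrite sqr_cabs mulNr; case: z. Qed.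

Lemma complex_ext z w : Re z = Re w -> Im z = Im w -> z = w.
Proof. by case: z => ? ?; case: w => ? ? /= -> ->. Qed.

Lemma Im_gt0_neq0 z : 0 < Im z -> z != 0.
Proof. by apply: contraTneq => ->; rewrite ltxx. Qed.

(** Cauchy-Schwarz without square roots: [X i] need only be dominated by the geometric mean of [A i]
    and [B i]. In the induction the cross term obeys [(2 x y)^2 <= 4 (a b) (c d) <= (a d + c
    b)^2]. *)
Lemma sum_sqr_le (I : Type) (r : seq I) (X A B : I -> R) :
  (forall i, [/\ 0 <= A i, 0 <= B i & X i ^+ 2 <= A i * B i]) ->
  (\sum_(i <- r) X i) ^+ 2 <= (\sum_(i <- r) A i) * (\sum_(i <- r) B i).
Proof.
move=> h.
suff [_ _] : [/\ 0 <= \sum_(i <- r) A i, 0 <= \sum_(i <- r) B i &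
  (\sum_(i <- r) X i) ^+ 2 <= (\sum_(i <- r) A i) * (\sum_(i <- r) B i)] by [].
elim: r => [|i r [a0 b0 ih]]; first by rewrite !big_nil mulr0 expr0n.
rewrite !big_cons; have [a1 b1 ab] := h i; split; rewrite ?addr_ge0//.
set x := X i in ab *; set y := \sum_(_ <- _) _ in ih *.
set a := A i in a1 ab *; set b := B i in b1 ab *.
set c := \sum_(_ <- _) _ in a0 ih *; set d := \sum_(_ <- _) _ in b0 ih *.
suff xy : 2 * (x * y) <= a * d + c * b.
  have -> : (x + y) ^+ 2 = x ^+ 2 + y ^+ 2 + 2 * (x * y) by ring.
  have -> : (a + c) * (b + d) = a * b + c * d + (a * d + c * b) by ring.
  by rewrite !lerD.
apply: le_trans (ler_norm _) _.
rewrite -(@ler_pXn2r _ 2)// ?nnegrE ?normr_ge0 ?addr_ge0 ?mulr_ge0//.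
rewrite real_normK ?num_real//.
have h1 : (x ^+ 2) * (y ^+ 2) <= (a * b) * (c * d) by apply: ler_pM; rewrite ?sqr_ge0.
have h2 : 0 <= (a * d - c * b) ^+ 2 by rewrite sqr_ge0.
have -> : (2 * (x * y)) ^+ 2 = 4 * (x ^+ 2 * y ^+ 2) by ring.
have -> : (a * d + c * b) ^+ 2 = (a * d - c * b) ^+ 2 + 4 * ((a * b) * (c * d)) by ring.
lra.
Qed.

End ComplexModulus.

(** * The fixed-point map and its iteration *)

Section FixedPointMap.
Context {R : realType} (p n : nat) (S : 'M[R]_(p, n)).
Hypothesis S_ge0 : forall i k, 0 <= S i k.
Implicit Types (z : R[i]) (u v : 'I_p -> R[i]).

Definition gden u k : R[i] := 1 + \sum_(j < p) (S j k)%:C * u j.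

Definition gmap z u i : R[i] := - (z - \sum_(k < n) (S i k)%:C / gden u k)^-1.

(** The excess of [Im (- (gmap z u i)^-1)] over [Im z]. Its sign makes the map preserve the upper
    half-plane. *)
Definition gweight u i : R :=
  \sum_(k < n) S i k * (\sum_(j < p) S j k * Im (u j)) / cabs (gden u k) ^+ 2.

Lemma Im_gden u k : Im (gden u k) = \sum_(j < p) S j k * Im (u j).
Proof. by rewrite ImD add0r Im_sum; apply: eq_bigr => j _; rewrite ImZ. Qed.

Lemma Im_gden_ge0 u k : (forall j, 0 < Im (u j)) -> 0 <= Im (gden u k).
Proof.
by move=> u0; rewrite Im_gden; apply: sumr_ge0 => j _; rewrite mulr_ge0// ltW.
Qed.

(** Either column [k] of [S] has a positive entry and the imaginary part is positive, or the column
    vanishes and the value is [1]. *)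
Lemma gden_neq0 u k : (forall j, 0 < Im (u j)) -> gden u k != 0.
Proof.
move=> u0; have := Im_gden_ge0 k u0; rewrite le_eqVlt => /orP[/eqP|/Im_gt0_neq0//].
rewrite Im_gden => /esym/eqP; rewrite psumr_eq0; last first.
  by move=> j _; rewrite mulr_ge0// ltW.
move=> /allP h; rewrite /gden big1 ?addr0 ?oner_eq0// => j _.
have := h j (mem_index_enum _); rewrite /= mulf_eq0 => /orP[/eqP ->|/eqP e].
  by rewrite mul0r.
by have := u0 j; rewrite e ltxx.
Qed.

Lemma gweight_ge0 u i : (forall j, 0 < Im (u j)) -> 0 <= gweight u i.
Proof.
move=> u0; apply: sumr_ge0 => k _; rewrite -Im_gden.
apply: divr_ge0; last by rewrite sqr_ge0.
by rewrite mulr_ge0 ?Im_gden_ge0.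
Qed.

Lemma Im_gmap_inv z u i :
  Im (z - \sum_(k < n) (S i k)%:C / gden u k) = Im z + gweight u i.
Proof.
rewrite ImD ImN Im_sum -sumrN; congr (_ + _); apply: eq_bigr => k _.
by rewrite ImZ ImV Im_gden mulNr mulrN opprK mulrA.
Qed.

(** The identity behind every contraction estimate: the factor [cabs _ ^+ 2 * gweight u i] in those
    estimates falls short of [Im (gmap z u i)] by exactly [cabs _ ^+ 2 * Im z]. *)
Lemma Im_gmap z u i :
  Im (gmap z u i) = cabs (gmap z u i) ^+ 2 * (Im z + gweight u i).
Proof.
rewrite /gmap ImN ImV cabsN cabsV mulNr opprK Im_gmap_inv exprVn.
by rewrite mulrC.
Qed.

Lemma gmap_neq0 z u i : 0 < Im z -> (forall j, 0 < Im (u j)) -> gmap z u i != 0.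
Proof.
move=> z0 u0; rewrite oppr_eq0 invr_eq0; apply: Im_gt0_neq0.
by rewrite Im_gmap_inv ltr_wpDr// gweight_ge0.
Qed.

Lemma Im_gmap_gt0 z u i : 0 < Im z -> (forall j, 0 < Im (u j)) ->
  0 < Im (gmap z u i).
Proof.
move=> z0 u0; rewrite Im_gmap mulr_gt0//.
  by rewrite exprn_gt0// cabs_gt0 gmap_neq0.
by rewrite ltr_wpDr// gweight_ge0.
Qed.

(** A resolvent identity. Equal parameters [z = w] give the contraction; distinct ones give the
    difference quotient of a solution in [z]. *)
Lemma gmapB z w u v i : 0 < Im z -> 0 < Im w ->
  (forall j, 0 < Im (u j)) -> (forall j, 0 < Im (v j)) ->
  gmap z u i - gmap w v i = gmap z u i * gmap w v i *
    (z - w + \sum_(k < n) (S i k)%:C / (gden u k * gden v k) *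
              \sum_(j < p) (S j k)%:C * (u j - v j)).
Proof.
move=> z0 w0 u0 v0.
have -> : \sum_(k < n) (S i k)%:C / (gden u k * gden v k) *
              \sum_(j < p) (S j k)%:C * (u j - v j) =
   \sum_(k < n) (S i k)%:C / gden v k - \sum_(k < n) (S i k)%:C / gden u k.
  rewrite -sumrB; apply: eq_bigr => k _.
  have -> : \sum_(j < p) (S j k)%:C * (u j - v j) = gden u k - gden v k.
    rewrite /gden opprD addrACA subrr add0r -sumrB.
    by apply: eq_bigr => j _; rewrite mulrBr.
  have := gden_neq0 k u0; have := gden_neq0 k v0.
  move: (gden u k) (gden v k) => a b b0 a0; field.
  by rewrite a0 b0.
have := gmap_neq0 i z0 u0; have := gmap_neq0 i w0 v0.
rewrite /gmap !oppr_eq0 !invr_eq0.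
set a := \sum_(k < n) _; set b := \sum_(k < n) _ => wb zb.
by field; rewrite wb zb.
Qed.

(* Cauchy-Schwarz, once in [j] and once in [k]. *)
Lemma gmap_contract z u v i (D : R) : 0 < Im z ->
  (forall j, 0 < Im (u j)) -> (forall j, 0 < Im (v j)) -> 0 <= D ->
  (forall j, cabs (u j - v j) ^+ 2 <= D * (Im (u j) * Im (v j))) ->
  cabs (gmap z u i - gmap z v i) ^+ 2 <=
    D * (cabs (gmap z u i) ^+ 2 * gweight u i) *
        (cabs (gmap z v i) ^+ 2 * gweight v i).
Proof.
move=> z0 u0 v0 D0 h.
rewrite gmapB// subrr add0r !cabsM !exprMn.
set a := cabs _ ^+ 2; set b := cabs _ ^+ 2.
have -> : D * (a * gweight u i) * (b * gweight v i) =
  (a * b) * (D * gweight u i * gweight v i) by ring.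
apply: ler_wpM2l; first by rewrite mulr_ge0// sqr_ge0.
have cS (r : R) : 0 <= r -> cabs r%:C = r.
  by move=> r0; rewrite cabs_real ger0_norm.
apply: le_trans (_ : (\sum_(k < n) (S i k / (cabs (gden u k) * cabs (gden v k)) *
   \sum_(j < p) S j k * cabs (u j - v j))) ^+ 2 <= _).
  rewrite ler_pXn2r ?nnegrE ?cabs_ge0//; last first.
    apply: sumr_ge0 => k _; rewrite mulr_ge0 ?divr_ge0 ?mulr_ge0 ?cabs_ge0//.
    by apply: sumr_ge0 => j _; rewrite mulr_ge0 ?cabs_ge0.
  apply: le_trans (cabs_sum _ _ _) _; apply: ler_sum => k _.
  rewrite !cabsM cabsV cabsM cS//; apply: ler_wpM2l.
    by rewrite divr_ge0 ?mulr_ge0 ?cabs_ge0.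
  apply: le_trans (cabs_sum _ _ _) _; apply: ler_sum => j _.
  by rewrite cabsM cS.
have -> : D * gweight u i = \sum_(k < n) D * (S i k *
    (\sum_(j < p) S j k * Im (u j)) / cabs (gden u k) ^+ 2) by rewrite mulr_sumr.
apply: sum_sqr_le => k.
have cu0 : 0 <= \sum_(j < p) S j k * Im (u j).
  by apply: sumr_ge0 => j _; rewrite mulr_ge0// ltW.
have cv0 : 0 <= \sum_(j < p) S j k * Im (v j).
  by apply: sumr_ge0 => j _; rewrite mulr_ge0// ltW.
split; rewrite ?mulr_ge0 ?invr_ge0 ?sqr_ge0//.
rewrite -!mulrA !exprMn exprVn exprMn.
set X := \sum_(j < p) _; set Y := \sum_(j < p) _; set Z := \sum_(j < p) _.
set qu := cabs _ ^+ 2; set qv := cabs _ ^+ 2.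
have -> : D * (S i k * (Y * (qu^-1 * (S i k * (Z / qv))))) =
   S i k ^+ 2 * ((qu * qv)^-1 * (D * Y * Z)).
  by rewrite (invfM qu qv); ring.
apply: ler_wpM2l; first exact: sqr_ge0.
apply: ler_wpM2l; first by rewrite invr_ge0 mulr_ge0// sqr_ge0.
have -> : D * Y = \sum_(j < p) D * (S j k * Im (u j)) by rewrite mulr_sumr.
apply: sum_sqr_le => j; split.
- by rewrite !mulr_ge0// ltW.
- by rewrite mulr_ge0// ltW.
rewrite exprMn; have -> : D * (S j k * Im (u j)) * (S j k * Im (v j)) =
  S j k ^+ 2 * (D * (Im (u j) * Im (v j))) by ring.
by apply: ler_wpM2l (h j); rewrite sqr_ge0.
Qed.

End FixedPointMap.

Section Iteration.
Context {R : realType} (p n : nat) (S : 'M[R]_(p, n)).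
Hypothesis S_ge0 : forall i k, 0 <= S i k.
Implicit Types (z : R[i]) (u v : 'I_p -> R[i]).

(** The distance is attained at some index [i0]. There both weights lie strictly below the imaginary
    parts because [Im z > 0], so the contraction bound is contradictory unless the maximum is
    [0]. *)
Lemma gmap_fixed_unique z u v : 0 < Im z ->
  (forall j, 0 < Im (u j)) -> (forall j, 0 < Im (v j)) ->
  (forall i, u i = gmap S z u i) -> (forall i, v i = gmap S z v i) ->
  forall i, u i = v i.
Proof.
move=> z0 u0 v0 fu fv i.
pose r j : R := cabs (u j - v j) ^+ 2 / (Im (u j) * Im (v j)).
have [i0 _ rmax] := @arg_maxP _ R _ i xpredT r isT.
have uv0 j : 0 < Im (u j) * Im (v j) by rewrite mulr_gt0.
have r0 j : 0 <= r j by rewrite divr_ge0 ?sqr_ge0// ltW.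
have h j : cabs (u j - v j) ^+ 2 <= r i0 * (Im (u j) * Im (v j)).
  by rewrite -ler_pdivrMr//; exact: (rmax j isT).
have := gmap_contract S_ge0 i0 z0 u0 v0 (r0 i0) h; rewrite -fu -fv.
have lt w : (forall j, 0 < Im (w j)) -> (forall i, w i = gmap S z w i) ->
    cabs (w i0) ^+ 2 * gweight S w i0 < Im (w i0).
  move=> w0 fw; rewrite [in X in _ < X]fw Im_gmap// -fw mulrDr ltrDr.
  by rewrite mulr_gt0// exprn_gt0// cabs_gt0 fw gmap_neq0.
have -> : cabs (u i0 - v i0) ^+ 2 = r i0 * (Im (u i0) * Im (v i0)).
  by rewrite /r mulfVK// gt_eqF.
rewrite -mulrA => le_r.
have [r00|] := ltP 0 (r i0).
  move: le_r; rewrite ler_pM2l// => /le_gtF.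
  by rewrite ltr_pM ?lt// mulr_ge0 ?sqr_ge0 ?gweight_ge0.
move=> rle; have : cabs (u i - v i) ^+ 2 <= 0.
  by apply: le_trans (h i) _; rewrite pmulr_lle0.
by move=> {}h; apply/eqP; rewrite -subr_eq0 -cabs_eq0 -sqrf_eq0 eq_le h sqr_ge0.
Qed.

(** The starting value is the Stieltjes transform of the unit mass at [0]; as [z * (- z^-1)] is
    real, it satisfies the stability condition below. *)
Definition giter z k : 'I_p -> R[i] := iter k (gmap S z) (fun _ => - z^-1).

(* [Im (z u_i) >= 0] gives [|z q_k| >= Im z], hence the uniform lower bound on
   [|Phi_z u|] that makes the contraction uniform. *)
Definition gstable z u := forall i, 0 < Im (u i) /\ 0 <= Im (z * u i).

Lemma Im_mul_gden z u k : (forall i, 0 <= Im (z * u i)) ->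
  Im z <= Im (z * gden S u k).
Proof.
move=> u0; rewrite mulrDr mulr1 ImD lerDl mulr_sumr Im_sum; apply: sumr_ge0.
by move=> j _; rewrite mulrCA ImZ mulr_ge0.
Qed.

Lemma cabs_gmap_le z u i : 0 < Im z -> (forall j, 0 < Im (u j)) ->
  cabs (gmap S z u i) <= (Im z)^-1.
Proof.
move=> z0 u0; have g0 : 0 < cabs (gmap S z u i) by rewrite cabs_gt0 gmap_neq0.
have := Im_gmap S z u i => e.
have : cabs (gmap S z u i) ^+ 2 * Im z <= cabs (gmap S z u i).
  apply: le_trans (Im_le_cabs _); apply: le_trans (ler_norm _).
  by rewrite e ler_wpM2l ?sqr_ge0// lerDl gweight_ge0.
rewrite expr2 -mulrA -{3}(mulr1 (cabs _)) ler_pM2l// => h.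
by rewrite -(ler_pM2r z0) mulVf ?gt_eqF.
Qed.

(** With [q_k = gden S u k], the product [z * gmap S z u i] equals
    [- (1 - sum_k s_ik / (z q_k))^-1], and every [z q_k] has nonnegative imaginary part. Transforms
    of measures on the half-line [[0, +oo[] have this property: there
    [Im (z / (w - z)) = w Im z / |w - z|^2]. *)
Lemma gmap_stable z u : 0 < Im z -> gstable z u -> gstable z (gmap S z u).
Proof.
move=> z0 su i; have u0 j : 0 < Im (u j) by case: (su j).
split; first exact: Im_gmap_gt0.
have zN0 := Im_gt0_neq0 z0.
have -> : z * gmap S z u i =
    - (1 - \sum_(k < n) (S i k)%:C / (z * gden S u k))^-1.
  have := gmap_neq0 S_ge0 i z0 u0; rewrite /gmap oppr_eq0 invr_eq0 => d0.
  rewrite mulrN; congr (- _).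
  have -> : 1 - \sum_(k < n) (S i k)%:C / (z * gden S u k) =
     (z - \sum_(k < n) (S i k)%:C / gden S u k) / z.
    rewrite mulrBl mulfV//; congr (_ - _); rewrite mulr_suml.
    by apply: eq_bigr => k _; rewrite invfM -mulrA; congr (_ * _); rewrite mulrC.
  by rewrite invfM invrK mulrC.
rewrite ImN ImV mulNr opprK; apply: divr_ge0; last exact: sqr_ge0.
rewrite ImD add0r ImN Im_sum -sumrN; apply: sumr_ge0 => k _.
rewrite ImZ ImV mulNr mulrN opprK; apply: mulr_ge0 => //.
apply: divr_ge0; last exact: sqr_ge0.
apply: le_trans (ltW z0) _; apply: Im_mul_gden => j.
by case: (su j).
Qed.

Lemma giter_stable z k : 0 < Im z -> gstable z (giter z k).
Proof.
move=> z0; elim: k => [|k ih]; last exact: gmap_stable.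
move=> i; have zN0 := Im_gt0_neq0 z0.
split; rewrite /giter/=; last by rewrite mulrN mulfV//= oppr0.
by rewrite ImN ImV mulNr opprK divr_gt0// exprn_gt0// cabs_gt0.
Qed.

Lemma giter_gt0 z k i : 0 < Im z -> 0 < Im (giter z k i).
Proof. by move=> z0; case: (giter_stable k z0 i). Qed.

Lemma cabs_giter_le z k i : 0 < Im z -> cabs (giter z k i) <= (Im z)^-1.
Proof.
move=> z0; case: k => [|k].
  rewrite cabsN cabsV lef_pV2 ?posrE// ?cabs_gt0 ?Im_gt0_neq0//.
  by apply: le_trans (Im_le_cabs _); exact: ler_norm.
by apply: cabs_gmap_le => // j; exact: giter_gt0.
Qed.

(** Bounds the modulus of [z - sum_k s_ik / q_k] on stable vectors, where [|q_k| >= Im z / |z|].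
    Summing over all rows makes it independent of the index. *)
Definition gbound z : R :=
  cabs z * (1 + (\sum_(i < p) \sum_(k < n) S i k) / Im z).

Lemma gbound_gt0 z : 0 < Im z -> 0 < gbound z.
Proof.
move=> z0; rewrite mulr_gt0 ?cabs_gt0 ?Im_gt0_neq0// ltr_wpDr// divr_ge0 ?(ltW z0)//.
by apply: sumr_ge0 => i _; apply: sumr_ge0.
Qed.

Lemma cabs_gmap_ge z u i : 0 < Im z -> gstable z u ->
  (gbound z)^-1 <= cabs (gmap S z u i).
Proof.
move=> z0 su; have u0 j : 0 < Im (u j) by case: (su j).
have d0 : z - \sum_(k < n) (S i k)%:C / gden S u k != 0.
  by have := gmap_neq0 S_ge0 i z0 u0; rewrite /gmap oppr_eq0 invr_eq0.
rewrite cabsN cabsV lef_pV2 ?posrE ?cabs_gt0 ?gbound_gt0//.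
apply: le_trans (cabsB _ _) _; rewrite /gbound mulrDr mulr1 lerD2l.
apply: le_trans (cabs_sum _ _ _) _.
apply: le_trans (_ : \sum_(k < n) S i k * (cabs z / Im z) <= _).
  apply: ler_sum => k _; rewrite cabsM cabs_real ger0_norm//.
  apply: ler_wpM2l => //; rewrite cabsV.
  have q0 : gden S u k != 0 by exact: gden_neq0.
  have zq : Im z <= cabs z * cabs (gden S u k).
    rewrite -cabsM; apply: le_trans (Im_le_cabs _).
    apply: le_trans (ler_norm _); apply: Im_mul_gden => j.
    by case: (su j).
  by rewrite ler_pdivlMr// mulrC ler_pdivrMr ?cabs_gt0.
rewrite -mulr_suml mulrCA ler_wpM2l ?cabs_ge0// ler_wpM2r ?invr_ge0 ?(ltW z0)//.
rewrite (bigD1 i)//= lerDl; apply: sumr_ge0 => j _; exact: sumr_ge0.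
Qed.

(** The uniform contraction factor. For [g = gmap S z u i] with [u] stable, [Im g] contains the part
    [|g|^2 Im z], which is at least [Im g * Im z / gbound S z] since [|g| >= Im g] and
    [|g| >= (gbound S z)^-1]. *)
Definition gratio z : R := 1 - Im z / gbound z.

Lemma gratio_itv z : 0 < Im z -> 0 <= gratio z < 1.
Proof.
move=> z0; rewrite subr_ge0 ltrBlDr ltrDl divr_gt0 ?gbound_gt0// andbT.
rewrite ler_pdivrMr ?gbound_gt0// mul1r /gbound.
apply: le_trans (_ : cabs z * 1 <= _).
  by rewrite mulr1; apply: le_trans (Im_le_cabs _); exact: ler_norm.
rewrite ler_wpM2l ?cabs_ge0// lerDl divr_ge0 ?(ltW z0)//.
by apply: sumr_ge0 => i _; apply: sumr_ge0.
Qed.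

Lemma gmap_weight_le z u i : 0 < Im z -> gstable z u ->
  cabs (gmap S z u i) ^+ 2 * gweight S u i <= gratio z * Im (gmap S z u i).
Proof.
move=> z0 su; have u0 j : 0 < Im (u j) by case: (su j).
have -> : cabs (gmap S z u i) ^+ 2 * gweight S u i =
    Im (gmap S z u i) - cabs (gmap S z u i) ^+ 2 * Im z.
  by rewrite [Im (gmap _ _ _ _)]Im_gmap// mulrDr addrAC subrr add0r.
rewrite /gratio mulrBl mul1r lerD2l lerN2 -mulrA mulrC ler_pM2r//.
rewrite expr2 mulrC; apply: ler_pM.
- exact/ltW/Im_gmap_gt0.
- by rewrite invr_ge0 ltW// gbound_gt0.
- by apply: le_trans (Im_le_cabs _); exact: ler_norm.
- exact: cabs_gmap_ge.
Qed.

(** Each step costs one factor [gratio z] for each of the two imaginary parts. [D] is the sum of the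
    initial ratios, which dominates their maximum. *)
Lemma giter_diff_le z : 0 < Im z -> exists2 D : R, 0 <= D & forall k i,
  cabs (giter z k.+1 i - giter z k i) ^+ 2 <=
  D * (gratio z ^+ 2) ^+ k * (Im (giter z k.+1 i) * Im (giter z k i)).
Proof.
move=> z0.
have pos k i := giter_gt0 k i z0.
have pos2 k i : 0 < Im (giter z k.+1 i) * Im (giter z k i) by rewrite mulr_gt0.
have /andP[g0 _] := gratio_itv z0.
pose r i : R := cabs (giter z 1 i - giter z 0 i) ^+ 2 /
  (Im (giter z 1 i) * Im (giter z 0 i)).
have r0 i : 0 <= r i by rewrite divr_ge0 ?sqr_ge0// ltW.
have D0 : 0 <= \sum_(i < p) r i by apply: sumr_ge0.
exists (\sum_(i < p) r i) => //; elim => [|k ih] i.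
  rewrite expr0 mulr1 -ler_pdivrMr// -/(r i) (bigD1 i)//= lerDl.
  by apply: sumr_ge0.
set D := \sum_(i < p) _ in D0 ih *.
have Dk0 : 0 <= D * (gratio z ^+ 2) ^+ k by rewrite mulr_ge0// exprn_ge0// sqr_ge0.
apply: le_trans (gmap_contract S_ge0 i z0 (pos k.+1) (pos k) Dk0 ih) _.
rewrite -[gmap S z (giter z k.+1) i]/(giter z k.+2 i).
rewrite -[gmap S z (giter z k) i]/(giter z k.+1 i).
have w1 := gmap_weight_le i z0 (giter_stable k.+1 z0).
have w2 := gmap_weight_le i z0 (giter_stable k z0).
rewrite -[gmap S z (giter z k.+1) i]/(giter z k.+2 i) in w1.
rewrite -[gmap S z (giter z k) i]/(giter z k.+1 i) in w2.
have -> : D * (gratio z ^+ 2) ^+ k.+1 *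
    (Im (giter z k.+2 i) * Im (giter z k.+1 i)) =
    D * (gratio z ^+ 2) ^+ k * ((gratio z * Im (giter z k.+2 i)) *
     (gratio z * Im (giter z k.+1 i))) by rewrite exprS; ring.
rewrite -mulrA ler_wpM2l// ler_pM//.
- by rewrite mulr_ge0 ?sqr_ge0 ?gweight_ge0.
- by rewrite mulr_ge0 ?sqr_ge0 ?gweight_ge0.
Qed.

Lemma giter_diff_cvg0 z i : 0 < Im z ->
  (fun k => cabs (giter z k.+1 i - giter z k i)) @ \oo --> (0 : R).
Proof.
move=> z0; have [D D0 h] := giter_diff_le z0.
have /andP[g0 g1] := gratio_itv z0.
(* The imaginary parts are at most [(Im z)^-1], which turns the relative bound into an absolute
   one. *)
have cb k : cabs (giter z k.+1 i - giter z k i) ^+ 2 <=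
    D / Im z ^+ 2 * (gratio z ^+ 2) ^+ k.
  apply: le_trans (h k i) _; rewrite mulrAC ler_wpM2r ?exprn_ge0//.
  rewrite ler_wpM2l// expr2 invfM ler_pM ?(ltW (giter_gt0 _ _ z0))//.
    apply: le_trans (cabs_giter_le k.+1 i z0).
    by apply: le_trans (Im_le_cabs _); exact: ler_norm.
  apply: le_trans (cabs_giter_le k i z0).
  by apply: le_trans (Im_le_cabs _); exact: ler_norm.
have c0 : (fun k => D / Im z ^+ 2 * (gratio z ^+ 2) ^+ k) @ \oo --> (0 : R).
  rewrite -(mulr0 (D / Im z ^+ 2)); apply: cvgMr.
  by apply: cvg_expr; rewrite ger0_norm ?exprn_ge0// expr_lt1.
have : (fun k => cabs (giter z k.+1 i - giter z k i) ^+ 2) @ \oo --> (0 : R).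
  apply: (squeeze_cvgr _ (cvg_cst _) c0).
  by near=> k; rewrite sqr_ge0 cb.
move=> h2; have := cvg_comp _ _ h2 (@sqrt_continuous R 0).
rewrite sqrtr0; apply: cvg_trans; apply: near_eq_cvg; near=> k.
by rewrite /= sqrtr_sqr ger0_norm// cabs_ge0.
Unshelve. all: by end_near. Qed.

End Iteration.

(** * Limits of complex-valued functions along filters and ultrafilters *)

Section ComplexLimits.
Context {R : realType} {T : Type} {F : set_system T}.
Implicit Types (f g : T -> R[i]) (a b : R[i]).

Definition ccvg (F : set_system T) f a : Prop :=
  (f : T -> R[i]^o) @ F --> (a : R[i]^o).

(** Radii in [R[i]^o] are positive elements of [R[i]], hence real, so they can be exchanged for
    radii in [R]. *)
Lemma ccvgP {FF : Filter F} f a :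
  ccvg F f a <-> (fun t => cabs (f t - a)) @ F --> (0 : R).
Proof.
split=> [/cvgrPdist_lt h|/cvgrPdist_lt h].
  apply/cvgrPdist_lt => e e0; have := h e%:C; rewrite ltcR => /(_ e0).
  apply: filterS => t; rewrite sub0r normrN (ger0_norm (cabs_ge0 _)) => lt.
  have : (cabs (a - f t))%:C < e%:C by rewrite -norm_cabs.
  by rewrite ltcR cabs_subC.
apply/cvgrPdist_lt => e e0.
have eE : e = (Re e)%:C by rewrite RRe_real// realE ltW.
have /h : 0 < Re e by rewrite -ltcR -eE.
apply: filterS => t; rewrite sub0r normrN (ger0_norm (cabs_ge0 _)) => lt.
suff : (cabs (a - f t))%:C < e by rewrite -norm_cabs.
by rewrite eE ltcR cabs_subC.
Qed.

Lemma ccvg_cst {FF : Filter F} a : ccvg F (fun=> a) a.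
Proof. exact: cvg_cst. Qed.

Lemma ccvgD {FF : Filter F} f g a b :
  ccvg F f a -> ccvg F g b -> ccvg F (fun t => f t + g t) (a + b).
Proof. exact: cvgD. Qed.

Lemma ccvgN {FF : Filter F} f a : ccvg F f a -> ccvg F (fun t => - f t) (- a).
Proof. exact: cvgN. Qed.

Lemma ccvgB {FF : Filter F} f g a b :
  ccvg F f a -> ccvg F g b -> ccvg F (fun t => f t - g t) (a - b).
Proof. exact: cvgB. Qed.

Lemma ccvgM {FF : Filter F} f g a b :
  ccvg F f a -> ccvg F g b -> ccvg F (fun t => f t * g t) (a * b).
Proof. by move=> h1 h2; apply: (@cvgM R[i] T F _ f g a b h1 h2). Qed.

Lemma ccvgV {FF : Filter F} f a :
  a != 0 -> ccvg F f a -> ccvg F (fun t => (f t)^-1) a^-1.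
Proof. by move=> h1 h2; apply: (@cvgV R[i] T F _ f a h1 h2). Qed.

Lemma ccvg_sum {FF : Filter F} (I : Type) (r : seq I) (f : I -> T -> R[i])
    (a : I -> R[i]) : (forall i, ccvg F (f i) (a i)) ->
  ccvg F (fun t => \sum_(i <- r) f i t) (\sum_(i <- r) a i).
Proof.
move=> h; elim: r => [|i r ih].
  rewrite big_nil (_ : (fun _ => _) = fun=> 0); first exact: ccvg_cst.
  by apply/funext => t; rewrite big_nil.
rewrite big_cons (_ : (fun _ => _) = fun t => f i t + \sum_(j <- r) f j t).
  exact: ccvgD.
by apply/funext => t; rewrite big_cons.
Qed.

Lemma ccvg_Im {FF : Filter F} f a :
  ccvg F f a -> (fun t => Im (f t)) @ F --> Im a.
Proof.
move=> /ccvgP/cvgrPdist_lt h; apply/cvgrPdist_lt => e /h; apply: filterS => t.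
rewrite sub0r normrN ger0_norm ?cabs_ge0//; apply: le_lt_trans.
by rewrite -ImN -ImD -(cabs_subC a) Im_le_cabs.
Qed.

Lemma ccvg_Re {FF : Filter F} f a :
  ccvg F f a -> (fun t => Re (f t)) @ F --> Re a.
Proof.
move=> /ccvgP/cvgrPdist_lt h; apply/cvgrPdist_lt => e /h; apply: filterS => t.
rewrite sub0r normrN ger0_norm ?cabs_ge0//; apply: le_lt_trans.
by rewrite -ReN -ReD -(cabs_subC a) Re_le_cabs.
Qed.

Lemma ccvg_ReIm {FF : Filter F} f a :
  (fun t => Re (f t)) @ F --> Re a -> (fun t => Im (f t)) @ F --> Im a ->
  ccvg F f a.
Proof.
move=> h1 h2; apply/ccvgP.
have h : (fun t => `|Re (f t) - Re a| + `|Im (f t) - Im a|) @ F --> (0 : R).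
  rewrite -[0 : R](addr0 0) -(normr0 R); apply: cvgD; apply: cvg_norm.
    by rewrite -(subrr (Re a)); apply: cvgB => //; exact: cvg_cst.
  by rewrite -(subrr (Im a)); apply: cvgB => //; exact: cvg_cst.
apply: (squeeze_cvgr _ (cvg_cst _) h); apply: nearW => t; rewrite cabs_ge0/=.
by apply: le_trans (cabs_le_ReIm _) _; rewrite ReD ImD ReN ImN.
Qed.

Lemma ccvg_unique {FF : ProperFilter F} f a b : ccvg F f a -> ccvg F f b -> a = b.
Proof. by move=> h1 h2; apply: (cvg_unique (@norm_hausdorff _ R[i]^o) h1 h2). Qed.

End ComplexLimits.

Section UltraLimit.
Context {R : realType} {U : set_system nat} {UU : UltraFilter U}.

(** Compactness gives a cluster point of the image filter. For an ultrafilter a cluster point is a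
    limit, because it contains the preimage of a neighbourhood or the complement of that
    preimage. *)
Lemma bounded_ultra_cvg (x : nat -> R) (a b : R) :
  (forall k, a <= x k <= b) -> exists l : R, x @ U --> l.
Proof.
move=> xab; have PU : ProperFilter U := @ultra_proper _ _ UU.
have [|l [_ lU]] := @segment_compact R a b (x @ U) (fmap_proper_filter x PU).
  apply: (@filterE _ U _ (x @^-1` `[a, b])) => k.
  by rewrite /preimage/= in_itv/= xab.
exists l => A lA.
have [//|nA] := in_ultra_setVsetC (x @^-1` A) UU.
have [y [nAy Ay]] : (~` A) `&` A !=set0 by exact: lU.
by case: (nAy Ay).
Qed.

Lemma bounded_ultra_ccvg (x : nat -> R[i]) (M : R) :
  (forall k, cabs (x k) <= M) -> exists l : R[i], ccvg U x l.
Proof.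
move=> xM; have PU : ProperFilter U := @ultra_proper _ _ UU.
have [|a ha] := @bounded_ultra_cvg (fun k => Re (x k)) (- M) M.
  by move=> k; rewrite -ler_norml (le_trans (Re_le_cabs _)).
have [|b hb] := @bounded_ultra_cvg (fun k => Im (x k)) (- M) M.
  by move=> k; rewrite -ler_norml (le_trans (Im_le_cabs _)).
by exists (a +i* b); exact: ccvg_ReIm.
Qed.

End UltraLimit.

Section IterationLimit.
Context {R : realType} (p n : nat) (S : 'M[R]_(p, n)).
Hypothesis S_ge0 : forall i k, 0 <= S i k.
Context {U : set_system nat} {UU : UltraFilter U}.
Hypothesis Uoo : \oo `<=` U.

Lemma ccvg_gmap {F : set_system nat} {FF : ProperFilter F} (z : R[i])
    (u : nat -> 'I_p -> R[i]) (v : 'I_p -> R[i]) : 0 < Im z ->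
  (forall j, 0 < Im (v j)) -> (forall j, ccvg F (fun k => u k j) (v j)) ->
  forall i, ccvg F (fun k => gmap S z (u k) i) (gmap S z v i).
Proof.
move=> z0 v0 uv i.
have cq k : ccvg F (fun t => gden S (u t) k) (gden S v k).
  apply: ccvgD; first exact: ccvg_cst.
  apply: ccvg_sum => j; apply: ccvgM; [exact: ccvg_cst|exact: uv].
apply/ccvgN/ccvgV; first by have := gmap_neq0 S_ge0 i z0 v0; rewrite /gmap oppr_eq0 invr_eq0.
apply: ccvgB; first exact: ccvg_cst.
apply: ccvg_sum => k; apply: ccvgM; first exact: ccvg_cst.
by apply: ccvgV (cq k); exact: gden_neq0.
Qed.

(** Positivity is not lost in the limit, since [Im g >= |g|^2 Im z >= Im z / (gbound S z)^2] for all
    iterates [g] after the initial one. Consecutive iterates have the same limit, and continuity of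
    the map turns this into the fixed-point equation. *)
Lemma giter_limit (z : R[i]) : 0 < Im z -> exists u : 'I_p -> R[i],
  [/\ forall i, ccvg U (fun k => giter S z k i) (u i),
      forall i, 0 < Im (u i) & forall i, u i = gmap S z u i].
Proof.
move=> z0; have PU : ProperFilter U := @ultra_proper _ _ UU.
have /choice[u hu] : forall i, exists l, ccvg U (fun k => giter S z k i) l.
  move=> i; apply: (@bounded_ultra_ccvg _ _ _ _ (Im z)^-1) => k.
  exact: cabs_giter_le.
have hu1 i : ccvg U (fun k => giter S z k.+1 i) (u i).
  have hd : ccvg U (fun k => giter S z k.+1 i - giter S z k i) 0.
    apply/ccvgP; under eq_fun do rewrite subr0.
    apply: cvg_trans (@giter_diff_cvg0 _ _ _ _ S_ge0 z i z0) => A.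
    exact: Uoo.
  rewrite -(add0r (u i)).
  rewrite (_ : (fun k => _) = fun k =>
    (giter S z k.+1 i - giter S z k i) + giter S z k i); first exact: ccvgD.
  by apply/funext => k; rewrite subrK.
have u0 i : 0 < Im (u i).
  have B0 := gbound_gt0 S_ge0 z0.
  apply: (@lt_le_trans _ _ ((gbound S z)^-1 ^+ 2 * Im z)).
    by rewrite mulr_gt0 ?exprn_gt0 ?invr_gt0.
  apply: (cvgr_to_ge (ccvg_Im (hu1 i))).
  apply: nearW => k.
  rewrite [giter _ _ _]/(gmap S z (giter S z k)) Im_gmap.
  have st := giter_stable S_ge0 k z0.
  apply: ler_pM => //.
  - by rewrite sqr_ge0.
  - by rewrite ltW.
  - rewrite ler_pXn2r ?nnegrE ?cabs_ge0 ?invr_ge0 ?(ltW B0)//.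
    exact: cabs_gmap_ge.
  - by rewrite lerDl gweight_ge0// => j; exact: giter_gt0.
exists u; split => // i.
have h : ccvg U (fun k => giter S z k.+1 i) (gmap S z u i).
  exact: (@ccvg_gmap U PU z (giter S z) u z0 u0 hu i).
exact: (ccvg_unique (hu1 i) h).
Qed.

End IterationLimit.

(** * Discrete Stieltjes transforms *)

Section DiscreteStieltjes.
Context {R : realType}.
Implicit Types (z : R[i]) (l : seq (R * R)).

(** A finite atomic measure is a list of pairs, weight first and node second. *)
Definition discrete_stieltjes l z : R[i] :=
  \sum_(a <- l) a.1%:C / (a.2%:C - z).

Definition nonneg_weights l := all (fun a => 0 <= a.1) l.

Lemma realc_subz_neq0 (x : R) z : 0 < Im z -> x%:C - z != 0.
Proof.
move=> z0; apply/negP => /eqP/(congr1 (@complex.Im R)); rewrite ImD ImN /= sub0r => /eqP.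
by rewrite oppr_eq0 gt_eqF.
Qed.

(** The spectral measure of the symmetric matrix [B] at the vector [b]: for the unitary
    diagonalization [A = P^-1 diag(s) P], the weights are [|(P b)_i|^2] and the nodes are the
    eigenvalues. The resolvent vector enters as any solution [y] of [(B - z) y = b], so an
    application only has to exhibit one and no inverse matrix is computed. *)
Lemma spectral_stieltjes (d : nat) (B : 'I_d -> 'I_d -> R) (b : 'I_d -> R) :
  (forall i j, B i j = B j i) ->
  exists l, [/\ nonneg_weights l, \sum_(a <- l) a.1 = \sum_i b i ^+ 2 &
    forall z (y : 'I_d -> R[i]), 0 < Im z ->
      (forall i, \sum_j (B i j)%:C * y j - z * y i = (b i)%:C) ->
      \sum_i (b i)%:C * y i = discrete_stieltjes l z].
Proof.
move=> Bsym.
pose A : 'M[R[i]]_d := \matrix_(i, j) (B i j)%:C.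
have Aherm : A \is hermsymmx.
  apply/is_hermitianmxP; rewrite expr0 scale1r; apply/matrixP => i j.
  rewrite !mxE Bsym; apply/esym; exact: conjc_real.
have An := hermitian_normalmx Aherm.
have sreal := hermitian_spectral_diag_real Aherm.
have /orthomx_spectralP AE := An.
set P := spectralmx A in AE; set s := spectral_diag A in AE sreal.
have Pu : P \is unitarymx := spectral_unitarymx A.
have Pi : P \in unitmx := spectral_unit A.
pose v : 'cV[R[i]]_d := \col_i (b i)%:C.
pose l := [seq (cabs ((P *m v) i ord0) ^+ 2, Re (s ord0 i)) | i <- enum 'I_d].
have conjmul (x : R[i]) : Num.conj x * x = (cabs x ^+ 2)%:C.
  by rewrite mulrC -normCK norm_cabs -rmorphXn.
have Pt (x y : 'cV[R[i]]_d) : (x ^t Num.Def.conjC)%sesqui *m y =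
   ((P *m x) ^t Num.Def.conjC)%sesqui *m (P *m y).
  by rewrite trmx_mul map_mxM mulmxA mulmxKtV.
have vc (y : 'cV[R[i]]_d) : ((v ^t Num.Def.conjC)%sesqui *m y) ord0 ord0 =
   \sum_i (b i)%:C * y i ord0.
  rewrite mxE; apply: eq_bigr => i _; rewrite !mxE; congr (_ * _).
  exact: conjc_real.
have Pc (x y : 'cV[R[i]]_d) : ((x ^t Num.Def.conjC)%sesqui *m y) ord0 ord0 =
   \sum_i Num.conj (x i ord0) * y i ord0.
  by rewrite mxE; apply: eq_bigr => i _; rewrite !mxE.
exists l; split.
- by apply/allP => a /mapP[i _ ->] /=; rewrite sqr_ge0.
- apply: complexI; rewrite big_map big_enum/= !rmorph_sum/=.
  transitivity (((v ^t Num.Def.conjC)%sesqui *m v) ord0 ord0).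
    by rewrite Pt Pc; apply: eq_bigr => i _; rewrite conjmul.
  by rewrite vc; apply: eq_bigr => i _; rewrite mxE rmorphXn.
move=> z y z0 hy.
pose Y : 'cV[R[i]]_d := \col_i y i.
have hY : (A - z%:M) *m Y = v.
  apply/matrixP => i j; rewrite mulmxBl mul_scalar_mx !mxE -hy; congr (_ - _).
  by apply: eq_bigr => k _; rewrite !mxE.
have hPY : diag_mx s *m (P *m Y) - z *: (P *m Y) = P *m v.
  have PA : P *m A = diag_mx s *m P by rewrite AE -mulmxA mulKVmx.
  by rewrite -hY mulmxBl mulmxBr mul_scalar_mx scalemxAr !mulmxA PA.
transitivity (((v ^t Num.Def.conjC)%sesqui *m Y) ord0 ord0).
  by rewrite vc; apply: eq_bigr => i _; rewrite mxE.
rewrite Pt Pc /discrete_stieltjes big_map big_enum/=; apply: eq_bigr => i _.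
have sE : s ord0 i = (Re (s ord0 i))%:C.
  by rewrite RRe_real//; apply: (mxOverP sreal).
have /matrixP/(_ i ord0) := hPY.
set PY := P *m Y; set Pv := P *m v.
rewrite [LHS]mxE mul_diag_mx [X in X + _]mxE [X in _ + X]mxE [X in - X]mxE.
rewrite -mulrBl sE => <-; rewrite sE /=.
have sz : (Re (s ord0 i))%:C - z != 0 by exact: realc_subz_neq0.
by rewrite -conjmul -mulrA; congr (_ * _); rewrite [in RHS]mulrC mulKf.
Qed.

Lemma discrete_stieltjes_scale (c : R) l : 0 <= c -> nonneg_weights l ->
  exists2 l', nonneg_weights l' &
  forall z, discrete_stieltjes l' z = c%:C * discrete_stieltjes l z.
Proof.
move=> c0 /allP l0; exists [seq (c * a.1, a.2) | a <- l].
  by apply/allP => a /mapP[e /l0 e0 ->] /=; rewrite mulr_ge0.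
move=> z; rewrite /discrete_stieltjes big_map mulr_sumr; apply: eq_bigr => a _.
by rewrite rmorphM mulrA.
Qed.

Lemma discrete_stieltjes_sum (I : Type) (r : seq I) (c : I -> R)
    (L : I -> seq (R * R)) : (forall i, 0 <= c i) ->
  (forall i, nonneg_weights (L i)) ->
  exists2 l, nonneg_weights l &
  forall z, discrete_stieltjes l z =
    \sum_(i <- r) (c i)%:C * discrete_stieltjes (L i) z.
Proof.
move=> c0 L0; elim: r => [|i r [l l0 hl]].
  by exists [::] => // z; rewrite /discrete_stieltjes !big_nil.
have [l' l'0 hl'] := discrete_stieltjes_scale (c0 i) (L0 i).
exists (l' ++ l); first by rewrite /nonneg_weights all_cat; apply/andP.
by move=> z; rewrite big_cons -hl -hl' /discrete_stieltjes big_cat.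
Qed.

(* Resolvent of the rank-one perturbation [diag w + b b^t] with [b_i^2] the
   weights of [l]. *)
Lemma discrete_stieltjes_inv1D l : nonneg_weights l ->
  exists2 l', nonneg_weights l' & forall z, 0 < Im z ->
    1 + discrete_stieltjes l z != 0 ->
    (1 + discrete_stieltjes l z)^-1 = 1 - discrete_stieltjes l' z.
Proof.
move=> /allP l0; pose d := size l; pose e i := nth (0, 0) l i.
pose w (i : 'I_d) := (e i).2; pose b (i : 'I_d) := Num.sqrt (e i).1.
have bb (i : 'I_d) : b i * b i = (e i).1.
  by rewrite -expr2 sqr_sqrtr// l0// mem_nth.
have [|l' [l'0 _ hl']] := @spectral_stieltjes d
  (fun i j => b i * b j + (if i == j then w i else 0)) b.
  by move=> i j; rewrite mulrC eq_sym; case: eqP => // ->.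
exists l' => // z z0; set t := discrete_stieltjes l z => t1.
have tE : t = \sum_(i < d) (b i * b i)%:C / ((w i)%:C - z).
  rewrite /t /discrete_stieltjes (big_nth (0, 0)) big_mkord.
  by apply: eq_bigr => i _; rewrite bb.
have wz i : (w i)%:C - z != 0 by exact: realc_subz_neq0.
(* The solution of the perturbed system given by the Sherman-Morrison formula. *)
pose y (i : 'I_d) : R[i] := (b i)%:C * ((1 + t)^-1 / ((w i)%:C - z)).
have by_ : \sum_i (b i)%:C * y i = t / (1 + t).
  rewrite tE mulr_suml; apply: eq_bigr => i _; rewrite -tE /y rmorphM/=.
  by rewrite -!mulrA; do 2 congr (_ * _); rewrite mulrC.
rewrite -(hl' z y z0); first by rewrite by_; field.
move=> i.
have -> : \sum_j (b i * b j + (if i == j then w i else 0))%:C * y j =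
    (b i)%:C * (\sum_j (b j)%:C * y j) + (w i)%:C * y i.
  rewrite mulr_sumr -[X in _ + X](big_pred1_eq +%R i (fun j => (w i)%:C * y j)).
  rewrite [X in _ + X]big_mkcond -big_split/=; apply: eq_bigr => j _.
  rewrite rmorphD rmorphM mulrDl mulrA eq_sym; congr (_ + _).
  by case: eqP => [->//|_]; rewrite mul0r.
rewrite by_ -addrA -mulrBl /y; field.
by rewrite t1 wz.
Qed.

(* Corner entry of the resolvent of the bordered matrix [[c, b^t], [b, diag w]]. *)
Lemma discrete_stieltjes_schur (c : R) l : nonneg_weights l ->
  exists l', [/\ nonneg_weights l', \sum_(a <- l') a.1 = 1 & forall z, 0 < Im z ->
    c%:C - z - discrete_stieltjes l z != 0 ->
    (c%:C - z - discrete_stieltjes l z)^-1 = discrete_stieltjes l' z].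
Proof.
move=> /allP l0; pose d := size l; pose e i := nth (0, 0) l i.
pose w (i : 'I_d) := (e i).2; pose b (i : 'I_d) := Num.sqrt (e i).1.
have bb (i : 'I_d) : b i * b i = (e i).1.
  by rewrite -expr2 sqr_sqrtr// l0// mem_nth.
pose B (i j : 'I_d.+1) : R := match unlift ord0 i, unlift ord0 j with
  | None, None => c | None, Some j' => b j' | Some i', None => b i'
  | Some i', Some j' => if i' == j' then w i' else 0 end.
pose f (i : 'I_d.+1) : R := if unlift ord0 i is None then 1 else 0.
have [|l' [l'0 ml' hl']] := @spectral_stieltjes d.+1 B f.
  move=> i j; rewrite /B; case: (unlift ord0 i) => [i'|]; case: (unlift ord0 j) => //.
  by move=> j'; rewrite eq_sym; case: eqP => // ->.
have f0 : f ord0 = 1 by rewrite /f unlift_none.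
have fS i : f (lift ord0 i) = 0 by rewrite /f liftK.
exists l'; split => //.
  rewrite ml' big_ord_recl f0 expr1n big1 ?addr0// => i _.
  by rewrite fS expr0n.
move=> z z0; set t := discrete_stieltjes l z => t1.
have tE : t = \sum_(i < d) (b i * b i)%:C / ((w i)%:C - z).
  rewrite /t /discrete_stieltjes (big_nth (0, 0)) big_mkord.
  by apply: eq_bigr => i _; rewrite bb.
have wz i : (w i)%:C - z != 0 by exact: realc_subz_neq0.
pose k := (c%:C - z - t)^-1.
(* The corner component is the reciprocal [k] of the Schur complement; the other components follow
   by back substitution. *)
pose y (i : 'I_d.+1) : R[i] := if unlift ord0 i is Some i' then
  - ((b i')%:C * (k / ((w i')%:C - z))) else k.
have y0 : y ord0 = k by rewrite /y unlift_none.
have yS i : y (lift ord0 i) = - ((b i)%:C * (k / ((w i)%:C - z))).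
  by rewrite /y liftK.
rewrite -(hl' z y z0).
  rewrite big_ord_recl y0 f0 mul1r big1 ?addr0// => i _.
  by rewrite fS mul0r.
move=> i; case: (unliftP ord0 i) => [j|] ->; last first.
  rewrite big_ord_recl y0 f0 {1}/B unlift_none.
  have -> : \sum_(i0 < d) (B ord0 (lift ord0 i0))%:C * y (lift ord0 i0) = - (t * k).
    rewrite tE mulr_suml -sumrN; apply: eq_bigr => j _.
    rewrite yS /B unlift_none liftK rmorphM/= mulrN -!mulrA; congr (- (_ * (_ * _))).
    by rewrite mulrC.
  transitivity (k * (c%:C - z - t)); last exact: mulVf.
  by ring.
rewrite big_ord_recl y0 fS {1}/B unlift_none liftK.
have -> : \sum_(i0 < d) (B (lift ord0 j) (lift ord0 i0))%:C * y (lift ord0 i0) =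
    (w j)%:C * y (lift ord0 j).
  rewrite (bigD1 j)//= big1 ?addr0 => [|i' ij]; rewrite /B !liftK ?eqxx//.
  by rewrite eq_sym (negbTE ij) mul0r.
rewrite yS -addrA -mulrBl; field.
exact: wz.
Qed.

End DiscreteStieltjes.

Section IterateDiscrete.
Context {R : realType} (p n : nat) (S : 'M[R]_(p, n)).
Hypothesis S_ge0 : forall i k, 0 <= S i k.

(** The map preserves transforms of discrete probability measures: each [1 / q_c] is [1] minus a
    transform, so the new iterate is the reciprocal of [r - z - t] with [r] a row sum and [t] a
    transform, that is, a corner entry of a resolvent. The list is chosen before [z]; this
    uniformity is what makes it a measure. *)
Lemma giter_discrete k i : exists l : seq (R * R),
  [/\ nonneg_weights l, \sum_(a <- l) a.1 = 1 &
  forall z : R[i], 0 < Im z -> giter S z k i = discrete_stieltjes l z].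
Proof.
elim: k i => [|k ih] i.
  exists [:: (1, 0)]; split; rewrite /nonneg_weights /= ?ler01 ?big_seq1// => z z0.
  by rewrite /discrete_stieltjes big_seq1 /= sub0r div1r invrN.
have /choice[L hL] := ih.
have /choice[M hM] : forall c, exists M, nonneg_weights M /\
    forall z : R[i], 0 < Im z -> (gden S (giter S z k) c)^-1 = 1 - discrete_stieltjes M z.
  move=> c; have [||l l0 hl] := @discrete_stieltjes_sum _ _ (index_enum 'I_p)
     (fun j => S j c) L.
  - by move=> j.
  - by move=> j; case: (hL j).
  have [M M0 hM] := discrete_stieltjes_inv1D l0.
  exists M; split => // z z0.
  have gE : gden S (giter S z k) c = 1 + discrete_stieltjes l z.
    rewrite hl; congr (_ + _); apply: eq_bigr => j _.
    by case: (hL j) => _ _ ->.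
  by rewrite gE hM// -gE gden_neq0// => j; exact: giter_gt0.
have [||l l0 hl] := @discrete_stieltjes_sum _ _ (index_enum 'I_n) (fun c => S i c) M.
- by move=> c.
- by move=> c; case: (hM c).
have [l' [l'0 ml' hl']] := discrete_stieltjes_schur (\sum_c S i c) l0.
exists l'; split => // z z0.
have dE : z - \sum_(c < n) (S i c)%:C / gden S (giter S z k) c =
   - ((\sum_c S i c)%:C - z - discrete_stieltjes l z).
  have -> : \sum_(c < n) (S i c)%:C / gden S (giter S z k) c =
      (\sum_c S i c)%:C - discrete_stieltjes l z.
    rewrite hl rmorph_sum -sumrB; apply: eq_bigr => c _.
    by case: (hM c) => _ ->//; rewrite mulrBr mulr1.
  by ring.
rewrite -hl'//.
  by rewrite [giter _ _ _]/(gmap S z (giter S z k)) /gmap dE invrN opprK.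
have := @gmap_neq0 _ _ _ _ S_ge0 z (giter S z k) i z0.
rewrite /gmap oppr_eq0 invr_eq0 dE oppr_eq0; apply => j; exact: giter_gt0.
Qed.

End IterateDiscrete.

Section DiscreteSupport.
Context {R : realType} (p n : nat) (S : 'M[R]_(p, n)).
Hypothesis S_ge0 : forall i k, 0 <= S i k.
Variable s : R.
Hypothesis SA : assumptionA S s.

Lemma assumptionA_sum_le (m : nat) (f : 'I_m -> R) : (m <= p + n)%N ->
  (forall i, f i <= s / (p + n)%:R) -> \sum_i f i <= s.
Proof.
have [s0 _] := SA => mpn fs.
apply: le_trans (_ : \sum_(i < m) (s / (p + n)%:R) <= _); first exact: ler_sum.
rewrite sumr_const card_ord -[_ *+ m]mulr_natr -mulrA ger_pMr//.
have [->|pn0] := eqVneq (p + n)%N 0%N; first by rewrite invr0 mul0r ler01.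
by rewrite mulrC ler_pdivrMr ?mul1r ?ler_nat// ltr0n lt0n.
Qed.

Lemma row_sum_le i : \sum_k S i k <= s.
Proof. by apply: assumptionA_sum_le; [exact: leq_addl|move=> k; case: SA]. Qed.

Lemma col_sum_le k : \sum_i S i k <= s.
Proof. by apply: assumptionA_sum_le; [exact: leq_addr|move=> i; case: SA]. Qed.

(** The origin of [4 * s]. If all [|u_j| <= 2 / |z|], then [|q_k - 1| <= 2 s / |z| <= 1 / 2], so
    [sum_k s_ik / |q_k| <= 2 s <= |z| / 2], and the bound [2 / |z|] reproduces itself. *)
Lemma cabs_giter_far (z : R[i]) k i : 0 < Im z -> 4 * s <= cabs z ->
  cabs (giter S z k i) <= 2 / cabs z.
Proof.
move=> z0 zs; have [s0 _] := SA.
have az : 0 < cabs z by rewrite cabs_gt0 Im_gt0_neq0.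
elim: k i => [|k ih] i.
  by rewrite cabsN cabsV -[leLHS]mul1r ler_pM2r ?invr_gt0// ler1n.
rewrite [giter _ _ _]/(gmap S z (giter S z k)).
have q2 c : 2^-1 <= cabs (gden S (giter S z k) c).
  apply: le_trans (cabs_lbD _ _); rewrite cabs1 lerBrDr -lerBrDl.
  apply: le_trans (cabs_sum _ _ _) _.
  apply: le_trans (_ : \sum_(j < p) S j c * (2 / cabs z) <= _).
    apply: ler_sum => j _; rewrite cabsM cabs_real ger0_norm// ler_wpM2l//.
  rewrite -mulr_suml; apply: le_trans (_ : s * (2 / cabs z) <= _).
    by rewrite ler_wpM2r ?col_sum_le// divr_ge0 ?cabs_ge0.
  rewrite mulrA ler_pdivrMr//; lra.
rewrite cabsN cabsV -[2]invrK -invfM lef_pV2 ?posrE.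
- apply: le_trans (cabs_lbD _ _) => //.
  rewrite cabsN lerBrDr -lerBrDl; apply: le_trans (cabs_sum _ _ _) _.
  apply: le_trans (_ : \sum_(c < n) S i c * 2 <= _).
    apply: ler_sum => c _; rewrite cabsM cabs_real ger0_norm// ler_wpM2l//.
    rewrite cabsV -[leRHS]invrK lef_pV2 ?posrE ?invr_gt0//.
    by apply: lt_le_trans (q2 c); rewrite invr_gt0.
  rewrite -mulr_suml; have := row_sum_le i; lra.
- rewrite cabs_gt0; have := @gmap_neq0 _ _ _ _ S_ge0 z (giter S z k) i z0.
  rewrite /gmap oppr_eq0 invr_eq0; apply=> j; exact: giter_gt0.
- by rewrite mulr_gt0// invr_gt0.
Qed.

(** Stability reads [(- Re z) Im g <= Im z Re g]. Together with [|g|^2 Im z <= Im g] and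
    [Re g <= |g|] it leaves the claim after cancelling [Im z * |g|]. *)
Lemma cabs_giter_neg (z : R[i]) k i : 0 < Im z -> Re z < 0 ->
  cabs (giter S z k i) <= (- Re z)^-1.
Proof.
move=> z0 zR; case: k => [|k].
  rewrite cabsN cabsV lef_pV2 ?posrE ?oppr_gt0 ?cabs_gt0 ?Im_gt0_neq0//.
  by apply: le_trans (Re_le_cabs _); rewrite -normrN ler_norm.
have [g0 gz] := giter_stable S_ge0 k.+1 z0 i.
have := Im_gmap S z (giter S z k) i.
rewrite -[gmap S z (giter S z k) i]/(giter S z k.+1 i).
have := gweight_ge0 S_ge0 i (fun j => giter_gt0 S_ge0 k j z0).
set g := giter S z k.+1 i in g0 gz *; set w := gweight _ _ _ => w0 gE.
have ag : 0 < cabs g by rewrite cabs_gt0 Im_gt0_neq0.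
rewrite ImM in gz.
have h1 : cabs g ^+ 2 * Im z <= Im g by rewrite gE ler_wpM2l ?sqr_ge0// lerDl.
have h2 : Re g <= cabs g by apply: le_trans (Re_le_cabs _); exact: ler_norm.
have h3 : (- Re z) * (cabs g ^+ 2 * Im z) <= Im z * cabs g.
  apply: le_trans (_ : Im z * Re g <= _); last by rewrite ler_wpM2l// ltW.
  apply: le_trans (_ : (- Re z) * Im g <= _).
    by rewrite ler_wpM2l// oppr_ge0 ltW.
  by rewrite mulNr -subr_ge0 opprK addrC.
have h4 : cabs g * (- Re z) <= 1.
  rewrite -(ler_pM2r (mulr_gt0 z0 ag)) mul1r; apply: le_trans h3.
  by rewrite le_eqVlt; apply/orP; left; apply/eqP; ring.
by rewrite -[leRHS]mul1r ler_pdivlMr// oppr_gt0.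
Qed.

Lemma Im_discrete_stieltjes (l : seq (R * R)) (z : R[i]) :
  Im (discrete_stieltjes l z) =
    \sum_(a <- l) a.1 * (Im z / cabs (a.2%:C - z) ^+ 2).
Proof.
rewrite Im_sum; apply: eq_bigr => a _.
by rewrite ImZ ImV ImD ImN /= sub0r opprK.
Qed.

(* An atom of mass [c] at [x] contributes [c / e] to [Im] at [x + i e]. *)
Lemma discrete_stieltjes_atom (l : seq (R * R)) (a : R * R) (M : R) :
  nonneg_weights l -> a \in l ->
  (forall e, 0 < e -> cabs (discrete_stieltjes l (a.2 +i* e)) <= M) ->
  a.1 = 0.
Proof.
move=> /allP l0 al hM; apply/eqP; rewrite eq_le l0// andbT.
have M0 : 0 <= M by apply: le_trans (hM 1 ltr01); exact: cabs_ge0.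
apply/ler_addgt0Pl => e e0; rewrite addr0.
have M1 : 0 < M + 1 by rewrite ltr_wpDl.
pose d := e / (M + 1); have d0 : 0 < d by rewrite divr_gt0.
have h : a.1 / d <= M.
  apply: le_trans (hM d d0); apply: le_trans (Im_le_cabs _).
  apply: le_trans (ler_norm _); rewrite Im_discrete_stieltjes.
  rewrite (big_rem a)//=.
  have -> : a.1 / d = a.1 * (d / cabs (a.2%:C - a.2 +i* d) ^+ 2).
    congr (_ * _); rewrite sqr_cabs /= subrr expr0n/= add0r sub0r sqrrN.
    by move: (d) d0 => x x0; field; rewrite gt_eqF.
  rewrite lerDl big_seq; apply: sumr_ge0 => b /mem_rem bl.
  by rewrite mulr_ge0 ?l0// divr_ge0 ?sqr_ge0// ltW.
move: h; rewrite ler_pdivrMr// => /le_trans; apply.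
rewrite /d mulrA ler_pdivrMr// mulrC ler_wpM2l ?(ltW e0)//.
by rewrite lerDl ler01.
Qed.

(** A node outside [[0, 4 * s]] has weight zero, because the iterate stays bounded on the vertical
    line above it. Discarding the entries of weight zero therefore localizes the nodes and keeps the
    transform. *)
Lemma giter_measure k i : exists l : seq (R * R),
  [/\ nonneg_weights l, \sum_(a <- l) a.1 = 1,
      forall a, a \in l -> 0 <= a.2 <= 4 * s &
  forall z : R[i], 0 < Im z -> giter S z k i = discrete_stieltjes l z].
Proof.
have [l [l0 l1 hl]] := giter_discrete S_ge0 k i.
exists [seq a <- l | a.1 != 0]; split.
- by apply/allP => a; rewrite mem_filter => /andP[_ /(allP l0)].
- rewrite big_filter -l1 [RHS](bigID (fun a => a.1 != 0))/=.
  by rewrite [X in _ + X]big1 ?addr0// => a /negPn/eqP.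
- move=> a; rewrite mem_filter => /andP[/eqP aN0 al].
  have [s0 _] := SA.
  apply/andP; split; rewrite leNgt; apply/negP => ax; apply: aN0.
    apply: (discrete_stieltjes_atom (M := (- a.2)^-1) l0 al) => e e0.
    by rewrite -hl//; apply: (@cabs_giter_neg (a.2 +i* e)).
  apply: (discrete_stieltjes_atom (M := 2 / (4 * s)) l0 al) => e e0.
  have h : 4 * s <= cabs (a.2 +i* e).
    apply: le_trans (ltW ax) _; apply: le_trans (ler_norm _) _.
    exact: (@Re_le_cabs _ (a.2 +i* e)).
  rewrite -hl//; apply: le_trans (cabs_giter_far _ _ _ h) _ => //.
  by rewrite ler_wpM2l// lef_pV2 ?posrE ?mulr_gt0//; apply: lt_le_trans h; rewrite mulr_gt0.
- move=> z z0; rewrite hl// /discrete_stieltjes big_filter.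
  rewrite [LHS](bigID (fun a => a.1 != 0))/=.
  by rewrite [X in _ + X]big1 ?addr0// => a /negPn/eqP ->; rewrite mul0r.
Qed.

End DiscreteSupport.

(** * Helly selection *)

Section RightContinuousRegularization.
Context {R : realType}.

(** A pointwise limit of distribution functions is monotone but may fail to be right-continuous; [H]
    is its right limit. The sandwich between values of [G] is all that is kept, which avoids any
    discussion of continuity points. *)
Lemma cdf_regularization (G : R -> R) (b : R) : {homo G : x y / x <= y} ->
  (forall x, x < 0 -> G x = 0) -> (forall x, b <= x -> G x = 1) ->
  exists (nu : probability (measurableTypeR R) R) (H : R -> R),
    (forall x, nu `]-oo, x]%classic = (H x)%:E) /\
    (forall x y, x < y -> G x <= H x <= G y).
Proof.
move=> Gnd G0 G1.
pose H x := inf [set G y | y in `]x, +oo[].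
have Gge0 x : 0 <= G x.
  have [x0|x0] := ltP x 0; first by rewrite G0.
  by rewrite -(G0 (-1)) ?Gnd// ?ltrN10// (le_trans _ x0)// lerN10.
have lb x : has_lbound [set G y | y in `]x, +oo[].
  by exists 0 => _ [y _ <-].
have ne x : [set G y | y in `]x, +oo[] !=set0.
  by exists (G (x + 1)), (x + 1) => //=; rewrite in_itv/= andbT ltrDl.
have Hle x y : x < y -> H x <= G y.
  by move=> xy; apply: ge_inf => //; exists y => //=; rewrite in_itv/= andbT.
have leH x t : (forall y, x < y -> t <= G y) -> t <= H x.
  move=> h; apply: lb_le_inf => // e [y /=].
  by rewrite in_itv/= andbT => xy <-; exact: h.
have GH x : G x <= H x by apply: leH => y xy; rewrite Gnd// ltW.
have Hnd : {homo H : x y / x <= y}.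
  by move=> x y xy; apply: leH => t yt; apply: Hle; exact: le_lt_trans yt.
have Hrc : forall x, H @ at_right x --> H x.
  move=> x; apply/cvgrPdist_lt => e e0.
  have [v [y /= xy yv] ve] := inf_adherent e0 (conj (ne x) (lb x)).
  have {}xy : x < y by move: xy; rewrite in_itv/= andbT.
  have ye : G y < H x + e by rewrite yv.
  near=> t.
  have xt : x < t by near: t; exact: nbhs_right_gt.
  have ty : t < y by near: t; exact: nbhs_right_lt.
  rewrite ler0_norm ?subr_le0 ?Hnd ?(ltW xt)// opprB ltrBlDl.
  exact: le_lt_trans (Hle _ _ ty) ye.
have HNy : H @ -oo --> (0 : R).
  apply: cvg_near_cst; near=> x.
  have x0 : x < 0 by near: x; exact: nbhs_ninfty_lt.
  apply/eqP; rewrite eq_le (le_trans (Gge0 x) (GH x)) andbT.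
  by rewrite -(G0 (x / 2)) ?Hle//; lra.
have Hy : H @ +oo --> (1 : R).
  apply: cvg_near_cst; near=> x.
  have xb : b <= x by near: x; by apply: nbhs_pinfty_ge; exact: num_real.
  apply/eqP; rewrite eq_le; apply/andP; split.
    have := Hle x (x + 1); rewrite (G1 (x + 1)); last by rewrite (le_trans xb)// lerDl.
    by apply; rewrite ltrDl.
  by have := GH x; rewrite G1.
pose c : cumulativeBounded (0 : R) (1 : R) := HB.pack H
  (isCumulative.Build R _ R H Hnd Hrc) (isCumulativeBounded.Build R 0 1 H HNy Hy).
exists (lebesgue_stieltjes_measure c), H; split; last first.
  by move=> x y xy; rewrite GH Hle.
move=> x; have := cdf_lebesgue_stieltjes_id c x.
by rewrite /cdf/= /distribution/= /pushforward/=.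
Unshelve. all: by end_near. Qed.

End RightContinuousRegularization.

Section StepApproximation.
Context {R : realType}.
Variables (b : R) (N : nat).
Hypothesis b_gt0 : 0 < b.
Implicit Types (f : R -> R) (w x : R).

Let mesh : R := b / N.+1%:R.
(* The nodes start at [- mesh], so that a possible atom at [0] lies inside a cell. *)
Let node (j : nat) : R := (j%:R - 1) * mesh.

Definition le_ind x w : R := (w <= x)%R%:R.

(** On each cell, open on the left and closed on the right, [f] is frozen at the left node. Written
    with [le_ind], its integral involves only values of the distribution function [H], and
    [step_sum] is that integral. *)
Definition step_fun f w : R :=
  \sum_(j < N.+2) f (node j) * (le_ind (node j.+1) w - le_ind (node j) w).

Definition step_sum f (H : R -> R) : R :=
  \sum_(j < N.+2) f (node j) * (H (node j.+1) - H (node j)).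

Let mesh_gt0 : 0 < mesh. Proof. by rewrite divr_gt0. Qed.

Let nodeS j : node j.+1 = node j + mesh.
Proof. by rewrite /node -natr1; ring. Qed.

Let node_lt j : node j < node j.+1. Proof. by rewrite nodeS ltrDl. Qed.

Let node0 : node 0 < 0. Proof. by rewrite /node sub0r mulN1r oppr_lt0. Qed.

Let nodeN : node N.+2 = b.
Proof. by rewrite /node -natr1 addrK /mesh mulrC mulfVK// pnatr_eq0. Qed.

Let telescope (D : nat -> R) :
  \sum_(j < N.+2) (D j.+1 - D j) = D N.+2 - D 0.
Proof.
by rewrite -(big_mkord xpredT (fun j => D j.+1 - D j)) telescope_sumr.
Qed.

Lemma step_fun_approx f K w : (forall x y, `|f x - f y| <= K * `|x - y|) ->
  0 <= w <= b -> `|f w - step_fun f w| <= K * mesh.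
Proof.
move=> fK /andP[w0 wb].
have K0 : 0 <= K by have := le_trans (normr_ge0 _) (fK 1 0); rewrite subr0 normr1 mulr1.
have tot : \sum_(j < N.+2) (le_ind (node j.+1) w - le_ind (node j) w) = 1.
  rewrite (telescope (fun j => le_ind (node j) w)) nodeN /le_ind wb (lt_geF (lt_le_trans node0 w0)).
  by rewrite subr0.
rewrite -[f w]mulr1 -[in f w * 1]tot mulr_sumr -sumrB.
rewrite -[leRHS]mulr1 -[in leRHS]tot mulr_sumr.
apply: le_trans (ler_norm_sum _ _ _) _; apply: ler_sum => j _.
rewrite -mulrBl normrM /le_ind.
have [wj|wj] := leP w (node j).
  by rewrite (le_trans wj (ltW (node_lt j))) subrr normr0 !mulr0.
have [wj1|_] := leP w (node j.+1); last by rewrite subrr normr0 !mulr0.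
rewrite subr0 normr1 !mulr1; apply: le_trans (fK _ _) _.
rewrite ler_wpM2l// ger0_norm ?subr_ge0 ?(ltW wj)//.
by rewrite lerBlDl -nodeS.
Qed.

(** Summation by parts moves the differences onto [f], whose increments are at most [K * mesh]. The
    remaining factor is the sum of the gaps [d j = H (node j) - G (node j)]; each is at most an
    increment of [G], so they telescope to at most [1]. *)
Lemma step_sum_regularize f K (G H : R -> R) :
  (forall x y, `|f x - f y| <= K * `|x - y|) ->
  (forall x, x < 0 -> G x = 0) -> (forall x, b <= x -> G x = 1) ->
  (forall x y, x < y -> G x <= H x <= G y) ->
  `|step_sum f H - step_sum f G| <= K * mesh.
Proof.
move=> fK G0 G1 GH.
have K0 : 0 <= K by have := le_trans (normr_ge0 _) (fK 1 0); rewrite subr0 normr1 mulr1.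
pose d j := H (node j) - G (node j).
have d0 j : 0 <= d j by rewrite subr_ge0; case/andP: (GH _ _ (node_lt j)).
have dle j : d j <= G (node j.+1) - G (node j).
  by rewrite lerD2r; case/andP: (GH _ _ (node_lt j)).
have dz : d 0 = 0.
  apply/eqP; rewrite eq_le d0 andbT /d (G0 (node 0))// subr0.
  have h2 : node 0 < node 0 / 2 by have := node0; lra.
  have /andP[_] := GH _ _ h2; rewrite (G0 (node 0 / 2))//.
  by have := node0; lra.
have dN : d N.+2 = 0.
  apply/eqP; rewrite eq_le d0 andbT; apply: le_trans (dle _) _.
  by rewrite !G1 ?subrr ?nodeN// nodeS nodeN lerDl ltW.
have -> : step_sum f H - step_sum f G =
   \sum_(j < N.+2) f (node j) * (d j.+1 - d j).
  by rewrite /step_sum -sumrB; apply: eq_bigr => j _; rewrite /d; ring.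
have -> : \sum_(j < N.+2) f (node j) * (d j.+1 - d j) =
   - \sum_(j < N.+2) (f (node j.+1) - f (node j)) * d j.+1.
  apply/eqP; rewrite -subr_eq0 opprK -big_split/=; apply/eqP.
  transitivity (\sum_(j < N.+2) (f (node j.+1) * d j.+1 - f (node j) * d j)).
    by apply: eq_bigr => j _; ring.
  by rewrite (telescope (fun j => f (node j) * d j)) dN dz !mulr0 subrr.
rewrite normrN; apply: le_trans (ler_norm_sum _ _ _) _.
apply: le_trans (_ : \sum_(j < N.+2) K * mesh * d j.+1 <= _).
  apply: ler_sum => j _; rewrite normrM (ger0_norm (d0 _)) ler_wpM2r//.
  by apply: le_trans (fK _ _) _; rewrite nodeS addrAC subrr add0r gtr0_norm.
have Km0 : 0 <= K * mesh by apply: mulr_ge0 => //; exact: ltW.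
rewrite -mulr_sumr -[leRHS]mulr1; apply: (ler_wpM2l Km0).
apply: le_trans (_ : \sum_(j < N.+2) (G (node j.+2) - G (node j.+1)) <= _).
  by apply: ler_sum => j _; exact: dle.
rewrite (telescope (fun j => G (node j.+1))) lerBlDr.
rewrite (G1 (node N.+3)); last by rewrite nodeS nodeN lerDl ltW.
rewrite lerDl; have -> : node 1 = 0 by rewrite /node subrr mul0r.
have /andP[h1 h2] := GH (- 1) 0 (ltrN10 _).
by rewrite (G0 (-1)) ?ltrN10// in h1; rewrite (le_trans h1).
Qed.

Definition discrete_cdf (l : seq (R * R)) x : R :=
  \sum_(a <- l) a.1 * le_ind x a.2.

Lemma step_sum_discrete f K (l : seq (R * R)) :
  (forall x y, `|f x - f y| <= K * `|x - y|) ->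
  nonneg_weights l -> \sum_(a <- l) a.1 = 1 ->
  (forall a, a \in l -> 0 <= a.2 <= b) ->
  `|\sum_(a <- l) a.1 * f a.2 - step_sum f (discrete_cdf l)| <= K * mesh.
Proof.
move=> fK /allP l0 l1 lb.
have -> : step_sum f (discrete_cdf l) = \sum_(a <- l) a.1 * step_fun f a.2.
  rewrite /step_sum /step_fun; under [RHS]eq_bigr do rewrite mulr_sumr.
  rewrite exchange_big/=; apply: eq_bigr => j _.
  rewrite /discrete_cdf -sumrB mulr_sumr; apply: eq_bigr => a _; ring.
rewrite -sumrB; apply: le_trans (ler_norm_sum _ _ _) _.
rewrite -[leRHS]mulr1 -[in leRHS]l1 mulr_sumr big_seq [leRHS]big_seq.
apply: ler_sum => a al; rewrite -mulrBr normrM (ger0_norm (l0 a al)) mulrC.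
by rewrite ler_wpM2r ?l0// step_fun_approx// lb.
Qed.

End StepApproximation.

Section ProbabilityIntegral.
Context {R : realType} (nu : probability (measurableTypeR R) R).
Implicit Types (f g : R -> R).

Lemma prob_bounded_integrable f (M : R) :
  measurable_fun setT (f : measurableTypeR R -> R) -> (forall x, `|f x| <= M) ->
  nu.-integrable setT (EFin \o (f : measurableTypeR R -> R)).
Proof.
move=> mf fM; apply: measurable_bounded_integrable => //.
  by rewrite (le_lt_trans (probability_le1 _ _))// ltry.
exists M; split; first exact: num_real.
by move=> y My x _ /=; rewrite (le_trans (fM x))// ltW.
Qed.

Lemma measurable_le_ind x :
  measurable_fun setT (le_ind x : measurableTypeR R -> R).
Proof.
rewrite (_ : le_ind x = \1_(`]-oo, x]%classic)).
  by apply/measurable_indicP; exact: measurable_itv.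
by apply/funext => w; rewrite /le_ind indicE mem_setE in_itv.
Qed.

Lemma Rintegral_le_ind x (H : R) : nu `]-oo, x]%classic = H%:E ->
  \int[nu]_w le_ind x w = H.
Proof.
move=> nuH; rewrite /Rintegral (_ : (fun w => _) =
    fun w => (\1_(`]-oo, x]%classic : set (measurableTypeR R)) w)%:E).
  have mI : measurable (`]-oo, x]%classic : set (measurableTypeR R)).
    exact: measurable_itv.
  by rewrite integral_indic// setIT; exact: (congr1 fine nuH).
by apply/funext => w; rewrite /le_ind indicE mem_setE in_itv.
Qed.

Lemma Rintegral_sum (I : Type) (r : seq I) (F : I -> R -> R) :
  (forall i, nu.-integrable setT (EFin \o (F i : measurableTypeR R -> R))) ->
  nu.-integrable setT
    (EFin \o ((fun w => \sum_(i <- r) F i w) : measurableTypeR R -> R)) /\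
  \int[nu]_w (\sum_(i <- r) F i w) = \sum_(i <- r) \int[nu]_w F i w.
Proof.
move=> iF; elim: r => [|i r [ih1 ih2]].
  under eq_fun do rewrite big_nil.
  rewrite big_nil Rintegral_cst// mul0r; split => //.
  by apply: (@prob_bounded_integrable _ 0) => // x; rewrite normr0.
under eq_fun do rewrite big_cons.
rewrite big_cons -ih2 RintegralD//; split => //.
rewrite (_ : _ \o _ = fun w => ((F i w)%:E + (\sum_(j <- r) F j w)%:E)%E)//.
exact: (integrableD measurableT (iF i) ih1).
Qed.

Lemma Rintegral_step f b N (H : R -> R) :
  (forall x, nu `]-oo, x]%classic = (H x)%:E) ->
  nu.-integrable setT (EFin \o (step_fun b N f : measurableTypeR R -> R)) /\
  \int[nu]_w step_fun b N f w = step_sum b N f H.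
Proof.
move=> nuH.
have int_ind x : nu.-integrable setT (EFin \o (le_ind x : measurableTypeR R -> R)).
  apply: (@prob_bounded_integrable _ 1); first exact: measurable_le_ind.
  by move=> w; rewrite /le_ind; case: (w <= x); rewrite ?normr1// normr0.
have int_B x y : nu.-integrable setT
    (EFin \o ((fun w => le_ind x w - le_ind y w) : measurableTypeR R -> R)).
  rewrite (_ : _ \o _ = fun w => ((le_ind x w)%:E - (le_ind y w)%:E)%E)//.
  exact: (integrableB measurableT (int_ind x) (int_ind y)).
have [|h1 h2] := @Rintegral_sum _ (index_enum 'I_N.+2) (fun j w =>
  f ((j%:R - 1) * (b / N.+1%:R)) *
   (le_ind ((j.+1%:R - 1) * (b / N.+1%:R)) w - le_ind ((j%:R - 1) * (b / N.+1%:R)) w)).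
  move=> j; rewrite (_ : _ \o _ = fun w => ((f ((j%:R - 1) * (b / N.+1%:R)))%:E *
    ((le_ind ((j.+1%:R - 1) * (b / N.+1%:R)) w -
      le_ind ((j%:R - 1) * (b / N.+1%:R)) w))%:E)%E)//.
  exact: (integrableZl measurableT _ (int_B _ _)).
split; first exact: h1.
rewrite [LHS]h2; apply: eq_bigr => j _.
rewrite RintegralZl//; congr (_ * _).
by rewrite RintegralB//; congr (_ - _); apply: Rintegral_le_ind.
Qed.

End ProbabilityIntegral.

Section Helly.
Context {R : realType}.

Lemma le0_of_le_div (x c : R) : (forall N : nat, x <= c / N.+1%:R) -> x <= 0.
Proof.
move=> h; rewrite leNgt; apply/negP => x0.
have c0 : 0 <= c.
  by have := h 0%N; rewrite divr1; apply: le_trans; exact: ltW.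
have := archi_boundP (divr_ge0 c0 (ltW x0)); set N := Num.bound _ => cN.
have := h N; rewrite leNgt => /negP; apply.
rewrite ltr_pdivrMr// mulrC -ltr_pdivrMr//; apply: lt_trans cN _.
by rewrite ltr_nat.
Qed.

Lemma lipschitz_continuous (f : R -> R) K :
  (forall x y, `|f x - f y| <= K * `|x - y|) -> continuous f.
Proof.
move=> fK x; apply/cvgrPdist_lt => e e0.
have K0 : 0 <= K by have := le_trans (normr_ge0 _) (fK 1 0); rewrite subr0 normr1 mulr1.
have K1 : 0 < K + 1 by rewrite ltr_wpDl.
have := (@cvgrPdist_lt R R R (nbhs x) (nbhs_filter x) id x).1 (@cvg_id _ _) _ (divr_gt0 e0 K1).
apply: filterS => y xy; apply: le_lt_trans (fK _ _) _.
apply: (@le_lt_trans _ _ ((K + 1) * `|x - y|)).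
  by rewrite ler_wpM2r// lerDl.
by rewrite mulrC -ltr_pdivlMr.
Qed.

Lemma Rintegral_null_setC (nu : probability (measurableTypeR R) R)
    (D : set (measurableTypeR R)) (f : R -> R) : measurable D -> nu (~` D) = 0%E ->
  nu.-integrable setT (EFin \o (f : measurableTypeR R -> R)) ->
  \int[nu]_w f w = \int[nu]_(w in D) f w.
Proof.
move=> mD nD fi; rewrite /Rintegral; congr fine.
have mC : measurable (~` D) by exact: measurableC.
rewrite (negligible_integral mC measurableT fi nD).
by rewrite setTD setCK.
Qed.

Lemma rcvg_sum (T : Type) (F : set_system T) (FF : Filter F) (I : Type)
    (r : seq I) (f : I -> T -> R) (a : I -> R) :
  (forall i, f i @ F --> a i) ->
  (fun t => \sum_(i <- r) f i t) @ F --> \sum_(i <- r) a i.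
Proof.
move=> h; elim: r => [|i r ih].
  by rewrite big_nil; under eq_fun do rewrite big_nil; exact: cvg_cst.
by rewrite big_cons; under eq_fun do rewrite big_cons; exact: cvgD.
Qed.

(** Bounded Lipschitz test functions cover the real and imaginary parts of the Cauchy kernel. The
    integral and the limit [l] are compared through the step sums of [H] and of [G]; each of the
    three errors is at most [K * b / N.+1], whence the factor [3]. *)
Lemma helly (U : set_system nat) (UU : UltraFilter U) (L : nat -> seq (R * R))
    (b : R) : 0 < b ->
  (forall k, [/\ nonneg_weights (L k), \sum_(a <- L k) a.1 = 1 &
                 forall a, a \in L k -> 0 <= a.2 <= b]) ->
  exists nu : probability (measurableTypeR R) R,
    nu (~` `[0, b]%classic) = 0%E /\
    forall (f : R -> R) (K M l : R),
      (forall x y, `|f x - f y| <= K * `|x - y|) -> (forall x, `|f x| <= M) ->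
      (fun k => \sum_(a <- L k) a.1 * f a.2) @ U --> l ->
      \int[nu]_w f w = l.
Proof.
move=> b0 LP; have PU : ProperFilter U := @ultra_proper _ _ UU.
have wle k x : 0 <= discrete_cdf (L k) x <= 1.
  have [/allP l0 l1 _] := LP k; rewrite -[X in _ <= _ <= X]l1 /discrete_cdf.
  rewrite big_seq [leRHS in _ && (_ <= leRHS)]big_seq; apply/andP; split.
    by apply: sumr_ge0 => a /l0 a0; rewrite mulr_ge0// ler0n.
  apply: ler_sum => a /l0 a0; rewrite -[leRHS]mulr1 ler_wpM2l// /le_ind.
  by case: (a.2 <= x); rewrite ?ler01.
have /choice[G hG] : forall x, exists l : R, (fun k => discrete_cdf (L k) x) @ U --> l.
  by move=> x; apply: (bounded_ultra_cvg (a := 0) (b := 1)) => k.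
have Gnd : {homo G : x y / x <= y}.
  move=> x y xy; apply: (ler_cvg_to (hG x) (hG y)); apply: nearW => k.
  have [/allP l0 _ _] := LP k.
  rewrite /discrete_cdf big_seq [leRHS]big_seq; apply: ler_sum => a /l0 a0.
  rewrite ler_wpM2l// /le_ind ler_nat; case: (leP a.2 x) => // ax.
  by rewrite (le_trans ax xy).
have G0 x : x < 0 -> G x = 0.
  move=> x0; apply: (cvg_unique (@norm_hausdorff _ R) (hG x)).
  apply: cvg_near_cst; apply: nearW => k; have [_ _ lb] := LP k.
  rewrite /discrete_cdf big_seq big1// => a /lb/andP[a0 _].
  by rewrite /le_ind leNgt (lt_le_trans x0 a0) mulr0.
have G1 x : b <= x -> G x = 1.
  move=> bx; apply: (cvg_unique (@norm_hausdorff _ R) (hG x)).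
  apply: cvg_near_cst; apply: nearW => k; have [_ l1 lb] := LP k.
  rewrite /discrete_cdf -[RHS]l1 big_seq [RHS]big_seq; apply: eq_bigr => a /lb/andP[_ ab].
  by rewrite /le_ind (le_trans ab bx) mulr1.
have [nu [H [nuH GH]]] := cdf_regularization Gnd G0 G1.
have mD : measurable (`[0, b]%classic : set (measurableTypeR R)).
  exact: measurable_itv.
have nuD : nu (~` `[0, b]%classic) = 0%E.
  have H0 x : x < 0 -> H x = 0.
    move=> x0; have x2 : x < x / 2 by lra.
    have /andP[h1 h2] := GH _ _ x2; apply/eqP; rewrite eq_le.
    by rewrite -{1}(G0 (x / 2)) ?h2/=; [rewrite -(G0 x)|lra].
  have Hb : H b = 1.
    have /andP[h1 h2] := GH b (b + 1) (ltr_pwDr ltr01 (lexx b)).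
    apply/eqP; rewrite eq_le -{2}(G1 b)// h1 andbT -(G1 (b + 1))//.
    by rewrite lerDl.
  (* Only half-lines closed on the right are read off from [H], so the open one is exhausted by
     those. *)
  have neg : nu.-negligible (`]-oo, 0[%classic : set (measurableTypeR R)).
    have sub : (`]-oo, 0[%classic : set (measurableTypeR R)) `<=`
        \bigcup_k `]-oo, - (k.+1%:R^-1)]%classic.
      move=> x /=; rewrite in_itv/= => x0.
      have := archi_boundP (ltW (_ : 0 < (- x)^-1)).
      rewrite invr_gt0 oppr_gt0 => /(_ x0); set k := Num.bound _ => hk.
      exists k => //=; rewrite in_itv/= lerNr -[leRHS]invrK lef_pV2 ?posrE//.
        by rewrite (le_trans (ltW hk))// ler_nat.
      by rewrite invr_gt0 oppr_gt0.
    apply: (negligibleS sub); apply: negligible_bigcup => k.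
    exists `]-oo, - (k.+1%:R^-1)]%classic; split; [exact: measurable_itv| |by []].
    by apply: etrans (nuH _) _; rewrite H0// oppr_lt0 invr_gt0.
  have pos : nu.-negligible (`]b, +oo[%classic : set (measurableTypeR R)).
    exists `]b, +oo[%classic; split; [exact: measurable_itv| |by []].
    have mb : measurable (`]-oo, b]%classic : set (measurableTypeR R)).
      exact: measurable_itv.
    rewrite -setCitvl; apply: etrans (probability_setC nu mb) _.
    have -> : nu (`]-oo, b]%classic : set (measurableTypeR R)) = 1%E.
      by rewrite -Hb; exact: nuH.
    by rewrite subee.
  have : nu.-negligible (~` `[0, b]%classic : set (measurableTypeR R)).
    by apply: negligibleS (negligibleU neg pos); rewrite setCitv.
  move=> /negligibleP; apply; exact: measurableC.
exists nu; split => // f K M l fK fM fl.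
apply/eqP; rewrite -subr_eq0 -normr_eq0 eq_le normr_ge0 andbT.
apply: (@le0_of_le_div _ (3 * (K * b))) => N.
have K0 : 0 <= K by have := le_trans (normr_ge0 _) (fK 1 0); rewrite subr0 normr1 mulr1.
have mf : measurable_fun setT (f : measurableTypeR R -> R).
  exact: (continuous_measurable_fun (lipschitz_continuous fK)).
have fi := prob_bounded_integrable nu mf fM.
have [si sE] := Rintegral_step f b N nuH.
have h1 : `|\int[nu]_w f w - step_sum b N f H| <= K * (b / N.+1%:R).
  rewrite -sE -RintegralB//.
  have di : nu.-integrable setT
      (EFin \o ((fun w => f w - step_fun b N f w) : measurableTypeR R -> R)).
    exact: (integrableB measurableT fi si).
  rewrite (Rintegral_null_setC mD nuD di).
  have diD : nu.-integrable (`[0, b]%classic : set (measurableTypeR R))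
      (EFin \o ((fun w => f w - step_fun b N f w) : measurableTypeR R -> R)).
    exact: (integrableS measurableT mD (@subsetT _ _) di).
  apply: le_trans (le_normr_Rintegral mD diD) _.
  apply: (@le_trans _ _ (\int[nu]_(w in `[0, b]%classic) (K * (b / N.+1%:R)))).
    apply: le_Rintegral => //.
    - exact: (integrable_abse diD).
    - exact: finite_measure_integrable_cst.
    - move=> w; rewrite /= in_itv/= => wb; exact: step_fun_approx.
  rewrite Rintegral_cst// -[leRHS]mulr1 ler_wpM2l//.
    by rewrite mulr_ge0// divr_ge0// ltW.
  by rewrite -lee_fin fineK ?probability_le1// fin_num_measure.
have h2 := step_sum_regularize N b0 fK G0 G1 GH.
have h3 : `|l - step_sum b N f G| <= K * (b / N.+1%:R).
  have cs : (fun k => step_sum b N f (discrete_cdf (L k))) @ U --> step_sum b N f G.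
    apply: rcvg_sum => j; apply: cvgMr; apply: cvgB; exact: hG.
  have h : (fun k => `|\sum_(a <- L k) a.1 * f a.2 - step_sum b N f (discrete_cdf (L k))|)
      @ U --> `|l - step_sum b N f G|.
    by apply: cvg_norm; exact: cvgB.
  apply: (cvgr_to_le h); apply: nearW => k; have [l0 l1 lb] := LP k.
  exact: step_sum_discrete.
set A := \int[nu]_w f w in h1 *; set B := step_sum b N f H in h1 h2.
set C := step_sum b N f G in h2 h3.
have -> : A - l = (A - B) + (B - C) - (l - C) by ring.
apply: le_trans (ler_normB _ _) _; apply: le_trans (lerD (ler_normD _ _) h3) _.
have := lerD (lerD h1 h2) (lexx (K * (b / N.+1%:R))).
have -> : 3 * (K * b) / N.+1%:R = 3 * (K * (b / N.+1%:R)) by rewrite !mulrA.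
by move: (K * _) => q; lra.
Qed.

End Helly.

(** * Stieltjes transforms and existence *)

Section CauchyKernel.
Context {R : realType}.
Implicit Types (z : R[i]) (w : R).

Lemma cabs_subz_ge w z : 0 < Im z -> Im z <= cabs (w%:C - z).
Proof.
move=> z0; apply: le_trans (Im_le_cabs _); rewrite ImD ImN /= sub0r normrN.
exact: ler_norm.
Qed.

Lemma cabs_kernel_le w z : 0 < Im z -> cabs (w%:C - z)^-1 <= (Im z)^-1.
Proof.
move=> z0; rewrite cabsV lef_pV2 ?posrE ?cabs_subz_ge//.
by rewrite cabs_gt0 realc_subz_neq0.
Qed.

Lemma kernel_lipschitz z w v : 0 < Im z ->
  cabs ((w%:C - z)^-1 - (v%:C - z)^-1) <= (Im z)^-1 ^+ 2 * `|w - v|.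
Proof.
move=> z0; have wz := realc_subz_neq0 w z0; have vz := realc_subz_neq0 v z0.
have -> : (w%:C - z)^-1 - (v%:C - z)^-1 =
    (w%:C - z)^-1 * (v%:C - z)^-1 * (v - w)%:C.
  by rewrite rmorphB/=; field; rewrite wz vz.
rewrite !cabsM cabs_real distrC ler_wpM2r// expr2.
by rewrite ler_pM ?cabs_ge0// cabs_kernel_le.
Qed.

Lemma Re_kernel_lipschitz z w v : 0 < Im z ->
  `|Re (w%:C - z)^-1 - Re (v%:C - z)^-1| <= (Im z)^-1 ^+ 2 * `|w - v|.
Proof.
move=> z0; apply: le_trans (kernel_lipschitz w v z0).
by rewrite -ReN -ReD Re_le_cabs.
Qed.

Lemma Im_kernel_lipschitz z w v : 0 < Im z ->
  `|Im (w%:C - z)^-1 - Im (v%:C - z)^-1| <= (Im z)^-1 ^+ 2 * `|w - v|.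
Proof.
move=> z0; apply: le_trans (kernel_lipschitz w v z0).
by rewrite -ImN -ImD Im_le_cabs.
Qed.

End CauchyKernel.

Section ComplexIntegral.
Context {R : realType} (nu : probability (measurableTypeR R) R).
Implicit Types (f g : measurableTypeR R -> R[i]) (z c : R[i]).

Definition cintegrable f :=
  nu.-integrable setT (EFin \o (fun w => Re (f w))) /\
  nu.-integrable setT (EFin \o (fun w => Im (f w))).

Lemma cintegrable_bounded f (M : R) :
  measurable_fun setT (fun w => Re (f w)) ->
  measurable_fun setT (fun w => Im (f w)) ->
  (forall w, cabs (f w) <= M) -> cintegrable f.
Proof.
move=> mr mi fM; split; apply: prob_bounded_integrable (M) _ _ => // w.
  by apply: le_trans (Re_le_cabs _) _.
by apply: le_trans (Im_le_cabs _) _.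
Qed.

Lemma cintegrableD f g : cintegrable f -> cintegrable g ->
  cintegrable (fun w => f w + g w).
Proof.
move=> [fr fi] [gr gi]; split.
- rewrite (_ : _ \o _ = fun w => ((Re (f w))%:E + (Re (g w))%:E)%E).
    exact: (integrableD measurableT fr gr).
  by apply/funext => w /=; rewrite ReD.
- rewrite (_ : _ \o _ = fun w => ((Im (f w))%:E + (Im (g w))%:E)%E).
    exact: (integrableD measurableT fi gi).
  by apply/funext => w /=; rewrite ImD.
Qed.

Lemma cintegrableZ c f : cintegrable f -> cintegrable (fun w => c * f w).
Proof.
move=> [fr fi]; split.
- rewrite (_ : _ \o _ = fun w => ((Re c)%:E * (Re (f w))%:E - (Im c)%:E * (Im (f w))%:E)%E).
    exact: (integrableB measurableT (integrableZl measurableT _ fr)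
      (integrableZl measurableT _ fi)).
  by apply/funext => w /=; rewrite ReM.
- rewrite (_ : _ \o _ = fun w => ((Re c)%:E * (Im (f w))%:E + (Im c)%:E * (Re (f w))%:E)%E).
    exact: (integrableD measurableT (integrableZl measurableT _ fi)
      (integrableZl measurableT _ fr)).
  by apply/funext => w /=; rewrite ImM.
Qed.

Lemma CintegralD f g : cintegrable f -> cintegrable g ->
  Cintegral nu (fun w => f w + g w) = Cintegral nu f + Cintegral nu g.
Proof.
move=> [fr fi] [gr gi]; rewrite /Cintegral; apply: complex_ext => /=.
  by rewrite -RintegralD//; apply: eq_Rintegral => w _; rewrite ReD.
by rewrite -RintegralD//; apply: eq_Rintegral => w _; rewrite ImD.
Qed.

Lemma CintegralZ c f : cintegrable f ->
  Cintegral nu (fun w => c * f w) = c * Cintegral nu f.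
Proof.
move=> [fr fi]; have Zr x := integrableZl measurableT x fr.
have Zi x := integrableZl measurableT x fi.
rewrite /Cintegral; apply: complex_ext; rewrite ?ReM ?ImM/=.
  rewrite -!RintegralZl// -(RintegralB measurableT (Zr _) (Zi _)).
  by apply: eq_Rintegral => w _; rewrite ReM.
rewrite -!RintegralZl// -(RintegralD measurableT (Zi _) (Zr _)).
by apply: eq_Rintegral => w _; rewrite ImM.
Qed.

(** The factor [2] is the price of bounding the real and imaginary parts separately. *)
Lemma cabs_Cintegral_le f (M : R) : cintegrable f ->
  (forall w, cabs (f w) <= M) -> cabs (Cintegral nu f) <= 2 * M.
Proof.
move=> [fr fi] fM; apply: le_trans (cabs_le_ReIm _) _; rewrite /Cintegral/=.
have bnd (h : measurableTypeR R -> R) : nu.-integrable setT (EFin \o h) ->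
    (forall w, `|h w| <= M) -> `|\int[nu]_w h w| <= M.
  move=> hi hM; apply: le_trans (le_normr_Rintegral measurableT hi) _.
  apply: (@le_trans _ _ (\int[nu]_w M)).
    apply: le_Rintegral => //.
      exact: (integrable_abse hi).
    exact: finite_measure_integrable_cst.
  rewrite Rintegral_cst// (_ : fine _ = 1) ?mulr1//.
  exact: (congr1 fine (probability_setT nu)).
rewrite mulr_natl mulr2n; apply: lerD; apply: bnd => // w.
  by apply: le_trans (Re_le_cabs _) _.
by apply: le_trans (Im_le_cabs _) _.
Qed.

Lemma measurable_Re_kernel z : 0 < Im z ->
  measurable_fun setT (fun w : measurableTypeR R => Re (w%:C - z)^-1).
Proof.
move=> z0; apply: (@continuous_measurable_fun R (fun w => Re (w%:C - z)^-1)).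
by apply: lipschitz_continuous => x y; exact: Re_kernel_lipschitz.
Qed.

Lemma measurable_Im_kernel z : 0 < Im z ->
  measurable_fun setT (fun w : measurableTypeR R => Im (w%:C - z)^-1).
Proof.
move=> z0; apply: (@continuous_measurable_fun R (fun w => Im (w%:C - z)^-1)).
by apply: lipschitz_continuous => x y; exact: Im_kernel_lipschitz.
Qed.

Lemma cintegrable_kernel z : 0 < Im z ->
  cintegrable (fun w => (w%:C - z)^-1).
Proof.
move=> z0; apply: (@cintegrable_bounded _ (Im z)^-1).
- exact: measurable_Re_kernel.
- exact: measurable_Im_kernel.
- by move=> w; exact: cabs_kernel_le.
Qed.

Lemma cintegrable_kernel2 z : 0 < Im z ->
  cintegrable (fun w => (w%:C - z)^-1 * (w%:C - z)^-1).
Proof.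
move=> z0; have mr := measurable_Re_kernel z0; have mi := measurable_Im_kernel z0.
apply: (@cintegrable_bounded _ ((Im z)^-1 * (Im z)^-1)).
- under eq_fun do rewrite ReM.
  by apply: measurable_funB; exact: measurable_funM.
- under eq_fun do rewrite ImM.
  by apply: measurable_funD; exact: measurable_funM.
- by move=> w; rewrite cabsM ler_pM ?cabs_ge0// cabs_kernel_le.
Qed.

Definition stieltjes z : R[i] := Cintegral nu (fun w => (w%:C - z)^-1).

(** Differentiation under the integral: the difference quotient minus the integral of [(w - z)^-2]
    is the integral of [h (w - h - z)^-1 (w - z)^-2], which is of order [h]. *)
Lemma stieltjes_holomorphic : holomorphic_on (@upper_half_plane R) stieltjes.
Proof.
move=> z z0; rewrite /upper_half_plane/= in z0.
apply/cvg_ex; exists (Cintegral nu (fun w => (w%:C - z)^-1 * (w%:C - z)^-1)).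
apply/ccvgP; apply/cvgrPdist_le => e e0.
(* One factor [2] is lost in [cabs_Cintegral_le], the other in [Im (h + z) >= Im z / 2]. *)
pose C := 2 * (2 * (Im z)^-1 ^+ 3).
have i0 : 0 < (Im z)^-1 by rewrite invr_gt0.
have C0 : 0 < C.
  by apply: mulr_gt0 => //; apply: mulr_gt0 => //; exact: exprn_gt0.
pose d := Num.min (Im z / 2) (e / C).
have d0 : 0 < d by rewrite lt_min; apply/andP; split; exact: divr_gt0.
have := @dnbhs0_lt R[i] R[i]^o d%:C; rewrite ltcR => /(_ d0) nd.
have nn := @nbhs_dnbhs_neq R[i]^o 0.
near=> h.
have hd : cabs h < d by rewrite -ltcR -norm_cabs; near: h; exact: nd.
have h0 : h != 0 by near: h; exact: nn.
rewrite sub0r normrN ger0_norm ?cabs_ge0//= /shift/=.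
have -> : (h *: (1 : R[i]^o) : R[i]) = h by exact: mulr1.
have hz : 0 < Im (h + z).
  rewrite ImD -ltrBlDl sub0r.
  have : `|Im h| < Im z / 2.
    by apply: le_lt_trans (Im_le_cabs _) (lt_le_trans hd _); rewrite ge_min lexx.
  by rewrite ltr_norml => /andP[h1 _]; lra.
have -> : (h^-1 *: ((stieltjes (h + z) - stieltjes z) : R[i]^o) : R[i]) -
   Cintegral nu (fun w => (w%:C - z)^-1 * (w%:C - z)^-1) =
   Cintegral nu (fun w => h^-1 * ((w%:C - (h + z))^-1 + (-1) * (w%:C - z)^-1) +
       (-1) * ((w%:C - z)^-1 * (w%:C - z)^-1)).
  have k1 := cintegrable_kernel hz; have k2 := cintegrable_kernel z0.
  have k3 := cintegrable_kernel2 z0.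
  have k4 := cintegrableZ (-1) k2; have k5 := cintegrableD k1 k4.
  have k6 := cintegrableZ h^-1 k5; have k7 := cintegrableZ (-1) k3.
  rewrite (CintegralD k6 k7) (CintegralZ _ k3) (CintegralZ _ k5) (CintegralD k1 k4).
  by rewrite (CintegralZ _ k2) !mulN1r.
have hC : 2 * (2 * (Im z)^-1 ^+ 3 * cabs h) <= e.
  rewrite mulrA -/C mulrC -ler_pdivlMr//; apply: le_trans (ltW hd) _.
  by rewrite /d ge_min lexx orbT.
apply: le_trans hC; apply: cabs_Cintegral_le.
  apply: cintegrableD; apply: cintegrableZ; last exact: cintegrable_kernel2.
  apply: cintegrableD; last apply: cintegrableZ; exact: cintegrable_kernel.
move=> w.
have az := realc_subz_neq0 w hz; have bz := realc_subz_neq0 w z0.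
have -> : h^-1 * ((w%:C - (h + z))^-1 + (-1) * (w%:C - z)^-1) +
       (-1) * ((w%:C - z)^-1 * (w%:C - z)^-1) =
   (w%:C - (h + z))^-1 * ((w%:C - z)^-1 * (w%:C - z)^-1) * h.
  by field; rewrite h0 az bz.
rewrite !cabsM ler_wpM2r ?cabs_ge0//.
have kb := cabs_kernel_le w z0; have kc := cabs_ge0 (w%:C - z)^-1.
have ka : cabs (w%:C - (h + z))^-1 <= 2 * (Im z)^-1.
  apply: le_trans (cabs_kernel_le w hz) _.
  rewrite -[2]invrK -invfM lef_pV2 ?posrE//; last by rewrite mulr_gt0// invr_gt0.
  rewrite ImD -lerBlDr.
  have : `|Im h| < Im z / 2.
    by apply: le_lt_trans (Im_le_cabs _) (lt_le_trans hd _); rewrite ge_min lexx.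
  by rewrite ltr_norml => /andP[h1 _]; lra.
have -> : 2 * (Im z)^-1 ^+ 3 = 2 * (Im z)^-1 * ((Im z)^-1 * (Im z)^-1) by ring.
by apply: ler_pM => //; rewrite ?cabs_ge0 ?mulr_ge0//; apply: ler_pM.
Unshelve. all: by end_near. Qed.

End ComplexIntegral.

Section StieltjesLimit.
Context {R : realType}.

Lemma stieltjes_of_ultra_limit (U : set_system nat) (UU : UltraFilter U)
    (L : nat -> seq (R * R)) (b : R) (u : R[i] -> R[i]) : 0 < b ->
  (forall k, [/\ nonneg_weights (L k), \sum_(a <- L k) a.1 = 1 &
                 forall a, a \in L k -> 0 <= a.2 <= b]) ->
  (forall z, 0 < Im z -> ccvg U (fun k => discrete_stieltjes (L k) z) (u z)) ->
  exists nu : probability (measurableTypeR R) R,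
    nu (~` `[0, b]%classic) = 0%E /\
    forall z, 0 < Im z -> u z = stieltjes nu z.
Proof.
move=> b0 LP Lu; have [nu [nu0 nuE]] := helly UU b0 LP.
have PU : ProperFilter U := @ultra_proper _ _ UU.
exists nu; split=> // z z0; rewrite /stieltjes /Cintegral; apply: complex_ext => /=.
  apply/esym; apply: (nuE (fun w => Re (w%:C - z)^-1) ((Im z)^-1 ^+ 2) (Im z)^-1).
  - by move=> x y; exact: Re_kernel_lipschitz.
  - by move=> x; apply: le_trans (Re_le_cabs _) (cabs_kernel_le _ z0).
  - have := ccvg_Re (Lu z z0); rewrite /discrete_stieltjes.
    under eq_fun do rewrite Re_sum; under eq_fun do under eq_bigr do rewrite ReZ.
    exact.
apply/esym; apply: (nuE (fun w => Im (w%:C - z)^-1) ((Im z)^-1 ^+ 2) (Im z)^-1).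
- by move=> x y; exact: Im_kernel_lipschitz.
- by move=> x; apply: le_trans (Im_le_cabs _) (cabs_kernel_le _ z0).
- have := ccvg_Im (Lu z z0); rewrite /discrete_stieltjes.
  under eq_fun do rewrite Im_sum; under eq_fun do under eq_bigr do rewrite ImZ.
  exact.
Qed.

Lemma measure_support_itv (nu : probability (measurableTypeR R) R) (b : R) :
  nu (~` `[0, b]%classic) = 0%E -> measure_support nu `<=` `[0, b].
Proof.
move=> nu0 x xs; apply: contrapT => xb.
have : open_nbhs x (~` `[0, b]%classic).
  by split => //; apply: closed_openC; exact: interval_closed.
by move=> /xs/lt_eqF; rewrite eq_sym => /eqP; apply; exact: nu0.
Qed.

End StieltjesLimit.

Section Existence.
Context {R : realType} (p n : nat) (S : 'M[R]_(p, n)).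

(** Pure algebra: inversion is an involution commuting with the sign, also at [0] by the convention
    [0^-1 = 0]. *)
Lemma solution_fixedP (z : R[i]) (x : 'cV[R[i]]_p) :
  - vinv x = const_mx z - cmx S *m vinv (const_mx 1 + (cmx S)^T *m x) <->
  forall i, x i ord0 = gmap S z (fun j => x j ord0) i.
Proof.
have E i : (const_mx z - cmx S *m vinv (const_mx 1 + (cmx S)^T *m x)) i ord0 =
    z - \sum_(k < n) (S i k)%:C / gden S (fun j => x j ord0) k.
  rewrite !mxE; congr (_ - _); apply: eq_bigr => k _; rewrite !mxE.
  congr (_ / (_ + _)); apply: eq_bigr => j _; by rewrite !mxE.
split=> [h i|h].
  have := congr1 (fun M : 'cV[R[i]]_p => M i ord0) h; rewrite /= E /gmap => <-.
  by rewrite !mxE invrN invrK opprK.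
apply/matrixP => i j; rewrite ord1 E !mxE [x i ord0]h /gmap invrN invrK opprK.
by [].
Qed.

Hypothesis S_ge0 : forall i k, 0 <= S i k.

Lemma is_solution_unique (m m' : R[i] -> 'cV[R[i]]_p) :
  is_solution S m -> is_solution S m' ->
  forall z, upper_half_plane z -> m' z = m z.
Proof.
move=> [_ mE m0] [_ m'E m'0] z z0; apply/matrixP => i j; rewrite ord1.
apply: (gmap_fixed_unique S_ge0 z0 (m'0 z z0) (m0 z z0)).
  exact: (solution_fixedP _ _).1 (m'E z z0).
exact: (solution_fixedP _ _).1 (mE z z0).
Qed.

(** The solution is defined by the transforms [stieltjes (nu i)], which settles holomorphy, and it
    inherits the equation from the pointwise limits [u]. The measure of the mean comes from a second
    application of the limit theorem, to the pooled lists [Lm] whose weights are divided by [p]. *)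
Lemma solution_exists (s : R) : (0 < p)%N -> assumptionA S s ->
  exists m : R[i] -> 'cV[R[i]]_p, is_solution S m /\
    exists nu : probability (measurableTypeR R) R, represents s m nu.
Proof.
move=> p0 SA; have [s0 _] := SA.
have b0 : 0 < 4 * s by rewrite mulr_gt0.
have [U [UU Uoo]] := ultraFilterLemma (@eventually_filter).
have PU : ProperFilter U := @ultra_proper _ _ UU.
have /choice[L hL] : forall ik : 'I_p * nat, exists l : seq (R * R),
  [/\ nonneg_weights l, \sum_(a <- l) a.1 = 1,
      forall a, a \in l -> 0 <= a.2 <= 4 * s &
  forall z : R[i], 0 < Im z -> giter S z ik.2 ik.1 = discrete_stieltjes l z].
  by move=> [i k]; exact: giter_measure.
have /choice[u hu] : forall z : R[i], exists u : 'I_p -> R[i], 0 < Im z ->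
  [/\ forall i, ccvg U (fun k => giter S z k i) (u i),
      forall i, 0 < Im (u i) & forall i, u i = gmap S z u i].
  move=> z; have [z0|z0] := ltP 0 (Im z); last by exists (fun=> 0).
  by have [u hu] := giter_limit S_ge0 Uoo z0; exists u.
have Lcvg i z : 0 < Im z -> ccvg U (fun k => discrete_stieltjes (L (i, k)) z) (u z i).
  move=> z0; have [h _ _] := hu z z0.
  rewrite (_ : (fun k => _) = fun k => giter S z k i) //.
  by apply/funext => k; have [_ _ _ ->] := hL (i, k).
have /choice[nu hnu] : forall i : 'I_p, exists nu : probability (measurableTypeR R) R,
    forall z, 0 < Im z -> u z i = stieltjes nu z.
  move=> i; have [|nu [_ hnu]] := stieltjes_of_ultra_limit UU b0 _ (Lcvg i).
    by move=> k; have [? ? ? _] := hL (i, k).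
  by exists nu.
pose m z : 'cV[R[i]]_p := \col_i stieltjes (nu i) z.
have mE z i : 0 < Im z -> m z i ord0 = u z i by move=> z0; rewrite mxE hnu.
exists m; split.
  split.
  - move=> i; rewrite (_ : (fun z => m z i ord0) = stieltjes (nu i)).
      exact: stieltjes_holomorphic.
    by apply/funext => z; rewrite mxE.
  - move=> z z0; apply/solution_fixedP => i.
    have -> : (fun j => m z j ord0) = u z by apply/funext => j; rewrite mE.
    by rewrite mE//; have [_ _ ->] := hu z z0.
  - by move=> z z0 i; rewrite mE//; have [_ h _] := hu z z0.
pose Lm k : seq (R * R) := [seq (p%:R^-1 * a.1, a.2) |
  a <- flatten [seq L (i, k) | i <- enum 'I_p]].
have mem k a : a \in Lm k -> exists i a', [/\ a' \in L (i, k), a.1 = p%:R^-1 * a'.1 & a.2 = a'.2].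
  by move=> /mapP[a' /flatten_mapP[i _ ai] ->]; exists i, a'.
have pR : (p%:R : R) != 0 by rewrite pnatr_eq0 -lt0n.
have LmP k : [/\ nonneg_weights (Lm k), \sum_(a <- Lm k) a.1 = 1 &
                 forall a, a \in Lm k -> 0 <= a.2 <= 4 * s].
  split.
  - apply/allP => a /mem[i [a' [ai -> _]]]; have [/allP/(_ _ ai)/= a0 _ _ _] := hL (i, k).
    by rewrite mulr_ge0// invr_ge0.
  - rewrite big_map big_flatten big_map big_enum/=.
    transitivity (\sum_(i < p) (p%:R^-1 : R)).
      apply: eq_bigr => i _; rewrite -mulr_sumr.
      by have [_ -> _ _] := hL (i, k); rewrite mulr1.
    by rewrite sumr_const card_ord -[_ *+ p]mulr_natr mulVf.
  - by move=> a /mem[i [a' [ai _ ->]]]; have [_ _ h _] := hL (i, k); exact: h.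
have [|num [num0 hnum]] := @stieltjes_of_ultra_limit _ U UU Lm _ (fun z => vmean (m z)) b0 LmP.
  move=> z z0.
  have -> : (fun k => discrete_stieltjes (Lm k) z) =
      fun k => p%:R^-1 * \sum_(i < p) discrete_stieltjes (L (i, k)) z.
    apply/funext => k; rewrite /discrete_stieltjes big_map big_flatten big_map big_enum/=.
    rewrite mulr_sumr; apply: eq_bigr => i _; rewrite mulr_sumr; apply: eq_bigr => a _.
    by rewrite rmorphM/= fmorphV rmorph_nat mulrA.
  rewrite /vmean; apply: ccvgM; first exact: ccvg_cst.
  under eq_bigr do rewrite mE//.
  by apply: ccvg_sum => i; exact: Lcvg.
exists num; split; first exact: measure_support_itv.
by move=> z z0; rewrite hnum.
Qed.

End Existence.

(** * Bounds on the solution and its derivative *)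

Section SchurTest.
Context {R : realType} (p n : nat).
Variables (T : 'I_p -> 'I_n -> R) (v : 'I_p -> R).
Hypothesis T0 : forall i k, 0 <= T i k.
Hypothesis v0 : forall i, 0 < v i.
Hypothesis Tv : forall i, \sum_k T i k * (\sum_j T j k * v j) <= v i.

(** With [V = T^t v], Cauchy-Schwarz gives [(sum_k T_ik)^2 <= v_i sum_k T_ik / V_k]. Enlarging the
    right side to its sum over all rows leaves [sum_k V_k / V_k <= n]. Columns are treated in the
    same way, with [V_k] and [1 / v_i] as weights. *)
Lemma schur_test : (forall i, (\sum_k T i k) ^+ 2 <= n%:R) /\
  (forall k, (\sum_i T i k) ^+ 2 <= p%:R).
Proof.
have [V VE] : exists V : 'I_n -> R, forall k, V k = \sum_j T j k * v j.
  by exists (fun k => \sum_j T j k * v j).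
have V0 k : 0 <= V k.
  by rewrite VE; apply: sumr_ge0 => j _; rewrite mulr_ge0// ltW.
have TV i : \sum_k T i k * V k <= v i.
  by under eq_bigr do rewrite VE.
split=> [i|k].
- apply: (@le_trans _ _ (v i * \sum_k T i k / V k)).
    apply: le_trans (@sum_sqr_le _ _ (index_enum 'I_n) (T i)
        (fun k => T i k * V k) (fun k => T i k / V k) _) _.
      move=> k; split; rewrite ?mulr_ge0 ?invr_ge0//.
      (* If [V k = 0], then column [k] of [T] vanishes because [v] is positive, and the quotient by
         [0] does no harm. *)
      have [Vk|Vk] := eqVneq (V k) 0; last by rewrite mulrACA mulfV// mulr1.
      suff -> : T i k = 0 by rewrite expr0n !mul0r.
      have /eqP := VE k; rewrite Vk eq_sym psumr_eq0; last first.
        by move=> j _; rewrite mulr_ge0// ltW.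
      move=> /allP/(_ i (mem_index_enum _))/=; rewrite mulf_eq0 (gt_eqF (v0 i)) orbF.
      by move/eqP.
    by apply: ler_wpM2r => //; apply: sumr_ge0 => k _; rewrite mulr_ge0 ?invr_ge0.
  apply: (@le_trans _ _ (\sum_j v j * \sum_k T j k / V k)).
    rewrite (bigD1 i)//= lerDl; apply: sumr_ge0 => j _; rewrite mulr_ge0 ?(ltW (v0 j))//.
    by apply: sumr_ge0 => k _; rewrite mulr_ge0 ?invr_ge0.
  under eq_bigr do rewrite mulr_sumr.
  rewrite exchange_big/= -[n in leRHS]card_ord -sumr_const; apply: ler_sum => k _.
  have -> : \sum_j v j * (T j k / V k) = V k / V k.
    by rewrite {2}VE mulr_suml; apply: eq_bigr => j _; rewrite mulrCA mulrA.
  by have [->|/mulfV->//] := eqVneq (V k) 0; rewrite mul0r ler01.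
- apply: (@le_trans _ _ (V k * \sum_i T i k / v i)).
    apply: le_trans (@sum_sqr_le _ _ (index_enum 'I_p) (fun i => T i k)
        (fun i => T i k * v i) (fun i => T i k / v i) _) _.
      move=> i; split; rewrite ?mulr_ge0 ?invr_ge0 ?(ltW (v0 i))//.
      by rewrite mulrACA mulfV ?mulr1// gt_eqF.
    by rewrite -VE.
  apply: (@le_trans _ _ (\sum_l V l * \sum_i T i l / v i)).
    have h l : 0 <= V l * \sum_i T i l / v i.
      rewrite mulr_ge0//; apply: sumr_ge0 => i _.
      by rewrite mulr_ge0 ?invr_ge0 ?(ltW (v0 i)).
    by rewrite (bigD1 k)//= lerDl; apply: sumr_ge0.
  under eq_bigr do rewrite mulr_sumr.
  rewrite exchange_big/= -[p in leRHS]card_ord -sumr_const; apply: ler_sum => i _.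
  have -> : \sum_l V l * (T i l / v i) = (\sum_l T i l * V l) / v i.
    by rewrite mulr_suml; apply: eq_bigr => l _; rewrite mulrCA mulrA.
  by rewrite ler_pdivrMr// mul1r.
Qed.

End SchurTest.

Section SolutionBounds.
Context {R : realType} (p n : nat) (S : 'M[R]_(p, n)).
Hypothesis S_ge0 : forall i k, 0 <= S i k.
Variables (z : R[i]) (u : 'I_p -> R[i]).
Hypothesis z_gt0 : 0 < Im z.
Hypothesis u_gt0 : forall i, 0 < Im (u i).
Hypothesis uE : forall i, u i = gmap S z u i.

Let q k := gden S u k.
(** In terms of [T] and [v] the imaginary part of the equation reads
    [v_i = |u_i| Im z + (T T^t v)_i], so [v] is the vector required by the Schur test. *)
Let T i k : R := cabs (u i) * S i k / cabs (q k).
Let v i : R := Im (u i) / cabs (u i).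
Let au i : 0 < cabs (u i). Proof. by rewrite cabs_gt0 Im_gt0_neq0. Qed.
Let aq k : 0 < cabs (q k). Proof. by rewrite cabs_gt0 gden_neq0. Qed.
Let v0 i : 0 < v i. Proof. by rewrite divr_gt0. Qed.
Lemma sol_ImE i : Im (u i) = cabs (u i) ^+ 2 * (Im z + gweight S u i).
Proof. by rewrite {1}uE Im_gmap -uE. Qed.

Let TV : (forall i, (\sum_k T i k) ^+ 2 <= n%:R) /\
  (forall k, (\sum_i T i k) ^+ 2 <= p%:R).
Proof.
apply: (@schur_test _ _ _ _ v) => [i k|i|i].
- by rewrite divr_ge0 ?mulr_ge0 ?cabs_ge0.
- by rewrite divr_gt0.
have -> : \sum_k T i k * (\sum_j T j k * v j) = cabs (u i) * gweight S u i.
  rewrite /gweight mulr_sumr; apply: eq_bigr => k _.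
  have -> : \sum_j T j k * v j = (\sum_j S j k * Im (u j)) / cabs (q k).
    rewrite mulr_suml; apply: eq_bigr => j _; rewrite /T /v.
    by have := au j; have := aq k => a b; field; rewrite !gt_eqF.
  rewrite /T -/(q k).
  by have := aq k => a; field; rewrite gt_eqF.
rewrite /v ler_pdivlMr// mulrAC -expr2 [leRHS]sol_ImE.
by rewrite ler_wpM2l ?sqr_ge0// lerDr ltW.
Qed.

Let sqr_le_nat (t : R) (m : nat) : t ^+ 2 <= m%:R -> t <= m%:R.
Proof.
move=> tm; case: m tm => [|m] tm.
  have /eqP : t ^+ 2 = 0 by apply/eqP; rewrite eq_le tm sqr_ge0.
  by rewrite sqrf_eq0 => /eqP ->.
rewrite leNgt; apply/negP => mt.
have : (m.+1%:R : R) < t ^+ 2.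
  apply: (lt_le_trans mt); rewrite expr2 ler_peMl//.
    exact: le_trans (ler0n _ _) (ltW mt).
  by apply: le_trans (ltW mt); rewrite ler1n.
by rewrite ltNge tm.
Qed.

(** The equation reads [z u_i = - 1 + sum_k u_i s_ik / q_k], and the moduli of the last terms form a
    row sum of [T]. The factor [cabs z] is the reason for staying away from [0]. *)
Lemma sol_upper i : cabs z * cabs (u i) <= 1 + n%:R.
Proof.
have d0 : z - \sum_(k < n) (S i k)%:C / q k != 0.
  by have := gmap_neq0 S_ge0 i z_gt0 u_gt0; rewrite /gmap oppr_eq0 invr_eq0.
have e : z * u i = -1 + u i * \sum_(k < n) (S i k)%:C / q k.
  have : u i * (z - \sum_(k < n) (S i k)%:C / q k) = -1.
    by rewrite {1}uE /gmap mulNr mulVf.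
  by rewrite mulrBr => <-; rewrite subrK mulrC.
rewrite -cabsM e; apply: le_trans (cabsD _ _) _.
rewrite cabsN cabs1 lerD2l; apply: le_trans (sqr_le_nat (TV.1 i)).
rewrite cabsM; apply: le_trans (ler_wpM2l (cabs_ge0 _) (cabs_sum _ _ _)) _.
rewrite mulr_sumr; apply: ler_sum => k _.
by rewrite cabsM cabsV cabs_real ger0_norm// mulrA.
Qed.

(** Here [1 / q_k = 1 - sum_j s_jk u_j / q_k], and the moduli of the last terms form a column sum of
    [T]. *)
Lemma sol_den_lower k : cabs (q k)^-1 <= 1 + p%:R.
Proof.
have q0 : q k != 0 by exact: gden_neq0.
have e : (q k)^-1 = 1 - (\sum_(j < p) (S j k)%:C * u j) / q k.
  by apply: (mulIf q0); rewrite mulrBl mulVf// mul1r mulfVK// /q /gden addrK.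
rewrite e; apply: le_trans (cabsB _ _) _.
rewrite cabs1 lerD2l; apply: le_trans (sqr_le_nat (TV.2 k)).
rewrite cabsM cabsV; apply: le_trans (ler_wpM2r _ (cabs_sum _ _ _)) _.
  by rewrite invr_ge0 cabs_ge0.
rewrite mulr_suml; apply: ler_sum => i _.
by rewrite cabsM cabs_real ger0_norm// /T [cabs _ * _]mulrC.
Qed.

Lemma sol_lower i : (cabs (u i))^-1 <= cabs z + (\sum_k S i k) * (1 + p%:R).
Proof.
rewrite {1}uE /gmap cabsN cabsV invrK; apply: le_trans (cabsB _ _) _.
rewrite lerD2l; apply: le_trans (cabs_sum _ _ _) _; rewrite mulr_suml.
apply: ler_sum => k _; rewrite cabsM cabs_real ger0_norm// ler_wpM2l//.
exact: sol_den_lower.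
Qed.

Lemma sol_den_upper k : cabs z * cabs (q k) <= cabs z + (\sum_j S j k) * (1 + n%:R).
Proof.
apply: le_trans (ler_wpM2l (cabs_ge0 z) (cabsD _ _)) _.
rewrite cabs1 mulrDr mulr1 lerD2l.
apply: le_trans (ler_wpM2l (cabs_ge0 z) (cabs_sum _ _ _)) _.
rewrite mulr_sumr mulr_suml; apply: ler_sum => j _.
rewrite cabsM cabs_real ger0_norm// mulrCA ler_wpM2l//.
exact: sol_upper.
Qed.

End SolutionBounds.

Section UniformBounds.
Context {R : realType} (p n : nat) (S : 'M[R]_(p, n)).
Hypothesis S_ge0 : forall i k, 0 <= S i k.

Definition is_fixed (z : R[i]) (u : 'I_p -> R[i]) :=
  [/\ 0 < Im z, forall i, 0 < Im (u i) & forall i, u i = gmap S z u i].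

Lemma sol_uniform_bounds (a A : R) : 0 < a -> exists2 c : R, 0 < c &
  forall z u, is_fixed z u -> a <= cabs z <= A ->
    (forall i, c <= cabs (u i) <= c^-1) /\
    (forall k, c <= cabs (gden S u k) <= c^-1).
Proof.
move=> a0.
pose s := \sum_i \sum_k S i k.
have s0 : 0 <= s by apply: sumr_ge0 => i _; apply: sumr_ge0.
have rs i : \sum_k S i k <= s.
  by rewrite /s (bigD1 i)//= lerDl; apply: sumr_ge0 => j _; apply: sumr_ge0.
have cs k : \sum_i S i k <= s.
  rewrite /s exchange_big (bigD1 k)//= lerDl.
  by apply: sumr_ge0 => j _; apply: sumr_ge0.
pose N : R := (p + n)%:R + 1.
have N1 : 1 <= N by rewrite lerDr ler0n.
(* The sum of every bound that occurs below, so that one constant serves all four estimates. *)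
pose B := 1 + `|A| + N / a + s * N + s * N / a + N.
have N0 : 0 <= N by rewrite (le_trans ler01).
have sN : 0 <= s * N by rewrite mulr_ge0.
have Na : 0 <= N / a by rewrite divr_ge0// ltW.
have sNa : 0 <= s * N / a by rewrite divr_ge0// ltW.
have A0 := normr_ge0 A.
have B0 : 0 < B by rewrite /B; lra.
have pN : 1 + p%:R <= N by rewrite /N natrD addrC lerD2r lerDl ler0n.
have nN : 1 + n%:R <= N by rewrite /N natrD addrC lerD2r lerDr ler0n.
exists B^-1; first by rewrite invr_gt0.
move=> z u [z0 u0 uE] /andP[az zA]; rewrite invrK.
have zz : 0 < cabs z by apply: lt_le_trans az.
have zA' : cabs z <= `|A| by apply: le_trans zA (ler_norm _).
split=> [i|k].
  have ui : 0 < cabs (u i) by rewrite cabs_gt0 Im_gt0_neq0.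
  apply/andP; split.
    rewrite -[leRHS]invrK lef_pV2 ?posrE ?invr_gt0//.
    apply: le_trans (sol_lower S_ge0 z0 u0 uE i) _.
    have : (\sum_k S i k) * (1 + p%:R) <= s * N.
      by rewrite ler_pM// ?addr_ge0//; apply: sumr_ge0.
    by rewrite /B; lra.
  apply: (@le_trans _ _ (N / a)); last by rewrite /B; lra.
  rewrite ler_pdivlMr//; apply: le_trans nN; rewrite mulrC.
  apply: le_trans (sol_upper S_ge0 z0 u0 uE i).
  by rewrite ler_wpM2r// ltW.
have qk : 0 < cabs (gden S u k) by rewrite cabs_gt0 gden_neq0.
apply/andP; split.
  rewrite -[leRHS]invrK lef_pV2 ?posrE ?invr_gt0// -cabsV.
  apply: le_trans (sol_den_lower S_ge0 z0 u0 uE k) _.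
  by apply: le_trans pN _; rewrite /B; lra.
have h := sol_den_upper S_ge0 z0 u0 uE k.
apply: (@le_trans _ _ (1 + s * N / a)); last by rewrite /B; lra.
apply: (@le_trans _ _ (1 + (\sum_j S j k) * (1 + n%:R) / cabs z)).
  rewrite -(ler_pM2l zz); apply: le_trans h _.
  by rewrite le_eqVlt; apply/orP; left; apply/eqP; field; rewrite gt_eqF.
rewrite lerD2l; apply: ler_pM.
- by rewrite mulr_ge0 ?addr_ge0//; apply: sumr_ge0.
- by rewrite invr_ge0 ltW.
- by apply: ler_pM => //; rewrite ?addr_ge0//; apply: sumr_ge0.
- by rewrite lef_pV2.
Qed.

End UniformBounds.

Section Harnack.
Context {R : realType} (p : nat) (Q : 'M[R]_p).
Hypothesis Q_ge0 : forall i j, 0 <= Q i j.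

(** Iteration of [c Q d <= d + C]: each step multiplies the error by at most [c] times the sum [r]
    of all entries of [Q] and adds one [C]. The constants are chosen before [d] and [C]. *)
Lemma harnack_power (c : R) (L : nat) : 0 < c -> exists c' k : R,
  [/\ 0 < c', 0 <= k & forall (C : R) (d : 'I_p -> R), 0 <= C ->
    (forall i, 0 <= d i) -> (forall i, c * \sum_j Q i j * d j <= d i + C) ->
    forall i, c' * \sum_j (Q ^+ L) i j * d j <= d i + k * C].
Proof.
move=> c0; elim: L => [|L [c' [k [c'0 k0 ih]]]].
  exists 1, 0; split => // C d C0 d0 _ i.
  rewrite mul1r mul0r addr0 (bigD1 i)//= big1 => [|j ji].
    by rewrite addr0 expr0 mxE eqxx mul1r.
  by rewrite expr0 mxE eq_sym (negbTE ji) mul0r.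
pose r := \sum_i \sum_j Q i j.
have r0 : 0 <= r by apply: sumr_ge0 => i _; apply: sumr_ge0.
exists (c * c'), (1 + c * r * k); split.
- by rewrite mulr_gt0.
- by rewrite addr_ge0// !mulr_ge0// ltW.
move=> C d C0 d0 h i; have {}ih := ih C d C0 d0 h.
have -> : c * c' * \sum_j (Q ^+ L.+1) i j * d j =
    c * \sum_l Q i l * (c' * \sum_j (Q ^+ L) l j * d j).
  rewrite -mulrA; congr (_ * _).
  under [RHS]eq_bigr do rewrite mulrCA; rewrite -mulr_sumr; congr (_ * _).
  under [RHS]eq_bigr do rewrite mulr_sumr; rewrite exchange_big/=.
  apply: eq_bigr => j _; rewrite exprS -mulmxE mxE mulr_suml.
  by apply: eq_bigr => l _; rewrite mulrA.
apply: (@le_trans _ _ (c * \sum_l Q i l * (d l + k * C))).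
  by apply: ler_wpM2l; [exact: ltW|]; apply: ler_sum => l _; apply: ler_wpM2l.
under eq_bigr do rewrite mulrDr.
rewrite big_split/= mulrDr -mulr_suml.
apply: (@le_trans _ _ (d i + C + c * (r * (k * C)))).
  apply: lerD => //; apply: ler_wpM2l; first exact: ltW.
  apply: ler_wpM2r; first by rewrite mulr_ge0.
  by rewrite /r [leRHS](bigD1 i)//= lerDl; apply: sumr_ge0 => j _; apply: sumr_ge0.
by rewrite mulrDl mul1r addrA lerD2l !mulrA.
Qed.

(** Once [Q ^+ L] has all entries at least [psi], every value of [d] is seen from every index. The
    case [C = 0] compares the entries of [h = Im u]; a positive [C] is needed for the inhomogeneous
    equation of the derivative. *)
Lemma harnack (c psi : R) (L : nat) : 0 < c -> 0 < psi ->
  (forall i j, psi <= (Q ^+ L) i j) -> exists c1 k : R,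
  [/\ 0 < c1, 0 <= k & forall (C : R) (d : 'I_p -> R), 0 <= C ->
    (forall i, 0 <= d i) -> (forall i, c * \sum_j Q i j * d j <= d i + C) ->
    forall i j, c1 * d j <= d i + k * C].
Proof.
move=> c0 psi0 Qpsi; have [c' [k [c'0 k0 h]]] := harnack_power L c0.
exists (c' * psi), k; split => //; first by rewrite mulr_gt0.
move=> C d C0 d0 hd i j; apply: le_trans (h C d C0 d0 hd i).
rewrite -mulrA; apply: ler_wpM2l; first exact: ltW.
apply: (@le_trans _ _ ((Q ^+ L) i j * d j)); first exact: ler_wpM2r.
rewrite (bigD1 j)//= lerDl; apply: sumr_ge0 => l _; rewrite mulr_ge0//.
exact: le_trans (ltW psi0) (Qpsi _ _).
Qed.

End Harnack.

Section DerivativeBound.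
Context {R : realType} (p n : nat) (S : 'M[R]_(p, n)).
Hypothesis S_ge0 : forall i k, 0 <= S i k.

Let Q := S *m S^T.

Let QE i j : Q i j = \sum_k S i k * S j k.
Proof. by rewrite mxE; apply: eq_bigr => k _; rewrite mxE. Qed.

Let Q_ge0 i j : 0 <= Q i j.
Proof. by rewrite QE; apply: sumr_ge0 => k _; rewrite mulr_ge0. Qed.

(** A zero diagonal entry of [S S^t] means a zero row of [S], hence a zero row in every positive
    power of [S S^t], against the lower bound. *)
Lemma gram_diag_lower (L : nat) (psi : R) : (0 < L)%N -> 0 < psi ->
  (forall i j, psi <= (Q ^+ L) i j) ->
  exists2 q0 : R, 0 < q0 & forall i, q0 <= Q i i.
Proof.
move=> L0 psi0 Qpsi.
have Qii i : 0 < Q i i.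
  rewrite lt_neqAle Q_ge0 andbT eq_sym; apply/negP; rewrite QE psumr_eq0; last first.
    by move=> k _; rewrite mulr_ge0.
  move=> /allP Si; have Sz k : S i k = 0.
    have := Si k (mem_index_enum _); rewrite /= -expr2 sqrf_eq0.
    by move/eqP.
  have := Qpsi i i; case: L L0 {Qpsi} => // L _.
  rewrite exprS -mulmxE mxE big1 ?leNgt ?psi0// => j _.
  by rewrite QE big1 ?mul0r// => k _; rewrite Sz mul0r.
have [i0|p0] := pselect (exists i : 'I_p, True); last first.
  by exists 1 => // i; exfalso; apply: p0; exists i.
have [i1 _] := i0.
have [i _ imin] := @arg_minP _ R _ i1 xpredT (fun i => Q i i) isT.
by exists (Q i i) => // j; exact: imin.
Qed.

(** With [G = |u|^2 S |q|^-2 S^t], one has [h = |u|^2 Im z + G h] and [|y| <= c^-2 + G |y|]. Let [X]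
    be the largest ratio [|y_l| / h_l]. Harnack forces [|y|] to be within a constant of [X h] at
    every index, in particular at the index where the phases cancel best. There the equation for [y]
    bounds [X h_i D], and [D] of order [h_i^2] bounds [X h_i^3]. *)
Lemma derivative_bound (c : R) : assumptionB S -> 0 < c ->
  exists C : R, forall z u (y : 'I_p -> R[i]), is_fixed S z u ->
    (forall i, c <= cabs (u i) <= c^-1) ->
    (forall k, c <= cabs (gden S u k) <= c^-1) ->
    (forall i, y i = u i ^+ 2 * (1 + \sum_k (S i k)%:C / gden S u k ^+ 2 *
                                  \sum_j (S j k)%:C * y j)) ->
    forall j, cabs (y j) * (\sum_i Im (u i)) ^+ 2 <= C.
Proof.
move=> [L [_ [psi [_ [[L0 _ psi0 _] [Qpsi _]]]]]] c0.
have [p0|pgt0] := leqP p 0.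
  by exists 0 => z u y _ _ _ _ [m mp]; exfalso; move: mp; rewrite ltnNge (leq_trans p0).
have psi'0 : 0 < psi / (p + n)%:R.
  by rewrite divr_gt0// ltr0n addn_gt0 pgt0.
have c40 : 0 < c ^+ 4 by rewrite exprn_gt0.
have [c1 [ka [c10 ka0 hk]]] := harnack Q_ge0 c40 psi'0 Qpsi.
have [q0 q00 hq0] := gram_diag_lower L0 psi'0 Qpsi.
pose Qm := \sum_i Q i i.
have Qm0 : 0 <= Qm by apply: sumr_ge0 => i _.
have ci0 : 0 < c^-1 by rewrite invr_gt0.
(* The error of the Harnack comparison caused by the inhomogeneity [c^-1 ^+ 2]. *)
pose C2 := ka * c^-1 ^+ 2 / c1.
have C20 : 0 <= C2 by rewrite divr_ge0 ?(ltW c10)// mulr_ge0// sqr_ge0.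
(* The inhomogeneity plus [C2] times an upper bound for [1 - b + 2 D]. *)
pose C3 := c^-1 ^+ 2 + C2 * (1 + 2 * c^-1 ^+ 4 * Qm).
(* [2 * c ^+ 4 * q0] bounds [2 D / h_i^2] from below. One factor [c1] transfers [|y_j|] to the index
   [i]; two more, together with [p ^+ 2], transfer the square of the sum. *)
exists (C3 * p%:R ^+ 2 / (2 * c ^+ 4 * q0 * c1 ^+ 3)).
move=> z u y [z0 u0 uE] bu bq yE j.
pose h i := Im (u i); pose Y i := cabs (y i).
pose q k := gden S u k.
pose G i j : R := cabs (u i) ^+ 2 * \sum_k S i k * S j k / cabs (q k) ^+ 2.
have au i : c <= cabs (u i) by case/andP: (bu i).
have au' i : cabs (u i) <= c^-1 by case/andP: (bu i).
have aq k : c <= cabs (q k) by case/andP: (bq k).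
have aq' k : cabs (q k) <= c^-1 by case/andP: (bq k).
have aq0 k : 0 < cabs (q k) by exact: lt_le_trans (aq k).
have qN0 k : q k != 0 by rewrite -cabs_gt0.
have G0 i l : 0 <= G i l.
  rewrite mulr_ge0 ?sqr_ge0//; apply: sumr_ge0 => k _.
  by apply: divr_ge0; rewrite ?sqr_ge0// mulr_ge0.
have sqle (a b : R) : 0 <= a -> a <= b -> a ^+ 2 <= b ^+ 2.
  by move=> a0 ab; rewrite ler_pXn2r// ?nnegrE// (le_trans a0).
have Gh (f : 'I_p -> R) i : \sum_l G i l * f l =
    cabs (u i) ^+ 2 * \sum_k S i k / cabs (q k) ^+ 2 * \sum_l S l k * f l.
  rewrite /G; under eq_bigr do rewrite -mulrA mulr_suml.
  rewrite -mulr_sumr; congr (_ * _); rewrite exchange_big/=.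
  apply: eq_bigr => k _; rewrite mulr_sumr; apply: eq_bigr => l _.
  by ring.
have hE i : h i = cabs (u i) ^+ 2 * Im z + \sum_l G i l * h l.
  rewrite /h (sol_ImE uE) mulrDr Gh; congr (_ + _ * _).
  by apply: eq_bigr => k _; rewrite mulrAC.
have GQ i l : c ^+ 4 * Q i l <= G i l.
  rewrite QE /G (_ : 4%N = (2 + 2)%N)// exprD -mulrA; apply: ler_pM.
  - exact: sqr_ge0.
  - by apply: mulr_ge0; [exact: sqr_ge0|apply: sumr_ge0 => k _; rewrite mulr_ge0].
  - by apply: (sqle _ _ _ (au i)); exact: ltW.
  rewrite mulr_sumr; apply: ler_sum => k _; rewrite mulrC ler_wpM2l ?mulr_ge0//.
  rewrite -[leLHS]invrK -exprVn lef_pV2 ?posrE ?exprn_gt0//.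
  by apply: (sqle _ _) => //; exact: ltW.
have h0 i : 0 < h i by exact: u0.
have Y0 i : 0 <= Y i by exact: cabs_ge0.
have hh i l : c1 * h l <= h i.
  have := hk 0 h (lexx 0) (fun i => ltW (h0 i)); rewrite mulr0.
  have -> : h i = h i + 0 by rewrite addr0.
  apply => m; rewrite addr0 [leRHS]hE; apply: ler_wpDl.
    by rewrite mulr_ge0 ?sqr_ge0// ltW.
  rewrite mulr_sumr; apply: ler_sum => t _; rewrite mulrA.
  by apply: ler_wpM2r (GQ _ _); exact: ltW.
have usq i : cabs (u i) ^+ 2 <= c^-1 ^+ 2 by apply: (sqle _ _); rewrite ?cabs_ge0.
have YGf (f : 'I_p -> R[i]) i : cabs (u i ^+ 2 * (1 + \sum_k (S i k)%:C / q k ^+ 2 *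
      \sum_j (S j k)%:C * f j)) <= c^-1 ^+ 2 + \sum_l G i l * cabs (f l).
  rewrite cabsM cabsX Gh; apply: le_trans (_ : cabs (u i) ^+ 2 *
    (1 + \sum_k S i k / cabs (q k) ^+ 2 * \sum_l S l k * cabs (f l)) <= _); last first.
    by rewrite mulrDr mulr1 lerD2r.
  apply: ler_wpM2l; first exact: sqr_ge0.
  apply: le_trans (cabsD _ _) _; rewrite cabs1 lerD2l.
  apply: le_trans (cabs_sum _ _ _) _; apply: ler_sum => k _.
  rewrite !cabsM cabsV cabsX cabs_real ger0_norm//; apply: ler_wpM2l.
    by apply: divr_ge0; rewrite ?sqr_ge0.
  apply: le_trans (cabs_sum _ _ _) _; apply: ler_sum => l _.
  by rewrite cabsM cabs_real ger0_norm.
have YG i : Y i <= c^-1 ^+ 2 + \sum_l G i l * Y l.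
  by rewrite /Y [in leLHS]yE; exact: YGf.
(* [X h - |y|] is a nonnegative vector vanishing at [i0]; Harnack bounds it
   everywhere by [C2]. *)
have [i0 _ i0max] := @arg_maxP _ R _ j xpredT (fun i => Y i / h i) isT.
pose X := Y i0 / h i0.
have X0 : 0 <= X by rewrite divr_ge0// ltW.
have YX i : Y i <= X * h i by rewrite -ler_pdivrMr//; exact: (i0max i isT).
have dC2 i : X * h i - Y i <= C2.
  have := hk (c^-1 ^+ 2) (fun i => X * h i - Y i) (sqr_ge0 _).
  have d0 l : 0 <= X * h l - Y l by rewrite subr_ge0.
  move=> /(_ d0) hd; have {}hd := hd _ i0 i.
  rewrite /C2 ler_pdivlMr// mulrC; apply: le_trans (hd _) _; last first.
    by rewrite {1}/X mulfVK ?gt_eqF// subrr add0r.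
  move=> l; apply: (@le_trans _ _ (\sum_t G l t * (X * h t - Y t))).
    rewrite mulr_sumr; apply: ler_sum => t _; rewrite mulrA.
    exact: ler_wpM2r (GQ _ _).
  have -> : \sum_t G l t * (X * h t - Y t) =
      X * (\sum_t G l t * h t) - \sum_t G l t * Y t.
    by rewrite mulr_sumr -sumrB; apply: eq_bigr => t _; ring.
  have h1 : X * (\sum_t G l t * h t) <= X * h l.
    apply: ler_wpM2l => //; rewrite [leRHS]hE lerDr.
    by rewrite mulr_ge0 ?sqr_ge0// ltW.
  by have := YG l; lra.
(* At an index minimizing [Re u_i / Im u_i] every [Im (u_i / q_k)] is at least
   [h_i / |q_k|^2].  So the diagonal coefficient [a = sum_k s_ik^2 (u_i / q_k)^2]
   has [Re (1 - a) = 1 - b + 2 D] with a gain [D] of order [h_i^2] over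
   [1 - b]. *)
have [i _ imin] := @arg_minP _ R _ j xpredT (fun i => Re (u i) / h i) isT.
have hre l : 0 <= h i * Re (u l) - Re (u i) * h l.
  rewrite subr_ge0; have := imin l isT; rewrite ler_pdivrMr// mulrAC ler_pdivlMr//.
  by rewrite [Re (u l) * _]mulrC.
pose w k := u i / q k.
(* Multiplied by [|q_k|^2], the right side is [h_i + sum_l s_lk (h_i Re u_l - h_l Re u_i)]: the
   summand [1] of [q_k] yields [h_i], and minimality makes the sum nonnegative. *)
have Imw k : h i / cabs (q k) ^+ 2 <= Im (w k).
  have -> : Im (w k) = (h i * Re (q k) - Re (u i) * Im (q k)) / cabs (q k) ^+ 2.
    by rewrite /w ImM ReV ImV /h; ring.
  apply: ler_wpM2r; first by rewrite invr_ge0 sqr_ge0.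
  rewrite /q Im_gden ReD Re_sum /= mulrDr mulr1 -addrA lerDl.
  rewrite !mulr_sumr -sumrB; apply: sumr_ge0 => l _; rewrite ReZ.
  have -> : h i * (S l k * Re (u l)) - Re (u i) * (S l k * Im (u l)) =
    S l k * (h i * Re (u l) - Re (u i) * h l) by rewrite /h; ring.
  by rewrite mulr_ge0.
pose a := \sum_k ((S i k) ^+ 2)%:C * w k ^+ 2.
pose b := G i i; pose D := \sum_k (S i k) ^+ 2 * Im (w k) ^+ 2.
have aw k : cabs (w k) ^+ 2 = cabs (u i) ^+ 2 / cabs (q k) ^+ 2.
  by rewrite /w cabsM cabsV exprMn exprVn.
have bE : b = \sum_k (S i k) ^+ 2 * cabs (w k) ^+ 2.
  rewrite /b /G mulr_sumr; apply: eq_bigr => k _; rewrite aw.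
  by move: (cabs (q k) ^+ 2)^-1 => t; ring.
have Rea : Re (1 - a) = 1 - b + 2 * D.
  rewrite ReD ReN Re_sum /= bE mulr_sumr -addrA -sumrN -[in RHS]sumrN -big_split/=.
  congr (_ + _); apply: eq_bigr => k _; rewrite ReZ expr2 ReM sqr_cabs; ring.
(* The diagonal term [a * y i] goes to the left side with its phase; only the off-diagonal terms,
   collected in [y'], are estimated by moduli. *)
pose y' l : R[i] := if l == i then 0 else y l.
have y'i : y' i = 0 by rewrite /y' eqxx.
have yi : y i * (1 - a) = u i ^+ 2 * (1 + \sum_k (S i k)%:C / q k ^+ 2 *
      \sum_l (S l k)%:C * y' l).
  rewrite mulrBr mulr1 {1}yE -/(q _).
  have -> : \sum_k (S i k)%:C / gden S u k ^+ 2 * \sum_l (S l k)%:C * y l =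
     \sum_k (S i k)%:C / q k ^+ 2 * (\sum_l (S l k)%:C * y' l) +
     \sum_k (S i k)%:C / q k ^+ 2 * ((S i k)%:C * y i).
    rewrite -big_split/=; apply: eq_bigr => k _; rewrite -mulrDr; congr (_ * _).
    rewrite (bigD1 i)//= addrC [in RHS](bigD1 i)//= y'i mulr0 add0r.
    by congr (_ + _); apply: eq_bigr => l li; rewrite /y' (negbTE li).
  rewrite addrA [in LHS]mulrDr -addrA -[RHS]addr0; congr (_ + _).
  apply/eqP; rewrite subr_eq0 /a !mulr_sumr; apply/eqP; apply: eq_bigr => k _.
  by rewrite /w rmorphXn/= exprMn exprVn; ring.
have Gii : b * h i <= h i.
  rewrite [leRHS]hE (bigD1 i)//= addrCA lerDl addr_ge0//.
    by rewrite mulr_ge0 ?sqr_ge0// ltW.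
  by apply: sumr_ge0 => l _; rewrite mulr_ge0// ltW.
have b1 : b <= 1 by rewrite -(ler_pM2r (h0 i)) mul1r.
have b0 : 0 <= b by exact: G0.
have D0 : 0 <= D by apply: sumr_ge0 => k _; rewrite mulr_ge0 ?sqr_ge0.
have E1 : Y i * (1 - b + 2 * D) <= c^-1 ^+ 2 + X * h i * (1 - b).
  apply: (@le_trans _ _ (cabs (y i * (1 - a)))).
    rewrite cabsM -Rea; apply: ler_wpM2l; first exact: cabs_ge0.
    by apply: le_trans (Re_le_cabs _); exact: ler_norm.
  rewrite yi; apply: le_trans (YGf _ _) _; rewrite lerD2l.
  apply: (@le_trans _ _ (X * \sum_(l | l != i) G i l * h l)).
    rewrite (bigD1 i)//= y'i cabs0 mulr0 add0r mulr_sumr.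
    apply: ler_sum => l li; rewrite /y' (negbTE li) mulrCA; apply: ler_wpM2l => //.
    exact: YX.
  rewrite -mulrA; apply: ler_wpM2l => //.
  have hEi := hE i; rewrite (bigD1 i)//= -/b in hEi.
  have : 0 <= cabs (u i) ^+ 2 * Im z by rewrite mulr_ge0 ?sqr_ge0// ltW.
  have -> : h i * (1 - b) = h i - b * h i by ring.
  by lra.
have Dup : D <= c^-1 ^+ 4 * Qm.
  apply: (@le_trans _ _ (c^-1 ^+ 4 * Q i i)).
    rewrite QE mulr_sumr; apply: ler_sum => k _; rewrite mulrC -expr2.
    apply: ler_wpM2r; first exact: sqr_ge0.
    apply: (@le_trans _ _ (cabs (w k) ^+ 2)).
      by rewrite sqr_cabs lerDr sqr_ge0.
    rewrite aw (_ : 4%N = (2 + 2)%N)// exprD; apply: ler_pM => //.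
    - exact: sqr_ge0.
    - by rewrite invr_ge0 sqr_ge0.
    - rewrite -exprVn; apply: (sqle _ _); first by rewrite invr_ge0 cabs_ge0.
      by rewrite lef_pV2 ?posrE.
  apply: ler_wpM2l; first by rewrite exprn_ge0// ltW.
  by rewrite /Qm (bigD1 i)//= lerDl; apply: sumr_ge0.
have Dlow : c ^+ 4 * q0 * h i ^+ 2 <= D.
  apply: (@le_trans _ _ (c ^+ 4 * h i ^+ 2 * Q i i)).
    by rewrite mulrAC; apply: ler_wpM2l => //; rewrite mulr_ge0 ?sqr_ge0// ltW.
  rewrite QE mulr_sumr; apply: ler_sum => k _; rewrite mulrC -expr2.
  apply: ler_wpM2l; first exact: sqr_ge0.
  have -> : c ^+ 4 * h i ^+ 2 = (h i * c ^+ 2) ^+ 2 by ring.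
  apply: (sqle _ _); first by rewrite mulr_ge0 ?sqr_ge0// ltW.
  apply: le_trans (Imw k); apply: ler_wpM2l; first exact: ltW.
  rewrite -[leLHS]invrK -exprVn lef_pV2 ?posrE ?exprn_gt0//.
  by apply: (sqle _ _) => //; exact: ltW.
have P0 : 0 <= X * h i by rewrite mulr_ge0// ltW.
(* Replacing [Y i] in [E1] by its lower bound [X * h i - C2] makes the terms [X * h i * (1 - b)]
   cancel; only the gain remains. *)
have E2 : X * h i * (2 * D) <= C3.
  have hd := dC2 i; have nn : 0 <= 1 - b + 2 * D by lra.
  have := ler_wpM2r nn hd => E3.
  have E4 : C2 * (1 - b + 2 * D) <= C2 * (1 + 2 * c^-1 ^+ 4 * Qm).
    by apply: ler_wpM2l => //; lra.
  rewrite /C3; move: E1 E3 E4; set P := X * h i; set K := c^-1 ^+ 2.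
  move: (C2 * (1 + _)) (C2 * (1 - _ + _)) => U V E1 E3 E4.
  have -> : P * (2 * D) = (P - Y i) * (1 - b + 2 * D) + Y i * (1 - b + 2 * D) - P * (1 - b).
    by ring.
  by lra.
have E5 : X * h i * (h i ^+ 2) <= C3 / (2 * c ^+ 4 * q0).
  rewrite ler_pdivlMr ?mulr_gt0//; apply: le_trans E2.
  have -> : X * h i * h i ^+ 2 * (2 * c ^+ 4 * q0) =
    X * h i * (2 * (c ^+ 4 * q0 * h i ^+ 2)) by ring.
  by apply: ler_wpM2l => //; lra.
have hl l : h l <= h i / c1 by rewrite ler_pdivlMr// mulrC.
have Yj : Y j <= X * h i / c1.
  by apply: le_trans (YX j) _; rewrite -mulrA; apply: ler_wpM2l.
have hs : \sum_l h l <= p%:R * (h i / c1).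
  rewrite mulr_natl -[p in leRHS]card_ord -sumr_const; apply: ler_sum => l _.
  exact: hl.
have hs0 : 0 <= \sum_l h l by apply: sumr_ge0 => l _; exact: ltW.
apply: (@le_trans _ _ (X * h i / c1 * (p%:R * (h i / c1)) ^+ 2)).
  apply: ler_pM; [exact: cabs_ge0|exact: sqr_ge0|exact: Yj|].
  exact: (sqle _ _ hs0 hs).
have -> : X * h i / c1 * (p%:R * (h i / c1)) ^+ 2 =
  X * h i * (h i ^+ 2) * (p%:R ^+ 2 / c1 ^+ 3) by field; rewrite gt_eqF.
have -> : C3 * p%:R ^+ 2 / (2 * c ^+ 4 * q0 * c1 ^+ 3) =
  C3 / (2 * c ^+ 4 * q0) * (p%:R ^+ 2 / c1 ^+ 3) by field; rewrite !gt_eqF.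
apply: ler_wpM2r => //; apply: divr_ge0; first exact: sqr_ge0.
by rewrite exprn_ge0// ltW.
Qed.

End DerivativeBound.

(** * Regularity of the solution up to the positive real axis *)

Section SolutionRegularity.
Context {R : realType} (p n : nat) (S : 'M[R]_(p, n)).
Hypothesis S_ge0 : forall i k, 0 <= S i k.
Variable m : R[i] -> 'cV[R[i]]_p.
Hypothesis msol : is_solution S m.

Let u z j := m z j ord0.

Lemma solution_is_fixed z : 0 < Im z -> is_fixed S z (u z).
Proof.
move=> z0; case: msol => _ mE m0; split => //.
- by move=> i; exact: m0.
- exact: (solution_fixedP S z (m z)).1 (mE z z0).
Qed.

Lemma solution_quotient_cvg z i : 0 < Im z -> exists D : R[i],
  ccvg (0 : R[i]^o)^' (fun h => h^-1 * (u (h + z) i - u z i)) D.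
Proof.
move=> z0; case: msol => hol _ _; have /cvg_ex[D hD] := hol i z z0.
exists D; move: hD; rewrite /ccvg; apply: cvg_trans; apply: near_eq_cvg.
apply: nearW => h /=; rewrite /shift/=.
have -> : (h *: (1 : R[i]^o) : R[i]) = h by exact: mulr1.
by [].
Qed.

Lemma dnbhs0_Im_gt0 z : 0 < Im z ->
  \forall h \near (0 : R[i]^o)^', h != 0 /\ 0 < Im ((h : R[i]) + z).
Proof.
move=> z0; have nn := @nbhs_dnbhs_neq R[i]^o 0.
have := @dnbhs0_lt R[i] R[i]^o (Im z)%:C; rewrite ltcR => /(_ z0) nd.
near=> h; split; first by near: h; exact: nn.
have hz : cabs h < Im z by rewrite -ltcR -norm_cabs; near: h; exact: nd.
have := le_lt_trans (Im_le_cabs h) hz; rewrite ltr_norml => /andP[h1 _].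
by rewrite ImD; lra.
Unshelve. all: by end_near. Qed.

(** Differentiability is part of [is_solution]. The linear equation is the limit of the identity
    [gmapB] at the parameters [h + z] and [z], divided by [h]. *)
Lemma solution_derivative z : 0 < Im z -> exists D : 'I_p -> R[i],
  (forall i, ccvg (0 : R[i]^o)^' (fun h => h^-1 * (u (h + z) i - u z i)) (D i)) /\
  (forall i, D i = u z i ^+ 2 * (1 + \sum_k (S i k)%:C / gden S (u z) k ^+ 2 *
                                  \sum_j (S j k)%:C * D j)).
Proof.
move=> z0; have /choice[D hD] := fun i => solution_quotient_cvg i z0.
have [_ u0 uE] := solution_is_fixed z0.
exists D; split => // i.
have FF : ProperFilter (0 : R[i]^o)^' by exact: Proper_dnbhs_numFieldType.
have ch : ccvg (0 : R[i]^o)^' (fun h => h) 0.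
  by apply: cvg_trans (@cvg_id _ _); exact: cvg_within.
have nz := dnbhs0_Im_gt0 z0.
have cu j : ccvg (0 : R[i]^o)^' (fun h => u (h + z) j) (u z j).
  have cc : ccvg (0 : R[i]^o)^' (fun=> u z j) (u z j) by exact: ccvg_cst.
  have : ccvg (0 : R[i]^o)^' (fun h => h * (h^-1 * (u (h + z) j - u z j)) + u z j)
      (0 * D j + u z j).
    by apply: ccvgD cc; exact: ccvgM (hD j).
  rewrite mul0r add0r /ccvg; apply: cvg_trans; apply: near_eq_cvg.
  by move: nz; apply: filterS => h [h0 _]; rewrite mulrA mulfV// mul1r subrK.
have cq k : ccvg (0 : R[i]^o)^' (fun h => gden S (u (h + z)) k) (gden S (u z) k).
  apply: ccvgD; first exact: ccvg_cst.
  by apply: ccvg_sum => j; apply: ccvgM (cu j); exact: ccvg_cst.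
have qN k : gden S (u z) k != 0 by exact: gden_neq0.
have cR : ccvg (0 : R[i]^o)^' (fun h => u (h + z) i * u z i *
    (1 + \sum_k (S i k)%:C / (gden S (u (h + z)) k * gden S (u z) k) *
         \sum_j (S j k)%:C * (h^-1 * (u (h + z) j - u z j))))
  (u z i ^+ 2 * (1 + \sum_k (S i k)%:C / gden S (u z) k ^+ 2 *
                                  \sum_j (S j k)%:C * D j)).
  rewrite expr2; apply: ccvgM; first by apply: ccvgM (cu i) _; exact: ccvg_cst.
  apply: ccvgD; first exact: ccvg_cst.
  apply: ccvg_sum => k; apply: ccvgM.
    apply: ccvgM; first exact: ccvg_cst.
    apply: ccvgV; first by rewrite expf_neq0.
    by rewrite expr2; apply: ccvgM (cq k) _; exact: ccvg_cst.
  by apply: ccvg_sum => j; apply: ccvgM (hD j); exact: ccvg_cst.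
apply: (ccvg_unique (hD i)); move: cR; rewrite /ccvg; apply: cvg_trans.
apply: near_eq_cvg; move: nz; apply: filterS => h [h0 hz].
have [_ uh0 uhE] := solution_is_fixed hz.
have e := gmapB S_ge0 i hz z0 uh0 u0; rewrite -uhE -uE addrK in e.
rewrite e [RHS]mulrCA; congr (_ * _); rewrite [RHS]mulrDr mulVf//; congr (_ + _).
rewrite mulr_sumr; apply: eq_bigr => k _; rewrite mulrCA; congr (_ * _).
by rewrite mulr_sumr; apply: eq_bigr => j _; rewrite mulrCA.
Qed.

(** Restricts complex increments to real multiples of a direction, so that complex derivatives yield
    derivatives along a segment. *)
Lemma dnbhs0_scale (w : R[i]) : w != 0 ->
  (fun s : R => (s%:C * w : R[i]^o)) @ (0 : R)^' --> (0 : R[i]^o)^'.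
Proof.
move=> w0 A /= /nbhs_ballP[e /= e0 hA].
have eE : e = (Re e)%:C by rewrite RRe_real// realE ltW.
have er0 : 0 < Re e by rewrite -ltcR -eE.
have aw : 0 < cabs w by rewrite cabs_gt0.
have := @dnbhs0_lt R R (Re e / cabs w) (divr_gt0 er0 aw).
have nn := @nbhs_dnbhs_neq R 0.
move=> nd; suff : \forall s \near (0 : R)^', A (s%:C * w) by [].
near=> s; apply: hA.
  rewrite /ball/= sub0r normrN.
  suff : (cabs (s%:C * w))%:C < e by rewrite -norm_cabs.
  rewrite eE ltcR cabsM cabs_real -ltr_pdivlMr//.
  by near: s; exact: nd.
by rewrite mulf_neq0// (inj_eq (@complexI R)); near: s; exact: nn.
Unshelve. all: by end_near. Qed.

Definition im_sum z : R := \sum_i Im (u z i).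

Lemma im_sum_ge0 z : 0 < Im z -> 0 <= im_sum z.
Proof.
by move=> z0; apply: sumr_ge0 => i _; have [_ u0 _] := solution_is_fixed z0; exact: ltW.
Qed.

Lemma segment_is_derive (z w : R[i]) (t : R) (D : 'I_p -> R[i]) :
  0 < Im (z + t%:C * w) ->
  (forall i, ccvg (0 : R[i]^o)^'
    (fun h => h^-1 * (u (h + (z + t%:C * w)) i - u (z + t%:C * w) i)) (D i)) ->
  is_derive t 1 (fun t => im_sum (z + t%:C * w)) (\sum_i Im (w * D i)).
Proof.
move=> zt0 hD.
suff h : (fun s => s^-1 *: (((fun t => im_sum (z + t%:C * w)) \o shift t) (s *: (1:R)) -
    im_sum (z + t%:C * w))) @ (0 : R)^' --> (\sum_i Im (w * D i) : R).
  by apply: DeriveDef; [apply/cvg_ex; eexists; exact: h|exact/cvg_lim].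
have [->|w0] := eqVneq w 0.
  under eq_bigr do rewrite mul0r /=.
  rewrite big1//; apply: cvg_near_cst; apply: nearW => s /=.
  by rewrite !mulr0 subrr scaler0.
have cD i : (fun s : R => Im (w * ((s%:C * w)^-1 * (u (s%:C * w + (z + t%:C * w)) i -
    u (z + t%:C * w) i)))) @ (0 : R)^' --> Im (w * D i).
  have c1 := cvg_comp _ _ (dnbhs0_scale w0) (hD i).
  apply: (@ccvg_Im _ _ (0 : R)^'); apply: ccvgM; first exact: ccvg_cst.
  exact: c1.
have FR : Filter (0 : R)^' by typeclasses eauto.
have := rcvg_sum (r := index_enum 'I_p) FR cD.
apply: cvg_trans; apply: near_eq_cvg.
have nn := @nbhs_dnbhs_neq R 0.
near=> s; have s0 : s != 0 by near: s; exact: nn.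
rewrite /= /shift/= /im_sum -sumrB scaler_sumr; apply: eq_bigr => i _.
have -> : z + (s *: (1 : R) + t)%:C * w = s%:C * w + (z + t%:C * w).
  by rewrite (_ : s *: (1 : R) = s) ?rmorphD/= ?mulrDl; [ring|exact: mulr1].
rewrite -ImN -ImD invfM [_^-1 / w]mulrC mulrA mulrA mulfV// mul1r.
by rewrite -fmorphV ImZ.
Unshelve. all: by end_near. Qed.

(** The derivative bound is exactly a bound on the derivative of the cube. The mean value theorem
    applies on the segment from [z] to [z'], which stays in the convex strip, and
    [|x - y|^3 <= |x^3 - y^3|] holds for nonnegative reals. *)
Lemma cube_lipschitz (a A : R) : assumptionB S -> 0 < a ->
  exists C : R, forall z z', a <= Re z <= A -> 0 < Im z <= 1 ->
    a <= Re z' <= A -> 0 < Im z' <= 1 ->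
    `|im_sum z - im_sum z'| ^+ 3 <= C * cabs (z - z').
Proof.
move=> SB a0.
have [c c0 hc] := sol_uniform_bounds S_ge0 (A + 1) a0.
have [C hC] := derivative_bound S_ge0 SB c0.
exists (3 * p%:R * C) => z z' /andP[z1 z2] /andP[z3 z4] /andP[z1' z2'] /andP[z3' z4'].
pose w := z' - z.
pose f t := im_sum (z + t%:C * w).
have strip (t : R) : 0 <= t <= 1 -> 0 < Im (z + t%:C * w) /\ a <= cabs (z + t%:C * w) <= A + 1.
  move=> /andP[t0 t1].
  have ReE : Re (z + t%:C * w) = (1 - t) * Re z + t * Re z'.
    by rewrite ReD ReZ ReD ReN; ring.
  have ImE : Im (z + t%:C * w) = (1 - t) * Im z + t * Im z'.
    by rewrite ImD ImZ ImD ImN; ring.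
  have t1' : 0 <= 1 - t by rewrite subr_ge0.
  have I0 : 0 < Im (z + t%:C * w) by rewrite ImE; nra.
  have I1 : Im (z + t%:C * w) <= 1 by rewrite ImE; nra.
  have R0 : a <= Re (z + t%:C * w) by rewrite ReE; nra.
  have R1 : Re (z + t%:C * w) <= A by rewrite ReE; nra.
  split => //; apply/andP; split.
    by apply: le_trans R0 (le_trans (ler_norm _) (Re_le_cabs _)).
  apply: le_trans (cabs_le_ReIm _) _; rewrite !ger0_norm ?lerD ?(ltW I0)//.
  by rewrite (le_trans (ltW a0)).
have df (t : R) : 0 <= t <= 1 -> exists2 d : R, is_derive t 1 f d &
    `|d| * f t ^+ 2 <= p%:R * C * cabs w.
  move=> t01; have [I0 zb] := strip t t01.
  have [D [hD DE]] := solution_derivative I0.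
  exists (\sum_i Im (w * D i)); first exact: segment_is_derive.
  have fx := solution_is_fixed I0.
  have [bu bq] := hc _ _ fx zb.
  apply: (@le_trans _ _ (\sum_i cabs w * cabs (D i) * f t ^+ 2)).
    rewrite -mulr_suml; apply: ler_wpM2r; first exact: sqr_ge0.
    apply: le_trans (ler_norm_sum _ _ _) _; apply: ler_sum => i _.
    by rewrite -cabsM Im_le_cabs.
  apply: (@le_trans _ _ (\sum_(i < p) cabs w * C)).
    apply: ler_sum => i _; rewrite -mulrA; apply: ler_wpM2l; first exact: cabs_ge0.
    exact: hC fx bu bq DE i.
  by rewrite sumr_const card_ord -[_ *+ p]mulr_natr le_eqVlt; apply/orP; left; apply/eqP; ring.
have f0 (t : R) : 0 <= t <= 1 -> 0 <= f t.
  by move=> t01; have [I0 _] := strip t t01; exact: im_sum_ge0.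
have f3 (t : R) : 0 <= t <= 1 -> exists2 d : R, is_derive t 1 (fun s => f s ^+ 3) d &
    `|d| <= 3 * p%:R * C * cabs w.
  move=> t01; have [d d1 d2] := df t t01.
  exists (3 * f t ^+ 2 * d).
    have -> : (fun s => f s ^+ 3) = f ^+ 3 by apply/funext => s.
    exact: is_deriveX.
  have -> : `|3 * f t ^+ 2 * d| = 3 * (`|d| * f t ^+ 2).
    by rewrite !normrM (ger0_norm (f0 t t01)) (ger0_norm (ler0n _ 3)); ring.
  have -> : 3 * p%:R * C * cabs w = 3 * (p%:R * C * cabs w) by ring.
  by rewrite ler_pM2l.
have /choice[df3 hdf3] : forall t : R, exists d : R, 0 <= t <= 1 ->
    is_derive t 1 (fun s => f s ^+ 3) d /\ `|d| <= 3 * p%:R * C * cabs w.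
  move=> t; have [t01|nt] := pselect (0 <= t <= 1); last by exists 0.
  by have [d d1 d2] := f3 t t01; exists d.
have [t t01 ft] : exists2 t, t \in `]0, 1[%R & f 1 ^+ 3 - f 0 ^+ 3 = df3 t * (1 - 0).
  apply: (@MVT _ (fun s => f s ^+ 3)) => //.
    move=> x; rewrite in_itv/= => /andP[x0 x1]; apply: (hdf3 x _).1.
    by rewrite !ltW.
  apply: derivable_within_continuous => x; rewrite in_itv/= => x01.
  by have [h _] := hdf3 x x01; exact: ex_derive.
have f0E : f 0 = im_sum z by rewrite /f mul0r addr0.
have f1E : f 1 = im_sum z' by rewrite /f mul1r /w addrC subrK.
have cube (x y : R) : 0 <= x -> 0 <= y -> `|x - y| ^+ 3 <= `|x ^+ 3 - y ^+ 3|.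
  wlog xy : x y / y <= x.
    move=> H x0 y0; have [/H|/ltW/H] := leP y x; first exact.
    by move=> /(_ y0 x0); rewrite (distrC y) (distrC (y ^+ 3)).
  move=> x0 y0; rewrite !ger0_norm ?subr_ge0//; last by rewrite ler_pXn2r// nnegrE.
  have : 0 <= 3 * x * y * (x - y) by rewrite !mulr_ge0// subr_ge0.
  have -> : (x - y) ^+ 3 = x ^+ 3 - y ^+ 3 - 3 * x * y * (x - y) by ring.
  by lra.
have zz0 : 0 <= (0 : R) <= 1 by rewrite lexx ler01.
have zz1 : 0 <= (1 : R) <= 1 by rewrite lexx ler01.
have := cube _ _ (f0 1 zz1) (f0 0 zz0); rewrite f0E f1E distrC cabs_subC.
move=> /le_trans; apply; rewrite -f0E -f1E ft subr0 mulr1 -/w.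
apply: (hdf3 t _).2; move: t01; rewrite in_itv/= => /andP[t0 t1].
by rewrite !ltW.
Qed.

End SolutionRegularity.

(** * Stieltjes inversion and the density *)

Section PoissonKernel.
Context {R : realType}.
Implicit Types (x w e a b : R).
Local Notation mu := (@lebesgue_measure R).

(** The Poisson kernel without its factor [pi^-1], which is why [pi] appears in the inversion
    formula. *)
Definition poisson e x w : R := Im ((w%:C - (x +i* e))^-1).

Lemma poissonE e x w : poisson e x w = e / ((w - x) ^+ 2 + e ^+ 2).
Proof. by rewrite /poisson ImV sqr_cabs /= sub0r sqrrN opprK. Qed.

Lemma poisson_sym e x w : poisson e x w = poisson e w x.
Proof. by rewrite !poissonE -(sqrrN (w - x)) opprB. Qed.

Lemma poisson_ge0 e x w : 0 < e -> 0 <= poisson e x w.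
Proof. by move=> e0; rewrite poissonE divr_ge0 ?(ltW e0)// addr_ge0// sqr_ge0. Qed.

Lemma poisson_lipschitz e x w v : 0 < e ->
  `|poisson e x w - poisson e x v| <= e^-1 ^+ 2 * `|w - v|.
Proof. by move=> e0; exact: (@Im_kernel_lipschitz _ (x +i* e)). Qed.

Lemma poisson_le e x w : 0 < e -> `|poisson e x w| <= e^-1.
Proof.
move=> e0; apply: le_trans (Im_le_cabs _) _.
exact: (@cabs_kernel_le _ _ (x +i* e)).
Qed.

Lemma continuous_poissonl e w : 0 < e -> continuous (fun x => poisson e x w).
Proof.
move=> e0; apply: (@lipschitz_continuous _ _ (e^-1 ^+ 2)) => x y.
by rewrite !(poisson_sym e _ w); exact: poisson_lipschitz.
Qed.

Lemma is_derive_atan_scaled e w x : 0 < e ->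
  is_derive x 1 (fun x => atan ((x - w) / e)) (poisson e x w).
Proof.
move=> e0.
have h : is_derive x 1 (fun y : R => (y - w) / e) e^-1.
  have hB : is_derive x 1 ((@id R : R -> R) - cst w) (1 - 0) by exact: is_deriveB.
  have hZ := @is_deriveZ _ _ _ _ e^-1 _ _ _ hB.
  have -> : (fun y : R => (y - w) / e) = e^-1 \*: ((@id R : R -> R) - cst w).
    by apply/funext => y; rewrite /= mulrC.
  by apply: is_derive_eq hZ _; rewrite subr0; exact: mulr1.
have hc := @is_derive1_comp R atan (fun y => (y - w) / e) x _ _ (is_derive1_atan _) h.
apply: is_derive_eq hc _.
rewrite poissonE; field.
have s0 : 0 < (w - x) ^+ 2 + e ^+ 2 by rewrite ltr_wpDl ?sqr_ge0// exprn_gt0.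
have s1 : 0 < (x - w) ^+ 2 + e ^+ 2 by rewrite ltr_wpDl ?sqr_ge0// exprn_gt0.
by rewrite ?(gt_eqF s0) ?(gt_eqF s1) ?(gt_eqF e0)//= addrC ?(gt_eqF s1) ?(gt_eqF s0).
Qed.

Lemma integral_poisson e w a b : 0 < e -> a < b ->
  (\int[mu]_(x in `[a, b]) (poisson e x w)%:E =
   (atan ((b - w) / e) - atan ((a - w) / e))%:E)%E.
Proof.
move=> e0 ab.
rewrite (@continuous_FTC2 _ _ (fun x => atan ((x - w) / e)))//.
- by apply: continuous_subspaceT; exact: continuous_poissonl.
- have cF : continuous (fun x => atan ((x - w) / e)).
    move=> x; apply: differentiable_continuous; apply/derivable1_diffP.
    by have h := is_derive_atan_scaled w x e0; exact: ex_derive.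
  split.
  + by move=> x _; have h := is_derive_atan_scaled w x e0; exact: ex_derive.
  + by apply: cvg_at_right_filter; exact: cF.
  + by apply: cvg_at_left_filter; exact: cF.
- move=> x _; rewrite derive1E; have h := is_derive_atan_scaled w x e0.
  exact: derive_val.
Qed.

Variable nu : probability (measurableTypeR R) R.

Definition poisson_int e x : R := \int[nu]_w poisson e x w.

Lemma measurable_poisson2 e : 0 < e ->
  measurable_fun setT (fun p : measurableTypeR R * measurableTypeR R => poisson e p.1 p.2).
Proof.
move=> e0.
rewrite (_ : (fun _ => _) = (poisson e 0 : measurableTypeR R -> R) \o
  (fun p : measurableTypeR R * measurableTypeR R => p.2 - p.1 : measurableTypeR R)).
  apply: measurableT_comp.
    apply: (@continuous_measurable_fun R (poisson e 0)).
    by apply: (@lipschitz_continuous _ _ (e^-1 ^+ 2)) => x y; exact: poisson_lipschitz.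
  exact: (measurable_funB measurable_snd measurable_fst).
by apply/funext => p; rewrite /= !poissonE subr0.
Qed.

Lemma poisson_intE e x : 0 < e ->
  (\int[nu]_w (poisson e x w)%:E = (poisson_int e x)%:E)%E.
Proof.
move=> e0; rewrite /poisson_int /Rintegral fineK//.
apply: integrable_fin_num => //.
apply: (@prob_bounded_integrable _ _ _ e^-1).
  apply: (@continuous_measurable_fun R (poisson e x)).
  by apply: (@lipschitz_continuous _ _ (e^-1 ^+ 2)) => y z; exact: poisson_lipschitz.
by move=> w; exact: poisson_le.
Qed.

(** Tonelli applied to the kernel cut off by the indicator of [[a, b]]; the inner integral has the
    arctangent as primitive. *)
Lemma integral_poisson_int e a b : 0 < e -> a < b ->
  (\int[mu]_(x in `[a, b]) (poisson_int e x)%:E =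
   \int[nu]_w (atan ((b - w) / e) - atan ((a - w) / e))%:E)%E.
Proof.
move=> e0 ab.
pose f (p : measurableTypeR R * measurableTypeR R) : \bar R :=
  (poisson e p.1 p.2 * \1_(`[a, b]%classic : set R) p.1)%:E.
have mf : measurable_fun setT f.
  apply/measurable_EFinP; apply: measurable_funM; first exact: measurable_poisson2.
  have mI : measurable_fun setT (\1_(`[a, b]%classic) : measurableTypeR R -> R).
    by apply/measurable_indicP; exact: measurable_itv.
  exact: (measurableT_comp mI measurable_fst).
have f0 p : (0 <= f p)%E.
  by rewrite lee_fin mulr_ge0 ?poisson_ge0// indicE ler0n.
have := @fubini_tonelli _ _ (measurableTypeR R) (measurableTypeR R) R mu nu f mf f0.
rewrite /f/= => fub.
transitivity (\int[mu]_x \int[nu]_y (poisson e x y * \1_`[a, b] x)%:E)%E.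
  rewrite integral_mkcond; apply: eq_integral => x _.
  rewrite patchE /= indicE; case: ifPn => xab.
    by under eq_integral do rewrite mulr1; rewrite poisson_intE.
  by under eq_integral do rewrite mulr0; rewrite integral0.
rewrite fub; apply: eq_integral => w _.
apply: etrans _ (integral_poisson w e0 ab); rewrite [RHS]integral_mkcond.
apply: eq_integral => x _.
by rewrite patchE /= indicE; case: ifPn => _; rewrite ?mulr1// mulr0.
Qed.

End PoissonKernel.

Section StieltjesInversion.
Context {R : realType} (nu : probability (measurableTypeR R) R).
Implicit Types (x w e a b : R).
Local Notation mu := (@lebesgue_measure R).
Local Notation eps k := ((k.+1%:R : R)^-1).

Lemma atan_scaled_cvg (t : R) :
  (fun k : nat => atan (t / eps k)) @ \oo -->
    (if 0 < t then pi / 2 else if t < 0 then - (pi / 2) else 0 : R).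
Proof.
have pos s : 0 < s -> (fun k : nat => atan (s / eps k)) @ \oo --> (pi / 2 : R).
  move=> s0.
  have h : (fun k : nat => s / eps k) @ \oo --> +oo.
    apply/cvgryPge => A; near=> k.
    rewrite invrK mulrC -ler_pdivrMr//.
    apply: (@le_trans _ _ k%:R); last by rewrite ler_nat.
    by near: k; exact: nbhs_infty_ger.
  exact: (cvg_comp _ _ h (@cvgy_atan R)).
case: ltgtP => [t0|t0|<-]; first exact: pos.
  have -> : (fun k : nat => atan (t / eps k)) = (fun k => - atan ((- t) / eps k)).
    by apply/funext => k; rewrite mulNr atanN opprK.
  by apply: cvgN; apply: pos; rewrite oppr_gt0.
by under eq_fun do rewrite mul0r atan0; exact: cvg_cst.
Unshelve. all: by end_near. Qed.

(** At an endpoint the limit would be [pi / 2], hence the two exclusions. *)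
Lemma atan_window_cvg a b w : a < b -> w != a -> w != b ->
  (fun k : nat => atan ((b - w) / eps k) - atan ((a - w) / eps k)) @ \oo -->
  (pi * \1_(`]a, b[%classic) w : R).
Proof.
move=> ab wa wb.
have -> : pi * \1_(`]a, b[%classic) w =
    (if 0 < b - w then pi / 2 else if b - w < 0 then - (pi / 2) else 0) -
    (if 0 < a - w then pi / 2 else if a - w < 0 then - (pi / 2) else 0) :> R.
  rewrite indicE mem_setE in_itv/= !subr_gt0 !subr_lt0.
  case: (ltgtP w a) wa => //= wa _; case: (ltgtP w b) wb => //= wb _;
    rewrite ?mulr1 ?mulr0; try lra.
by apply: cvgB; exact: atan_scaled_cvg.
Qed.

Lemma atan_norm_le (x : R) : `|atan x| <= pi / 2.
Proof. by rewrite ler_norml !ltW ?atan_gtNpi2 ?atan_ltpi2. Qed.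

Lemma window_integral_cvg a b : a < b -> nu [set a] = 0%E -> nu [set b] = 0%E ->
  (fun k : nat => \int[nu]_w (atan ((b - w) / eps k) - atan ((a - w) / eps k))%:E)%E @ \oo -->
  (pi%:E * nu `]a, b[%classic)%E.
Proof.
move=> ab na nb.
have mI : measurable (`]a, b[%classic : set (measurableTypeR R)) by exact: measurable_itv.
have m1 : measurable_fun setT (\1_(`]a, b[%classic) : measurableTypeR R -> R).
  by apply/measurable_indicP.
have -> : (pi%:E * nu `]a, b[%classic)%E =
    (\int[nu]_w (pi * \1_(`]a, b[%classic : set (measurableTypeR R)) w)%:E)%E.
  under eq_integral do rewrite EFinM.
  rewrite ge0_integralZl//.
  - by rewrite integral_indic// setIT.
  - exact/measurable_EFinP.
  - by rewrite lee_fin pi_ge0.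
have neg : nu.-negligible ([set a] `|` [set b] : set (measurableTypeR R)).
  apply: negligibleU.
    by exists [set a]; split; [exact: measurable_set1|exact: na|].
  by exists [set b]; split; [exact: measurable_set1|exact: nb|].
have [|||||_ _ h] := @dominated_convergence _ (measurableTypeR R) R nu setT measurableT
  (fun k w => (atan ((b - w) / eps k) - atan ((a - w) / eps k))%:E)
  (fun w => (pi * \1_(`]a, b[%classic : set (measurableTypeR R)) w)%:E)
  (cst pi%:E) _ _ _ _ _.
- move=> k; apply/measurable_EFinP.
  have cont c : continuous (fun w : R => atan ((c - w) / eps k)).
    move=> w; apply: (@continuous_comp _ _ _ (fun w : R => (c - w) / eps k) atan).
      by apply: cvgM; [apply: cvgB; [exact: cvg_cst|exact: cvg_id]|exact: cvg_cst].
    exact: continuous_atan.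
  by apply: (@continuous_measurable_fun R) => w; apply: cvgB; exact: cont.
- apply/measurable_EFinP; exact: measurable_funM.
- have : {ae nu, forall x, ~ ([set a] `|` [set b]) x}.
    by move: neg; apply: negligibleS => x /=; exact: contrapT.
  apply: filterS; first exact: (ae_filter_ringOfSetsType nu).
  move=> w wN _; apply/cvg_EFin; first by near=> k.
  apply: atan_window_cvg => //; apply/eqP => wE; apply: wN; [left|right]; exact: wE.
- exact: finite_measure_integrable_cst.
- apply: aeW => w k _; rewrite /= lee_fin.
  apply: le_trans (ler_normB _ _) _.
  by have := atan_norm_le ((b - w) / eps k); have := atan_norm_le ((a - w) / eps k); lra.
exact: h.
Unshelve. all: by end_near. Qed.

(** At [w = x] the kernel takes the value [e^-1], and elsewhere it is nonnegative. *)
Lemma poisson_int_atom e x : 0 < e -> fine (nu [set x]) <= e * poisson_int nu e x.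
Proof.
move=> e0.
have ms : measurable ([set x] : set (measurableTypeR R)) by exact: measurable_set1.
have : (\int[nu]_(w in [set x]) (poisson e x w)%:E <= (poisson_int nu e x)%:E)%E.
  rewrite -poisson_intE//; apply: ge0_subset_integral => //.
    apply/measurable_EFinP; apply: (@continuous_measurable_fun R (poisson e x)).
    by apply: (@lipschitz_continuous _ _ (e^-1 ^+ 2)) => y z; exact: poisson_lipschitz.
  by move=> w _; rewrite lee_fin poisson_ge0.
have -> : (\int[nu]_(w in [set x]) (poisson e x w)%:E)%E = (e^-1%:E * nu [set x])%E.
  rewrite -integral_cst//; apply: eq_integral => w; rewrite inE => /= ->.
  by rewrite poissonE subrr expr0n/= add0r expr2 invfM mulrA mulfV ?gt_eqF// mul1r.
have fx : nu [set x] \is a fin_num by exact: fin_num_measure.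
rewrite -(fineK fx) -EFinM lee_fin => h.
by rewrite mulrC -ler_pdivrMr// mulrC.
Qed.

Lemma cube_le_bound (t C : R) : `|t| ^+ 3 <= C -> `|t| <= C + 1.
Proof.
move=> h; have t0 := normr_ge0 t.
have [t1|t1] := leP `|t| 1; first by have := exprn_ge0 3 t0; lra.
apply: le_trans (_ : `|t| ^+ 3 <= _); last lra.
by rewrite exprS ler_peMr// expr_ge1// ltW.
Qed.

Lemma cube_cvg0 (f : nat -> R) (l C : R) :
  (forall k, `|f k - l| ^+ 3 <= C * eps k) -> f @ \oo --> l.
Proof.
move=> h; apply/cvgrPdist_lt => d d0.
have C0 : 0 <= C.
  by have := le_trans (exprn_ge0 3 (normr_ge0 _)) (h 0%N); rewrite invr1 mulr1.
near=> k.
have kC : C * eps k < d ^+ 3.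
  rewrite ltr_pdivrMr// mulrC -ltr_pdivrMr ?exprn_gt0//.
  apply: (@lt_le_trans _ _ k%:R); last by rewrite ler_nat.
  by near: k; exact: nbhs_infty_gtr.
have := le_lt_trans (h k) kC.
by rewrite distrC ltr_pXn2r// ?nnegrE ?normr_ge0// ltW.
Unshelve. all: by end_near. Qed.

Lemma poisson_int_lipschitz e x y : 0 < e ->
  `|poisson_int nu e x - poisson_int nu e y| <= e^-1 ^+ 2 * `|x - y|.
Proof.
move=> e0.
have int z : nu.-integrable setT (EFin \o (poisson e z : measurableTypeR R -> R)).
  apply: (@prob_bounded_integrable _ _ _ e^-1) => [|w]; last exact: poisson_le.
  apply: (@continuous_measurable_fun R (poisson e z)).
  by apply: (@lipschitz_continuous _ _ (e^-1 ^+ 2)) => v w; exact: poisson_lipschitz.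
have intB : nu.-integrable setT
    (EFin \o ((fun w => poisson e x w - poisson e y w) : measurableTypeR R -> R)).
  rewrite (_ : _ \o _ = fun w => ((poisson e x w)%:E - (poisson e y w)%:E)%E); last first.
    by apply/funext => w /=; rewrite EFinB.
  exact: (integrableB measurableT (int x) (int y)).
rewrite /poisson_int -RintegralB//.
apply: le_trans (le_normr_Rintegral measurableT intB) _.
have -> : e^-1 ^+ 2 * `|x - y| = \int[nu]_w (e^-1 ^+ 2 * `|x - y|).
  rewrite Rintegral_cst// (_ : fine _ = 1) ?mulr1//.
  exact: (congr1 fine (probability_setT nu)).
apply: le_Rintegral => //.
- exact: (integrable_abse intB).
- exact: finite_measure_integrable_cst.
- by move=> w _; rewrite !(poisson_sym e _ w); exact: poisson_lipschitz.
Qed.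

Lemma integrable_cst_itv a b (c : R) :
  mu.-integrable (`[a, b]%classic : set (measurableTypeR R)) (cst c%:E).
Proof.
apply: (@continuous_compact_integrable _ (cst c)); first exact: segment_compact.
exact: continuous_subspaceT (@cst_continuous _ _ c).
Qed.

(** The boundary value of the Poisson integral. Its rate of convergence and its Hoelder continuity
    are stated for cubes, so that no fractional power occurs. *)
Variable L : R -> R.
Hypothesis PL : forall a b, 0 < a -> exists C : R,
  (forall x e, a <= x <= b -> 0 < e <= 1 -> `|poisson_int nu e x - L x| ^+ 3 <= C * e) /\
  (forall x y, a <= x <= b -> a <= y <= b -> `|L x - L y| ^+ 3 <= C * `|x - y|).

Let eps01 k : 0 < eps k <= 1.
Proof. by rewrite invr_gt0 ltr0n/= invf_le1// ler1n. Qed.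

(** The mass is at most [e] times a Poisson integral that stays bounded as [e] tends to [0]. *)
Lemma no_positive_atom x : 0 < x -> nu [set x] = 0%E.
Proof.
move=> x0; have [C [hC _]] := PL x x0.
have fx : nu [set x] \is a fin_num by apply: fin_num_measure; exact: measurable_set1.
have xx : x <= x <= x by rewrite lexx.
have C0 : 0 <= C.
  have := le_trans (exprn_ge0 3 (normr_ge0 _)) (hC x 1 xx _).
  by rewrite mulr1; apply; rewrite ltr01 lexx.
rewrite -(fineK fx); congr (_%:E); apply/eqP; rewrite eq_le fine_ge0 ?andbT//.
apply: (@le0_of_le_div _ _ (`|L x| + (C + 1))) => k.
have /andP[e0 e1] := eps01 k.
apply: le_trans (poisson_int_atom x e0) _; rewrite mulrC; apply: ler_wpM2r; first exact: ltW.
have hb : `|poisson_int nu (eps k) x - L x| <= C + 1.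
  apply: cube_le_bound; apply: le_trans (hC x _ xx (eps01 k)) _.
  by rewrite ler_piMr.
have := le_trans (ler_norm _) hb; have := ler_norm (L x); lra.
Qed.

Lemma L_continuous_within a b : 0 < a -> {within `[a, b], continuous L}.
Proof.
move=> a0; have [C [_ hC]] := PL b a0.
apply/subspace_continuousP => x /= xab; apply/cvgrPdist_lt => d d0.
rewrite in_itv/= in xab.
have C1 : 0 < `|C| + 1 by rewrite ltr_wpDl.
have dd : 0 < d ^+ 3 / (`|C| + 1) by rewrite divr_gt0// exprn_gt0.
rewrite near_withinE; near=> y => yab; rewrite /= in_itv/= in yab.
have xy : `|x - y| < d ^+ 3 / (`|C| + 1).
  by near: y; exact: (@cvgrPdist_lt R R R (nbhs x) (nbhs_filter x) id x).1 (@cvg_id _ _) _ dd.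
have h : `|L x - L y| ^+ 3 < d ^+ 3.
  apply: le_lt_trans (hC x y xab yab) _.
  apply: le_lt_trans (_ : (`|C| + 1) * `|x - y| < _).
    by apply: ler_wpM2r => //; apply: le_trans (ler_norm _) _; rewrite lerDl.
  by rewrite mulrC -ltr_pdivlMr.
by move: h; rewrite ltr_pXn2r// ?nnegrE ?normr_ge0// ltW.
Unshelve. all: by end_near. Qed.

(** Both sides are limits of the integral of [poisson_int nu (eps k)] over [[a, b]]: by dominated
    convergence for Lebesgue measure, and by the arctangent window for [nu], where the endpoints
    carry no mass. *)
Lemma stieltjes_inversion a b : 0 < a -> a < b ->
  (\int[mu]_(x in `[a, b]) (L x)%:E = pi%:E * nu `]a, b[%classic)%E.
Proof.
move=> a0 ab; have b0 := lt_trans a0 ab.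
have [C [hC _]] := PL b a0.
have aa : a <= a <= b by rewrite lexx ltW.
have C0 : 0 <= C.
  have := le_trans (exprn_ge0 3 (normr_ge0 _)) (hC a 1 aa _).
  by rewrite mulr1; apply; rewrite ltr01 lexx.
have h1 := window_integral_cvg ab (no_positive_atom a0) (no_positive_atom b0).
have mab : measurable (`[a, b]%classic : set (measurableTypeR R)) by exact: measurable_itv.
have mL : measurable_fun `[a, b]%classic (L : measurableTypeR R -> R).
  apply: subspace_continuous_measurable_fun => //; exact: L_continuous_within.
have [M hM] : exists M : R, forall x, a <= x <= b -> `|L x| <= M.
  have cI : compact `[a, b]%classic := @segment_compact R a b.
  have [M [_ mrt]] := compact_bounded (continuous_compact (L_continuous_within a0) cI).
  exists (M + 1) => x xab; apply: (mrt (M + 1)); first by rewrite ltrDl.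
  by exists x => //=; rewrite in_itv.
have [|||||_ _ h2] := @dominated_convergence _ (measurableTypeR R) R mu `[a, b]%classic mab
  (fun k x => (poisson_int nu (eps k) x)%:E) (fun x => (L x)%:E)
  (cst (M + (C + 1))%:E) _ _ _ _ _.
  - move=> k; apply/measurable_EFinP; apply: measurable_funTS.
    have /andP[e0 _] := eps01 k.
    apply: (@continuous_measurable_fun R (poisson_int nu (eps k))).
    apply: (@lipschitz_continuous _ _ ((eps k)^-1 ^+ 2)) => x y.
    exact: poisson_int_lipschitz.
  - exact/measurable_EFinP.
  - apply: aeW => x xab; apply/cvg_EFin; first by near=> k.
    by apply: (@cube_cvg0 _ _ C) => k; apply: hC.
  - exact: integrable_cst_itv.
  - apply: aeW => x k xab; rewrite /= lee_fin; rewrite /= in_itv/= in xab.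
    have hb : `|poisson_int nu (eps k) x - L x| <= C + 1.
      apply: cube_le_bound; apply: le_trans (hC x _ xab (eps01 k)) _.
      by rewrite ler_piMr//; case/andP: (eps01 k).
    rewrite -(subrK (L x) (poisson_int _ _ _)).
    apply: le_trans (ler_normD _ _) _; rewrite addrC lerD//; exact: hM.
apply: (cvg_unique _ h2); first exact: ereal_hausdorff.
move: h1; apply: cvg_trans; apply: near_eq_cvg; apply: nearW => k.
by have /andP[e0 _] := eps01 k; rewrite /= integral_poisson_int.
Unshelve. all: by end_near. Qed.

End StieltjesInversion.

(** * Identification of the measure with its density *)

Section DensityMeasure.
Context {R : realType}.
Implicit Types (x w a b : R).
Local Notation mu := (@lebesgue_measure R).
Variable f : R -> R.
Hypothesis mf : measurable_fun setT (f : measurableTypeR R -> R).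
Hypothesis f0 : forall x, 0 <= f x.

Definition density_measure (A : set (measurableTypeR R)) : \bar R :=
  (\int[mu]_(x in A) (f x)%:E)%E.

Let density_measure0 : density_measure set0 = 0%E.
Proof. exact: integral_set0. Qed.

Let density_measure_ge0 A : (0 <= density_measure A)%E.
Proof. by apply: integral_ge0 => x _; rewrite lee_fin. Qed.

Let density_measure_sigma_additive : semi_sigma_additive density_measure.
Proof.
apply: (@semi_sigma_additive_nng_induced _ _ _ mu (EFin \o f)) => [|x].
  exact/measurable_EFinP.
by rewrite /= lee_fin.
Qed.

HB.instance Definition _ := isMeasure.Build _ _ _ density_measure
  density_measure0 density_measure_ge0 density_measure_sigma_additive.

Hypothesis f_null : forall x, x <= 0 -> f x = 0.
Variable nu : probability (measurableTypeR R) R.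
Hypothesis nu_itv : forall a b, 0 < a -> a < b ->
  nu `]a, b]%classic = (\int[mu]_(x in `]a, b]) (f x)%:E)%E.

Let P : set (measurableTypeR R) := `]0, +oo[%classic.
Let mP : measurable P. Proof. exact: measurable_itv. Qed.

(** The formula is assumed only for [a > 0]. For [a <= 0] both measures are continuous from below
    along the intervals [F k], which exhaust the positive part of []a, b]]. *)
Lemma density_measure_itv a b : mrestr nu mP `]a, b]%classic = density_measure `]a, b]%classic.
Proof.
have pos c d : 0 < c -> mrestr nu mP `]c, d]%classic = density_measure `]c, d]%classic.
  move=> c0; have [dc|cd] := leP d c.
    by rewrite set_itv_ge -?leNgt ?bnd_simp// !measure0.
  rewrite /mrestr (setIidl _) ?nu_itv// => x.
  rewrite /P /= !in_itv/= andbT => /andP[cx _]; exact: lt_trans cx.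
have [a0|a0] := ltP 0 a; first exact: pos.
pose F k : set (measurableTypeR R) := `]k.+1%:R^-1, b]%classic.
have mF k : measurable (F k) by exact: measurable_itv.
have UF : \bigcup_k F k = `]a, b]%classic `&` P.
  apply/seteqP; split=> [x [k _]|x []]; rewrite /P /F /= !in_itv/= ?andbT.
    move=> /andP[kx ->]; have x0 : 0 < x by apply: lt_trans kx; rewrite invr_gt0.
    by rewrite (le_lt_trans a0 x0).
  move=> /andP[_ xb] x0; have [k kx] : exists k : nat, k.+1%:R^-1 < x.
    exists (Num.truncn x^-1); rewrite -[ltRHS]invrK ltf_pV2 ?posrE ?invr_gt0//.
    exact: truncnS_gt.
  by exists k => //=; rewrite in_itv/= kx.
have mUF : measurable (\bigcup_k F k) by exact: bigcup_measurable.
have ndF : nondecreasing_seq F.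
  move=> i j ij; apply/subsetPset => x; rewrite /F /= !in_itv/= => /andP[ix ->].
  by rewrite andbT (le_lt_trans _ ix)// lef_pV2 ?posrE// ler_nat.
have h1 := nondecreasing_cvg_mu (mu := mrestr nu mP) mF mUF ndF.
have h2 := nondecreasing_cvg_mu (mu := density_measure) mF mUF ndF.
have e12 : mrestr nu mP \o F = density_measure \o F.
  by apply/funext => k /=; apply: pos; rewrite invr_gt0.
rewrite e12 in h1.
have h : mrestr nu mP (\bigcup_k F k) = density_measure (\bigcup_k F k).
  exact: cvg_unique h1 h2.
rewrite UF in h; rewrite {1}/mrestr -setIA setIid in h.
apply: etrans h _; rewrite /density_measure.
rewrite integral_mkcondr; apply: eq_integral => x _.
rewrite /patch; case: ifPn => //; rewrite notin_setE /P/= in_itv/= andbT => /negP.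
by rewrite -leNgt => /f_null ->.
Qed.

Lemma density_unique (A : set (measurableTypeR R)) : measurable A ->
  nu (A `&` P) = (\int[mu]_(x in A) (f x)%:E)%E.
Proof.
move=> mA.
apply: (@measure_unique _ R (measurableTypeR R) (@ocitv R)
  (fun k => `](- k%:R)%R, k%:R]%classic) _ _ _ _ (mrestr nu mP) density_measure _ _ A mA) => //.
- exact: ocitvI.
- by move=> k; exists (- k%:R, k%:R).
- apply/seteqP; split=> // x _; exists (Num.truncn `|x|).+1 => //=.
  rewrite in_itv/=; have := truncnS_gt `|x|; rewrite ltr_norml => /andP[-> /ltW ->] //.
- by move=> _ [[a b] _ <-]; exact: density_measure_itv.
- by move=> k; rewrite -ge0_fin_numE//; exact: fin_num_measure.
Qed.

End DensityMeasure.

(** A point outside the support has a null open neighbourhood, hence a null interval with rational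
    endpoints around it. Countably many such intervals, enumerated through [pickle], cover the
    half-line. *)
Lemma null_negative_halfline (R : realType) (nu : probability (measurableTypeR R) R) (b : R) :
  measure_support nu `<=` `[0, b] -> nu `]-oo, 0[%classic = 0%E.
Proof.
move=> hsupp.
have mI (q : rat * rat) : measurable (`]ratr q.1, ratr q.2[%classic : set (measurableTypeR R)).
  exact: measurable_itv.
pose F k : set (measurableTypeR R) := if @unpickle (rat * rat)%type k is Some q then
  (if nu `]ratr q.1, ratr q.2[%classic == 0%E then `]ratr q.1, ratr q.2[%classic else set0)
  else set0.
have F0 : nu.-negligible (\bigcup_k F k).
  apply: negligible_bigcup => k; rewrite /F; case: unpickle => [q|]; last exact: negligible_set0.
  case: eqP => [h|_]; last exact: negligible_set0.
  by exists (`]ratr q.1, ratr q.2[%classic); split; [exact: mI|exact: h|].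
have sub : `]-oo, 0[%classic `<=` \bigcup_k F k.
  move=> x; rewrite /= in_itv/= => x0.
  have : ~ measure_support nu x.
    by move=> /hsupp; rewrite /= in_itv/= leNgt x0.
  move=> /existsNP[U /not_implyP[[oU Ux] /negP]]; rewrite -leNgt => U0.
  have /nbhs_ballP[e /= e0 xU] := open_nbhs_nbhs (conj oU Ux).
  have [q1 q1x] := @rat_in_itvoo R (x - e) x ltac:(by rewrite ltrBlDr ltrDl).
  have [q2 q2x] := @rat_in_itvoo R x (x + e) ltac:(by rewrite ltrDl).
  move: q1x q2x; rewrite !in_itv/= => /andP[h1 h2] /andP[h3 h4].
  exists (pickle (q1, q2)); [exact: Logic.I|rewrite /F pickleK [X in nu X]/=].
  have -> : nu `]ratr q1, ratr q2[%classic = 0%E.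
    apply/eqP; rewrite eq_le measure_ge0 andbT; apply: le_trans U0.
    apply: le_measure; rewrite ?inE//; first exact: open_measurable.
    move=> y /=; rewrite in_itv/= => /andP[y1 y2]; apply: xU.
    by rewrite /ball/= ltr_norml; apply/andP; split; lra.
  by rewrite eqxx; apply/andP; split.
have mN : measurable (`]-oo, 0[%classic : set (measurableTypeR R)) by exact: measurable_itv.
by apply/(measure_negligible mN); exact: negligibleS F0.
Qed.

Section Density.
Context {R : realType} (p n : nat) (S : 'M[R]_(p, n)).
Hypothesis p0 : (0 < p)%N.
Hypothesis S_ge0 : forall i k, 0 <= S i k.
Variables (m : R[i] -> 'cV[R[i]]_p) (nu : probability (measurableTypeR R) R).
Variables s : R.
Hypothesis msol : is_solution S m.
Hypothesis mnu : represents s m nu.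
Hypothesis SB : assumptionB S.
Local Notation mu := (@lebesgue_measure R).
Local Notation eps k := ((k.+1%:R : R)^-1).
Implicit Types (x y e a b : R).

Let eps01 k : 0 < eps k <= 1.
Proof. by rewrite invr_gt0 ltr0n/= invf_le1// ler1n. Qed.

Lemma poisson_int_im_sum e x : 0 < e ->
  poisson_int nu e x = p%:R^-1 * im_sum m (x +i* e).
Proof.
move=> e0; have [_ /(_ (x +i* e) e0)/(congr1 (@complex.Im R))] := mnu.
rewrite /vmean; have -> : (p%:R : R[i])^-1 = (p%:R^-1 : R)%:C.
  by rewrite fmorphV rmorph_nat.
by rewrite ImZ Im_sum => ->.
Qed.

Lemma poisson_int_cube a b : 0 < a -> exists2 C : R, 0 <= C &
  forall x e x' e', a <= x <= b -> 0 < e <= 1 -> a <= x' <= b -> 0 < e' <= 1 ->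
  `|poisson_int nu e x - poisson_int nu e' x'| ^+ 3 <= C * (`|x - x'| + `|e - e'|).
Proof.
move=> a0; have [C hC] := cube_lipschitz S_ge0 msol b SB a0.
exists `|C| => // x e x' e' xab e1 xab' e1'.
have /andP[e0 _] := e1; have /andP[e0' _] := e1'.
rewrite !poisson_int_im_sum// -mulrBr normrM exprMn.
apply: le_trans (_ : `|im_sum m (x +i* e) - im_sum m (x' +i* e')| ^+ 3 <= _).
  rewrite ler_piMl ?exprn_ge0// exprn_ile1// ger0_norm ?invr_ge0//.
  by rewrite invf_le1 ?ltr0n// ler1n.
apply: le_trans (hC (x +i* e) (x' +i* e') xab e1 xab' e1') _.
apply: le_trans (_ : `|C| * cabs ((x +i* e) - (x' +i* e')) <= _).
  by apply: ler_wpM2r (ler_norm _); exact: cabs_ge0.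
apply: ler_wpM2l => //; apply: le_trans (cabs_le_ReIm _) _.
by [].
Qed.

(** Comparison with height [1] keeps the Poisson integrals bounded, so an ultrafilter limit can
    serve to define [L]. Sending the second height to [0] in [poisson_int_cube] then gives
    convergence at a rate for all [e], so the choice of ultrafilter is immaterial. *)
Lemma density_limit : exists L : R -> R, (forall x, 0 < x -> 0 <= L x) /\
  forall a b, 0 < a -> exists C : R,
  (forall x e, a <= x <= b -> 0 < e <= 1 -> `|poisson_int nu e x - L x| ^+ 3 <= C * e) /\
  (forall x y, a <= x <= b -> a <= y <= b -> `|L x - L y| ^+ 3 <= C * `|x - y|).
Proof.
have [U [UU Uoo]] := ultraFilterLemma (@eventually_filter).
have PU : ProperFilter U := @ultra_proper _ _ UU.
have /choice[L hL] : forall x, exists l : R, 0 < x ->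
    (fun k => poisson_int nu (eps k) x) @ U --> l.
  move=> x; have [x0|x0] := ltP 0 x; last by exists 0.
  have [C C0 hC] := poisson_int_cube x x0.
  have xx : x <= x <= x by rewrite lexx.
  have o1 : (0 : R) < (1 : R) <= (1 : R) by rewrite ltr01 lexx.
  pose M := C + 1.
  have [k|l hl] := @bounded_ultra_cvg _ U UU (fun k => poisson_int nu (eps k) x)
    (poisson_int nu 1 x - M) (poisson_int nu 1 x + M); last by exists l.
  rewrite -ler_distl; apply: cube_le_bound.
  have hk := hC x _ x _ xx (eps01 k) xx o1.
  apply: (le_trans hk).
  have /andP[e0 e1] := eps01 k.
  rewrite subrr normr0 add0r ler_piMr// ler_norml lerBrDl subrr ltW//=.
  by rewrite lerBlDr (le_trans e1)// lerDl.
have eps0 : (fun k => eps k) @ U --> (0 : R).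
  have h : (fun k => eps k) @ \oo --> (0 : R) by exact: cvg_harmonic.
  by apply: cvg_trans h; apply: cvg_app; exact: Uoo.
have cub (f : nat -> R) l : f @ U --> l -> (fun k => `|f k| ^+ 3) @ U --> `|l| ^+ 3.
  by move=> /cvg_norm h; exact: (continuous_cvg _ (@exprn_continuous R 3 _) h).
exists L; split=> [x x0|a b a0].
  have h1 : (fun _ : nat => 0 : R) @ U --> (0 : R) by exact: cvg_cst.
  apply: (ler_cvg_to h1 (hL x x0)); apply: nearW => k; have /andP[e0 _] := eps01 k.
  by apply: Rintegral_ge0 => w _; exact: poisson_ge0.
have [C C0 hC] := poisson_int_cube b a0; exists C; split.
  move=> x e /[dup] xab /andP[ax xb] e01; have x0 := lt_le_trans a0 ax.
  have /andP[e0 _] := e01.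
  have h1 : (fun k => `|poisson_int nu e x - poisson_int nu (eps k) x| ^+ 3) @ U -->
      `|poisson_int nu e x - L x| ^+ 3.
    by apply: cub; apply: cvgB; [exact: cvg_cst|exact: hL].
  have h2 : (fun k => C * (e + eps k)) @ U --> C * (e + 0).
    by apply: cvgM (cvg_cst _) (cvgD (cvg_cst _) eps0).
  rewrite addr0 in h2; apply: (ler_cvg_to h1 h2); apply: nearW => k.
  have /andP[k0 _] := eps01 k.
  apply: le_trans (hC x e x _ xab e01 xab (eps01 k)) _.
  rewrite subrr normr0 add0r ler_wpM2l//; apply: le_trans (ler_normB _ _) _.
  by rewrite !gtr0_norm.
move=> x y /[dup] xab /andP[ax xb] /[dup] yab /andP[ay yb].
have x0 := lt_le_trans a0 ax; have y0 := lt_le_trans a0 ay.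
have h1 : (fun k => `|poisson_int nu (eps k) x - poisson_int nu (eps k) y| ^+ 3) @ U -->
    `|L x - L y| ^+ 3.
  by apply: cub; apply: cvgB; exact: hL.
have h2 : (fun _ : nat => C * `|x - y|) @ U --> C * `|x - y| by exact: cvg_cst.
apply: (ler_cvg_to h1 h2); apply: nearW => k.
apply: le_trans (hC x _ y _ xab (eps01 k) yab (eps01 k)) _.
by rewrite subrr normr0 addr0.
Qed.

End Density.

Section CubeHolder.
Context {R : realType} (L : R -> R).
Hypothesis cubeL : forall a b, 0 < a -> exists C : R,
  forall x y, a <= x <= b -> a <= y <= b -> `|L x - L y| ^+ 3 <= C * `|x - y|.

Lemma cube_locally_holder : locally_holder `]0, +oo[ L.
Proof.
exists 3%:R^-1; split.
  by rewrite invr_gt0 ltr0n/= invf_le1// ler1n.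
move=> K cK Kpos.
have [->|/set0P K0] := eqVneq K set0; first by exists 0.
have cid : {within K, continuous (@id R)}.
  by apply: continuous_subspaceT => x; exact: cvg_id.
(* The extrema of [K] enclose it in an interval [[a, b]] with [a > 0], where the cubed estimate
   applies. *)
have [a /set_mem Ka amin] := compact_EVT_min K0 cK cid.
have [b /set_mem Kb bmax] := compact_EVT_max K0 cK cid.
have a0 : 0 < a by have := Kpos a Ka; rewrite /= in_itv/= andbT.
(* After cubing, the constant has to dominate [C] through its third power; a number at least [1] is
   below its own cube. *)
have [C hC] := cubeL b a0; exists (`|C| + 1) => x y Kx Ky.
have Kab z : K z -> a <= z <= b.
  by move=> Kz; rewrite amin ?bmax ?inE.
have C1 : 1 <= `|C| + 1 by rewrite lerDr.
have C0 : 0 <= `|C| + 1 by rewrite addr_ge0.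
rewrite -(@ler_pXn2r _ 3)// ?nnegrE ?mulr_ge0 ?powR_ge0//.
rewrite exprMn -(powR_mulrn _ (powR_ge0 _ _)) -powRrM mulVf ?pnatr_eq0// powRr1//.
apply: le_trans (hC x y (Kab x Kx) (Kab y Ky)) _; apply: ler_wpM2r => //.
apply: le_trans (_ : `|C| + 1 <= _); first by apply: le_trans (ler_norm _) _; rewrite lerDl.
by rewrite exprS ler_peMr// expr_ge1.
Qed.

End CubeHolder.

Section DensityMeasurable.
Context {R : realType} (nu : probability (measurableTypeR R) R) (L : R -> R).
Local Notation mu := (@lebesgue_measure R).
Hypothesis PL : forall a b, 0 < a -> exists C : R,
  (forall x e, a <= x <= b -> 0 < e <= 1 -> `|poisson_int nu e x - L x| ^+ 3 <= C * e) /\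
  (forall x y, a <= x <= b -> a <= y <= b -> `|L x - L y| ^+ 3 <= C * `|x - y|).
Hypothesis L0 : forall x, 0 < x -> 0 <= L x.

Let P : set (measurableTypeR R) := `]0, +oo[%classic.
Let mP : measurable P. Proof. exact: measurable_itv. Qed.
Let f x : R := L x / pi * \1_P x.

Let f_patch : f = (fun x => L x / pi) \_ P.
Proof.
apply/funext => x; rewrite /f /patch indicE.
by case: (x \in P); rewrite ?mulr1 ?mulr0.
Qed.

Lemma measurable_density : measurable_fun setT (f : measurableTypeR R -> R).
Proof.
rewrite f_patch; apply/(measurable_restrictT _ mP); apply: measurable_funM => //.
pose F k : set (measurableTypeR R) := `[k.+1%:R^-1, k%:R]%classic.
have mF k : measurable (F k) by exact: measurable_itv.
have -> : P = \bigcup_k F k.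
  apply/seteqP; split=> [x|x [k _]]; rewrite /P /F /= !in_itv/= ?andbT; last first.
    by move=> /andP[kx _]; apply: lt_le_trans kx; rewrite invr_gt0.
  move=> x0; exists (maxn (Num.truncn x^-1) (Num.truncn x).+1) => //=.
  rewrite in_itv/=; apply/andP; split; last first.
    by apply: (le_trans (ltW (truncnS_gt x))); rewrite ler_nat leq_maxr.
  rewrite -[leRHS]invrK lef_pV2 ?posrE ?invr_gt0//.
  by apply: (le_trans (ltW (truncnS_gt _))); rewrite ler_nat ltnS leq_maxl.
apply/(measurable_fun_bigcup _ mF) => k.
apply: subspace_continuous_measurable_fun; first exact: mF.
by apply: (L_continuous_within PL); rewrite invr_gt0.
Qed.

Lemma density_itv a b : 0 < a -> a < b ->
  nu `]a, b]%classic = (\int[mu]_(x in `]a, b]) (f x)%:E)%E.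
Proof.
move=> a0 ab; have b0 := lt_trans a0 ab.
have mf := measurable_density.
have mab : measurable (`[a, b]%classic : set (measurableTypeR R)) by exact: measurable_itv.
have mo : measurable (`]a, b[%classic : set (measurableTypeR R)) by exact: measurable_itv.
have nb := no_positive_atom PL b0.
have -> : nu `]a, b]%classic = nu `]a, b[%classic.
  have -> : (`]a, b]%classic : set (measurableTypeR R)) = `]a, b[%classic `|` [set b].
    by rewrite setUitv1// bnd_simp.
  rewrite measureU//; last first.
    by apply/seteqP; split=> // x [/= h xb]; move: h; rewrite xb in_itv/= ltxx andbF.
  apply: etrans (adde0 _); congr (_ + _)%E; exact: nb.
rewrite integral_itv_obnd_cbnd; last by apply/measurable_EFinP; exact: measurable_funTS.
have -> : (\int[mu]_(x in `[a, b]) (f x)%:E)%E =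
    (\int[mu]_(x in `[a, b]) ((pi^-1)%:E * (L x)%:E))%E.
  apply: eq_integral => x; rewrite inE/= in_itv/= => /andP[ax _].
  rewrite /f indicE mem_set ?mulr1 1?mulrC//.
  by rewrite /P/= in_itv/= andbT (lt_le_trans a0).
rewrite ge0_integralZl_EFin//; first last.
- by rewrite invr_ge0 pi_ge0.
- apply/measurable_EFinP; apply: subspace_continuous_measurable_fun => //.
  exact: (L_continuous_within PL).
- by move=> x; rewrite /= in_itv/= => /andP[ax _]; rewrite lee_fin L0// (lt_le_trans a0).
rewrite (stieltjes_inversion PL a0 ab) muleA -EFinM mulVf ?mul1e//.
by rewrite gt_eqF// pi_gt0.
Qed.

(** [A] is cut into its parts at [0], on the positive and on the negative half-line; these carry the
    point mass, the density and nothing. *)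
Lemma density_decomposition : nu `]-oo, 0[%classic = 0%E ->
  forall A : set (measurableTypeR R), measurable A ->
  (nu A = (fine (nu [set 0%R]))%:E * \d_(0%R : measurableTypeR R) A +
          \int[mu]_(x in A) (f x)%:E)%E.
Proof.
move=> nuN A mA.
have mN : measurable (`]-oo, 0[%classic : set (measurableTypeR R)) by exact: measurable_itv.
have m0 : measurable ([set 0] : set (measurableTypeR R)) by exact: measurable_set1.
have f0 x : 0 <= f x.
  rewrite /f indicE; have [/set_mem|_] := boolP (x \in P); last by rewrite mulr0.
  rewrite /P /= in_itv/= andbT => x0.
  by rewrite mulr1 divr_ge0 ?pi_ge0// L0.
have fneg x : x <= 0 -> f x = 0.
  by move=> x0; rewrite /f indicE memNset ?mulr0// /P/= in_itv/= andbT => /lt_geF; rewrite x0.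
have <- := density_unique measurable_density f0 fneg density_itv mA.
have -> : nu A = (nu (A `&` [set 0%R]) + nu (A `&` P))%E.
  have mA0 := measurableI _ _ mA m0; have mAP := measurableI _ _ mA mP.
  have mAN := measurableI _ _ mA mN.
  have AE : A = ((A `&` [set 0]) `|` (A `&` P)) `|` (A `&` `]-oo, 0[%classic).
    rewrite -!setIUr; apply/esym/setIidl => x _ /=; rewrite /P /= !in_itv/= andbT.
    by case: (ltgtP x 0) => h; [right|left; right|left; left].
  rewrite {1}AE measureU//; [|exact: measurableU|]; last first.
    apply/seteqP; split=> // x [[[_ /= x0]|[_ xP]] [_ /=]]; rewrite in_itv/=.
      by rewrite x0 ltxx.
    by move: xP; rewrite /P/= in_itv/= andbT => x0 /(lt_trans x0); rewrite ltxx.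
  rewrite measureU//; last first.
    by apply/seteqP; split=> // x [[_ /= x0] [_]]; rewrite x0 /P /= in_itv/= ltxx.
  apply: etrans (adde0 _); congr (_ + _)%E.
  by apply: (subset_measure0 mAN mN _ nuN); exact: subIsetr.
congr (_ + _)%E; rewrite fineK; last exact: fin_num_measure.
rewrite diracE; have [A0|A0] := boolP (0 \in A).
  by rewrite mule1; congr (nu _); apply/setIidr => x ->; exact: set_mem.
rewrite mule0; have -> : A `&` [set 0] = set0; last exact: measure0.
by apply/seteqP; split=> // x [Ax /= x0]; move: A0; rewrite -x0 (mem_set Ax).
Qed.

End DensityMeasurable.

Theorem theorem2p1 (R : realType) (p n : nat) (p_gt0 : (0 < p)%N)
    (n_gt0 : (0 < n)%N) (S : 'M[R]_(p, n)) (S_ge0 : forall i k, 0 <= S i k) :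
  (forall s : R, assumptionA S s ->
    exists m : R[i] -> 'cV[R[i]]_p,
      [/\ is_solution S m,
          forall m' : R[i] -> 'cV[R[i]]_p, is_solution S m' ->
            forall z, upper_half_plane z -> m' z = m z
        & exists nu : probability (measurableTypeR R) R, represents s m nu]) /\
  (forall s : R, assumptionA S s -> assumptionB S -> assumptionD R p n ->
    forall (m : R[i] -> 'cV[R[i]]_p) (nu : probability (measurableTypeR R) R),
      is_solution S m -> represents s m nu ->
      exists (pi0 : R) (dens : R -> R),
        [/\ 0 <= pi0 <= 1,
            forall x, 0 < x -> 0 <= dens x,
            locally_holder `]0, +oo[ dens
          & forall A : set (measurableTypeR R), measurable A ->
              (nu A = pi0%:E * \d_(0%R : measurableTypeR R) A
                 + \int[lebesgue_measure]_(x in A)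
                     (dens x * \1_(`]0, +oo[ : set R) x)%R%:E)%E]).
Proof.
split=> [s sA|s _ SB _ m nu msol mnu].
  have [m [msol hnu]] := solution_exists S_ge0 p_gt0 sA.
  by exists m; split=> // m' msol' z z0; exact: (is_solution_unique S_ge0 msol msol' z0).
have [L [L0 PL]] := density_limit p_gt0 S_ge0 msol mnu SB.
have cubeL a b : 0 < a -> exists C : R,
    forall x y, a <= x <= b -> a <= y <= b -> `|L x / pi - L y / pi| ^+ 3 <= C * `|x - y|.
  move=> a0; have [C [_ hC]] := PL a b a0; exists (C * `|pi^-1| ^+ 3) => x y xab yab.
  rewrite -mulrBl normrM exprMn [leRHS]mulrAC ler_wpM2r ?exprn_ge0//.
  exact: hC.
exists (fine (nu [set 0%R])), (fun x => L x / pi); split.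
- have m0 : measurable ([set 0] : set (measurableTypeR R)) by exact: measurable_set1.
  rewrite fine_ge0//= -lee_fin fineK ?probability_le1//; exact: fin_num_measure.
- by move=> x x0; rewrite divr_ge0 ?pi_ge0 ?L0.
- exact: cube_locally_holder.
- have [hsupp _] := mnu.
  exact: (density_decomposition PL L0 (null_negative_halfline hsupp)).
Qed.
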